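(* Let $s\in(0,1)$, $d>2s$, $1\le p\leq2$, $\frac1p+\frac1q=1$ and $q>\frac{d}{2s}$. Let $\Omega\subset\mathbb{R}^d$ be an open bounded set with Lipschitz boundary satisfying the exterior ball condition, let $\mathcal{H}$ be a Hilbert space, and let $A:L^p(\Omega)\to\mathcal{H}$ be a bounded linear operator such that its adjoint $A^*$ maps $\mathcal{H}$ to $L^q(\Omega)$ compactly and $\mathcal{H}$ to $L^\infty(\Omega)$ continuously. Let $u^\dagger\in L^p(\Omega)$ with $u^\dagger\geq0$ and $Au^\dagger=f$, and assume that the source condition $A^*z\in\partial_{L^p}\big[\tfrac12|\cdot|_{H^s}^2\big](u^\dagger)$ holds for some $z\in\mathcal{H}$. For $\alpha>0$ and $n\in\mathcal{H}$ let $u_{\alpha,n}$ be the unique minimizer over $H^s_0(\overline\Omega)$ of $$u\mapsto\|Au-f-n\|_{\mathcal{H}}^2+\alpha\,|u|_{H^s}^2 .$$ Then for almost every $\theta>0$ and all $\varepsilon>0$ we have, as $\|n\|_{\mathcal{H}}\to0$ and $\alpha\to0$ with $\|n\|_{\mathcal{H}}/\alpha\leq C$ for a fixed constant $C$, that $$\sup_{x\in\{u_{\alpha,n}>\theta\}}d\big(x,\{u^\dagger\geq\theta-\varepsilon\}\big)\to0\quad\text{and}\quad\sup_{x\in\{u_{\alpha,n}\leq\theta\}}d\big(x,\{u^\dagger\leq\theta+\varepsilon\}\big)\to0 .$$ Moreover, if for almost every $\theta\in\mathbb{R}\setminus\{0\}$ the set $\{u^\dagger>\theta\}$ satisfies inner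 and outer density estimates, then the Hausdorff convergence $$d_H\big(\partial\{u_{\alpha,n}>\theta\},\partial\{u^\dagger>\theta\}\big)\to0$$ holds for almost every $\theta\in\mathbb{R}\setminus\{0\}$ for which $$\lim_{\varepsilon\to0}d_H\big(\{u^\dagger\geq\theta-\varepsilon\},\{u^\dagger>\theta\}\big)=0 .$$
   Context: For measurable $u:\mathbb{R}^d\to\mathbb{R}$, $|u|_{H^s}^2:=\int_{\mathbb{R}^d}\int_{\mathbb{R}^d}\frac{|u(x)-u(y)|^2}{|x-y|^{d+2s}}\,dx\,dy\in[0,+\infty]$, always computed on the whole space. $H^s_0(\overline\Omega):=\{u:\mathbb{R}^d\to\mathbb{R}\mid u=0\text{ on }\mathbb{R}^d\setminus\Omega,\ |u|_{H^s}<+\infty\}$. Functions in $L^p(\Omega)$ are identified with their extension by zero to $\mathbb{R}^d$; $(L^p(\Omega))'=L^q(\Omega)$. Subgradient: for $u\in L^p(\Omega)$ with $|u|_{H^s}<+\infty$ and $v\in L^q(\Omega)$, $v\in\partial_{L^p}\big[\frac12|\cdot|^2_{H^s}\big](u)$ if and only if $\frac12|u+h|_{H^s}^2\geq\frac12|u|_{H^s}^2+\int_\Omega v\,h$ for all $h\in L^p(\Omega)$. Exterior ball condition: there is a radius such that every point of $\partial\Omega$ can be touched by a ball of this radius contained in $\mathbb{R}^d\setminus\Omega$. A set $E\subset\mathbb{R}^d$ satisfies (inner and outer) density estimates if there are $C_E\in(0,1)$ and $r_0\in(0,1)$ such that $\frac{|E\cap B(x,r)|}{|B(x,r)|}\geq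 C_E$ and $\frac{|B(x,r)\setminus E|}{|B(x,r)|}\geq C_E$ for all $r\leq r_0$ and all $x\in\partial E$. $d(x,E):=\inf_{y\in E}|x-y|$ and $d_H(E,F):=\max\big(\sup_{x\in E}d(x,F),\ \sup_{y\in F}d(y,E)\big)$, with $\sup\emptyset=0$, $\inf\emptyset=+\infty$. Level sets are subsets of $\mathbb{R}^d$ and refer to the continuous representatives of $u^\dagger$ and $u_{\alpha,n}$ (both are continuous, being weak solutions of fractional Dirichlet problems with bounded right-hand side), which vanish outside $\Omega$. *)

(* Defs.v *)
From HB Require Import structures.
From mathcomp Require Import all_boot all_order all_algebra.
From mathcomp Require Import all_classical all_reals all_analysis.

Set Implicit Arguments.
Unset Strict Implicit.
Unset Printing Implicit Defensive.

Import Order.TTheory GRing.Theory Num.Theory.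
Import numFieldNormedType.Exports.

Local Open Scope classical_set_scope.
Local Open Scope ring_scope.

(** R^d is ['rV[R]_d].  Its library topology is that of the sup-norm, i.e. the
    usual one; distances and balls are taken in the Euclidean norm [enorm]. *)

Definition dotv (R : realType) d (x y : 'rV[R]_d) : R :=
  \sum_(i < d) x ord0 i * y ord0 i.

Definition enorm (R : realType) d (x : 'rV[R]_d) : R := Num.sqrt (dotv x x).

Definition eball (R : realType) d (c : 'rV[R]_d) (r : R) : set 'rV[R]_d :=
  [set x | enorm (x - c) < r].

Definition boundary (T : topologicalType) (E : set T) : set T :=
  closure E `\` interior E.

(** The Borel sigma-algebra of R^d, presented as the product sigma-algebra
    (as the library does for tuples). *)

Definition rV_display : measure_display -> measure_display.
Proof. exact. Qed.

Section measurable_rV.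
Context (R : realType) (n : nat).

Let coors : 'I_n -> 'rV[R]_n -> measurableTypeR R := fun i x => x ord0 i.

Let rV_set0 : g_sigma_preimage coors set0.
Proof. exact: sigma_algebra0. Qed.

Let rV_setC A : g_sigma_preimage coors A -> g_sigma_preimage coors (~` A).
Proof. exact: sigma_algebraC. Qed.

Let rV_bigcup (F : _^nat) : (forall i, g_sigma_preimage coors (F i)) ->
  g_sigma_preimage coors (\bigcup_i (F i)).
Proof. exact: sigma_algebra_bigcup. Qed.

HB.instance Definition _ := @isMeasurable.Build (rV_display default_measure_display)
  'rV[R]_n (g_sigma_preimage coors) rV_set0 rV_setC rV_bigcup.

End measurable_rV.

Lemma measurable_coord (R : realType) n (i : 'I_n) :
  measurable_fun [set: 'rV[R]_n] (fun x => x ord0 i : measurableTypeR R).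
Proof.
move=> _ Y mY; rewrite setTI; apply: sub_sigma_algebra => /=.
rewrite -bigcup_seq/=; exists i => /=; first by rewrite mem_index_enum.
by exists Y => //; rewrite setTI.
Qed.

Lemma measurable_rV d (T : measurableType d) (R : realType) n
    (f : T -> 'rV[R]_n) :
  (forall i, measurable_fun setT (fun t => f t ord0 i : measurableTypeR R)) ->
  measurable_fun setT f.
Proof.
move=> mf; have : g_sigma_preimage (fun i t => f t ord0 i : measurableTypeR R)
    `<=` measurable.
  apply: smallest_sub; first exact: sigma_algebra_measurable.
  case: n => [|n] in f mf *; first by rewrite big_ord0.
  rewrite -bigcup_mkord_ord; apply: bigcup_sub => i Ii.
  by move=> A [B mB <-]; exact: mf.
rewrite (g_sigma_preimage_comp
  (fun i (x : 'rV[R]_n) => x ord0 i : measurableTypeR R) f) => prefS.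
by move=> _ A mA; apply: prefS; exists A.
Qed.

(** The Lebesgue measure of R^d, by recursion on d: the Dirac mass on the point
    R^0, then the image of the product of the Lebesgue measures of R and R^n
    under [rV_cons : R * R^n -> R^(n+1)]. *)

Definition rV_cons (R : realType) n (p : measurableTypeR R * 'rV[R]_n) :
    'rV[R]_n.+1 :=
  \row_i (if unlift ord0 i is Some j then p.2 ord0 j else p.1).

Definition rV_uncons (R : realType) n (x : 'rV[R]_n.+1) :
    measurableTypeR R * 'rV[R]_n :=
  (x ord0 ord0, \row_j x ord0 (lift ord0 j)).

Lemma rV_consK (R : realType) n : cancel (@rV_cons R n) (@rV_uncons R n).
Proof.
move=> [a v]; rewrite /rV_uncons /rV_cons !mxE unlift_none; congr pair.
by apply/rowP => j; rewrite !mxE liftK.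
Qed.

Lemma measurable_rV_cons (R : realType) n :
  measurable_fun setT (@rV_cons R n).
Proof.
apply: measurable_rV => i; case: (unliftP ord0 i) => [j|] ->.
- rewrite (_ : (fun _ => _) =
    (fun x : 'rV[R]_n => x ord0 j : measurableTypeR R) \o snd).
    by apply: measurableT_comp => //; exact: measurable_coord.
  by apply/funext => p /=; rewrite mxE liftK.
- rewrite (_ : (fun _ => _) = fst)//.
  by apply/funext => p /=; rewrite mxE unlift_none.
Qed.

Lemma measurable_rV_uncons (R : realType) n :
  measurable_fun setT (@rV_uncons R n).
Proof.
apply/measurable_fun_pairP; split => /=.
  exact: measurable_coord.
apply: measurable_rV => i.
under eq_fun do rewrite mxE.
exact: measurable_coord.
Qed.

Section leb_step.
Context (R : realType) (n : nat).
Variable m : {sigma_finite_measure set 'rV[R]_n -> \bar R}.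

Definition leb_step : set 'rV[R]_n.+1 -> \bar R :=
  pushforward (lebesgue_measure \x m)%E (@rV_cons R n).

Let leb_step0 : leb_step set0 = 0%E.
Proof. by rewrite /leb_step /pushforward preimage_set0 measure0. Qed.

Let leb_step_ge0 A : (0 <= leb_step A)%E.
Proof. exact: (measure_ge0 (lebesgue_measure \x m)%E). Qed.

Let leb_step_sigma_additive : semi_sigma_additive leb_step.
Proof.
move=> F mF tF mUF; rewrite /leb_step /pushforward preimage_bigcup.
apply: measure_semi_sigma_additive.
- by move=> k; rewrite -[X in measurable X]setTI; exact: measurable_rV_cons.
- apply/trivIsetP => /= i j _ _ ij; rewrite -preimage_setI.
  by move/trivIsetP : tF => /(_ _ _ _ _ ij) ->//; rewrite preimage_set0.
- by rewrite -preimage_bigcup -[X in measurable X]setTI;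
    exact: measurable_rV_cons.
Qed.

HB.instance Definition _ := isMeasure.Build _ _ _ leb_step
  leb_step0 leb_step_ge0 leb_step_sigma_additive.

Let leb_step_sigma_finite : sigma_finite setT leb_step.
Proof.
have /sigma_finiteP[F [TF ndF Foo]] := sigma_finiteT (@lebesgue_measure R).
have /sigma_finiteP[G [TG ndG Goo]] := sigma_finiteT m.
exists (fun k => @rV_uncons R n @^-1` (F k `*` G k)).
  rewrite -preimage_bigcup (_ : \bigcup_k (F k `*` G k) = setT).
    by rewrite preimage_setT.
  rewrite -subTset => -[x y] _.
  have [k _ Fkx] : (\bigcup_k F k) x by rewrite -TF.
  have [l _ Gly] : (\bigcup_k G k) y by rewrite -TG.
  exists (maxn k l) => //; split => /=.
  - by move: x Fkx; exact/subsetPset/ndF/leq_maxl.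
  - by move: y Gly; exact/subsetPset/ndG/leq_maxr.
move=> k; have [mFk Fkoo] := Foo k; have [mGk Gkoo] := Goo k; split.
  rewrite -[X in measurable X]setTI; apply: measurable_rV_uncons => //.
  exact: measurableX.
rewrite /leb_step /pushforward -comp_preimage.
rewrite (_ : _ \o _ = id); last by apply/funext => p /=; rewrite rV_consK.
by rewrite preimage_id product_measure1E// lte_mul_pinfty// ge0_fin_numE.
Qed.

HB.instance Definition _ := Measure_isSigmaFinite.Build _ _ _ leb_step
  leb_step_sigma_finite.

End leb_step.

Fixpoint leb (R : realType) (d : nat) :
    {sigma_finite_measure set 'rV[R]_d -> \bar R} :=
  match d with
  | 0 => [the {sigma_finite_measure set 'rV[R]_0 -> \bar R} of dirac (0 : 'rV[R]_0)]
  | n.+1 => [the {sigma_finite_measure set 'rV[R]_n.+1 -> \bar R} of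
               leb_step (leb R n)]
  end.

Lemma measurable_box (R : realType) d (A : 'I_d -> set (measurableTypeR R)) :
  (forall i, measurable (A i)) ->
  measurable [set x : 'rV[R]_d | forall i, A i (x ord0 i)].
Proof.
move=> mA; rewrite (_ : [set x | _] = \big[setI/setT]_(i < d)
  ((fun x : 'rV[R]_d => x ord0 i : measurableTypeR R) @^-1` A i)).
  apply: bigsetI_measurable => i _; rewrite -[X in measurable X]setTI.
  exact: measurable_coord.
apply/seteqP; split => [x Ax|x].
  by elim/big_ind : _ => // i _; exact: Ax.
by rewrite -bigcap_seq => Ax i; apply: (Ax i); rewrite /= mem_index_enum.
Qed.

Lemma leb_box (R : realType) d (A : 'I_d -> set (measurableTypeR R)) :
  (forall i, measurable (A i)) ->
  leb R d [set x | forall i, A i (x ord0 i)] =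
    (\prod_(i < d) lebesgue_measure (A i))%E.
Proof.
elim: d A => [|d IH] A mA.
  rewrite big_ord0 /= diracE (_ : _ \in _ = true)//.
  by apply/mem_set => -[].
rewrite big_ord_recl -IH//=.
rewrite -product_measure1E//; last first.
  exact: (@measurable_box R d (fun j => A (lift ord0 j))).
rewrite /leb_step /pushforward; congr (_ _).
apply/seteqP; split => [[a v] /= h|[a v] /= [h1 h2] i].
  split => [|i]; first by have := h ord0; rewrite mxE unlift_none.
  by have := h (lift ord0 i); rewrite mxE liftK.
by rewrite mxE; case: (unliftP ord0 i) => [j|] ->.
Qed.

(** L^p(Omega), each class being represented by Borel functions on R^d that
    vanish outside Omega; p may be +oo.  Two functions denote the same element
    when they agree almost everywhere. *)
Definition LpO (R : realType) d (Om : set 'rV[R]_d) (p : \bar R) :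
    set ('rV[R]_d -> R) :=
  [set u | u \in Lfun (leb R d) p /\ forall x, ~ Om x -> u x = 0].

(** |u|_{H^s}^2.  The integrand is 0 on the diagonal, since 0 / 0 = 0. *)
Definition Hs_sq (R : realType) d (s : R) (u : 'rV[R]_d -> R) : \bar R :=
  (\int[leb R d]_x \int[leb R d]_y
     (`|u x - u y| ^+ 2 / enorm (x - y) `^ (d%:R + 2 * s))%:E)%E.

Definition Hs0 (R : realType) d (s : R) (Om : set 'rV[R]_d) :
    set ('rV[R]_d -> R) :=
  [set u : 'rV[R]_d -> R |
    [/\ measurable_fun setT u, forall x, ~ Om x -> u x = 0
      & (Hs_sq s u < +oo)%E]].

Definition subgradient (R : realType) d (s : R) (Om : set 'rV[R]_d)
    (p q : \bar R) (u v : 'rV[R]_d -> R) : Prop :=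
  [/\ LpO Om p u, (Hs_sq s u < +oo)%E, LpO Om q v
    & forall h, LpO Om p h ->
      (2^-1%:E * Hs_sq s u + \int[leb R d]_(x in Om) (v x * h x)%:E
        <= 2^-1%:E * Hs_sq s (fun x => u x + h x)%R)%E].

(** Near each boundary point, after an orthogonal change of coordinates [Q],
    Omega is the set lying above the graph of a Lipschitz function of the
    coordinates other than the [i]-th one. *)
Definition Lipschitz_boundary (R : realType) d (Om : set 'rV[R]_d) : Prop :=
  forall x0, boundary Om x0 ->
  exists (r : R) (Q : 'M[R]_d) (i : 'I_d) (g : 'rV[R]_d.-1 -> R) (L : R),
  [/\ 0 < r, Q *m Q^T = 1%:M,
      forall a b, `|g a - g b| <= L * enorm (a - b)
    & forall y, eball x0 r y ->
        (Om y <-> g (col' i (y *m Q)) < (y *m Q) ord0 i)].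

Definition exterior_ball (R : realType) d (Om : set 'rV[R]_d) : Prop :=
  exists2 r : R, 0 < r & forall x, boundary Om x ->
  exists2 c, enorm (x - c) = r & eball c r `<=` ~` Om.

Definition density_estimates (R : realType) d (E : set 'rV[R]_d) : Prop :=
  exists C r0 : R, [/\ 0 < C < 1, 0 < r0 < 1
    & forall r x, 0 < r <= r0 -> boundary E x ->
      (C%:E <= leb R d (E `&` eball x r) / leb R d (eball x r))%E /\
      (C%:E <= leb R d (eball x r `\` E) / leb R d (eball x r))%E].

Definition edist_to (R : realType) d (x : 'rV[R]_d) (E : set 'rV[R]_d) :
    \bar R :=
  ereal_inf [set (enorm (x - y))%:E | y in E].

(** sup_{x in E} d(x, F); 0 is added so that the supremum over the empty set
    is 0. *)
Definition excess (R : realType) d (E F : set 'rV[R]_d) : \bar R :=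
  ereal_sup ([set edist_to x F | x in E] `|` [set 0%E]).

Definition dH (R : realType) d (E F : set 'rV[R]_d) : \bar R :=
  Order.max (excess E F) (excess F E).

(** The norm of [H] is the one of the inner product [dot]: with completeness of
    [H], this makes [H] a real Hilbert space. *)
Definition inner_product (R : realType) (H : normedModType R)
    (dot : H -> H -> R) : Prop :=
  [/\ forall x y, dot x y = dot y x,
      forall a x y z, dot (a *: x + y) z = a * dot x z + dot y z
    & forall x, dot x x = `|x| ^+ 2].

(** [A] is given on all functions, but only its values on L^p(Omega) are
    constrained.  Linearity and boundedness force [A u = A v] when [u] and [v]
    agree almost everywhere. *)
Definition bounded_linear_LpO (R : realType) d (Om : set 'rV[R]_d)
    (p : \bar R) (H : normedModType R) (A : ('rV[R]_d -> R) -> H) : Prop :=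
  (forall a u v, LpO Om p u -> LpO Om p v ->
     A (fun x => a * u x + v x) = a *: A u + A v) /\
  exists M : R, forall u, LpO Om p u ->
    (`|A u|%:E <= M%:E * 'N[leb R d]_p[EFin \o u])%E.

(** [As] is the adjoint of [A], with values in L^q(Omega) = (L^p(Omega))'. *)
Definition is_adjoint (R : realType) d (Om : set 'rV[R]_d) (p q : \bar R)
    (H : normedModType R) (dot : H -> H -> R) (A : ('rV[R]_d -> R) -> H)
    (As : H -> 'rV[R]_d -> R) : Prop :=
  forall h, LpO Om q (As h) /\
    forall u, LpO Om p u ->
      (\int[leb R d]_(x in Om) (As h x * u x)%:E)%E = (dot h (A u))%:E.

Definition compact_to_LpO (R : realType) d (Om : set 'rV[R]_d) (q : \bar R)
    (H : normedModType R) (T : H -> 'rV[R]_d -> R) : Prop :=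
  forall h : nat -> H, (exists M : R, forall k, `|h k| <= M) ->
  exists (phi : nat -> nat) (v : 'rV[R]_d -> R),
  [/\ {homo phi : j k / (j < k)%N}, LpO Om q v
    & ('N[leb R d]_q[EFin \o (fun x => T (h (phi k)) x - v x)%R])%E
        @[k --> \oo] --> 0%E].

(** For a linear [T] this is continuity H -> L^q(Omega). *)
Definition bounded_to_LpO (R : realType) d (Om : set 'rV[R]_d) (q : \bar R)
    (H : normedModType R) (T : H -> 'rV[R]_d -> R) : Prop :=
  exists M : R, forall h, LpO Om q (T h) /\
    ('N[leb R d]_q[EFin \o T h] <= (M * `|h|)%:E)%E.

Definition tikhonov (R : realType) d (s : R) (H : normedModType R)
    (A : ('rV[R]_d -> R) -> H) (f : H) (alpha : R) (n : H)
    (u : 'rV[R]_d -> R) : \bar R :=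
  ((`|A u - f - n| ^+ 2)%:E + alpha%:E * Hs_sq s u)%E.

Definition is_minimizer (R : realType) d (s : R) (Om : set 'rV[R]_d)
    (H : normedModType R) (A : ('rV[R]_d -> R) -> H) (f : H)
    (alpha : R) (n : H) (u : 'rV[R]_d -> R) : Prop :=
  Hs0 s Om u /\ forall v, Hs0 s Om v ->
    (tikhonov s A f alpha n u <= tikhonov s A f alpha n v)%E.

Definition continuous_rep (R : realType) d (u v : 'rV[R]_d -> R) : Prop :=
  continuous v /\ {ae leb R d, forall x, v x = u x}.

(** ||n|| -> 0 and alpha -> 0 with alpha > 0 and ||n|| / alpha <= C, for the
    pair (alpha, n). *)
Definition small_noise (R : realType) (H : normedModType R) (C : R) :
    set_system (R * H) :=
  within [set an : R * H | 0 < an.1 /\ `|an.2| / an.1 <= C]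
    (nbhs ((0, 0) : R * H)).

(* Main.v *)
Require Import Defs.
From HB Require Import structures.
From mathcomp Require Import all_boot all_order all_algebra.
From mathcomp Require Import all_classical all_reals all_analysis.
From mathcomp Require Import measurable_realfun ess_sup_inf.
From mathcomp Require Import ring lra.

Set Implicit Arguments.
Unset Strict Implicit.
Unset Printing Implicit Defensive.

Import Order.TTheory GRing.Theory Num.Theory.
Import numFieldNormedType.Exports.

Local Open Scope classical_set_scope.
Local Open Scope ring_scope.

(** Put P = (f + n - A u) / alpha, where u is the minimizer.  The optimality
    conditions say that w = u - ud is a weak solution of an equation
    (-Delta)^s w = A^* (P - z) vanishing outside Omega.  Testing it with w gives
    |P - z| <= |n| / alpha + |z| and |w|_{H^s}^2 = <P - z, n - alpha P>, so that
    w tends to 0 in H^s while its fractional Laplacian stays bounded in L^oo.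

    Write K(x, y) = |x - y|^-(d + 2 s).  If psi is a truncation of w at some
    level and E is a set on which w lies lambda below this level, then the
    quadratic form at (w, psi) is at least
    lambda \int psi(x) \int_E K(x, y) dy dx, and it is at most G \int psi when
    |(-Delta)^s w| <= G; hence psi = 0 as soon as lambda \int_E K(x, .) > G on
    {psi > 0}.  As K is singular, \int_E K(x, .) is of order r^(-2 s) when E
    fills a fixed proportion of a ball of radius r around x.  This replaces
    Sobolev embeddings and De Giorgi iterations, and yields the boundedness of
    w, its uniform smallness when |w|_{H^s} is small and, with a truncation level
    slightly bent by a paraboloid, its continuity up to the boundary: the essential
    upper and lower limits of w at a point must coincide.

    So u converges to ud uniformly, which gives the first two limits at once.
    Uniform convergence also makes the boundaries of the superlevel sets converge
    for every theta != 0 that is not the value of a local minimum or maximum of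
    ud, and the values of the local extrema of a function are countable. *)

(** * Lebesgue measure on R^d *)

(** The comparison principle is global, whereas essential upper limits give information near one
    point only; this shapes the continuity proof. With a bent level alone, the truncation would also
    live far from the point, wherever [w] is large. So [w] is first capped at a constant level, and
    the excess over the cap is carried separately as [m]. As [m] vanishes near the point, its
    influence costs a constant [tau]. Bending at scale r costs gamma r^(-2 s) up to a constant, and
    the gain is (g - gamma) r^(-2 s) up to another one, g being the gap below the upper limit. Hence
    the order of choice: gamma as a fraction of g, next the radius that fixes [tau], and r last.

    Balls of the library are cubes, which have an exact volume, while the kernel and the exterior
    balls are Euclidean; the factors d in the constants convert between the two. Everything on weak
    solutions holds almost everywhere, and pointwise statements are recovered only from continuity,
    an open negligible set being empty. *)

Section tonelli_curried.
Context d1 d2 (T1 : measurableType d1) (T2 : measurableType d2) (R : realType).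
Variables (m1 : {sigma_finite_measure set T1 -> \bar R})
  (m2 : {sigma_finite_measure set T2 -> \bar R}).
Variable f : T1 -> T2 -> \bar R.
Hypothesis mf : measurable_fun setT (fun z => f z.1 z.2).
Hypothesis f0 : forall x y, (0 <= f x y)%E.

Lemma ge0_measurable_integral : measurable_fun setT (fun x => \int[m2]_y f x y)%E.
Proof. exact: (measurable_fun_fubini_tonelli_F (fun z => f z.1 z.2)). Qed.

Lemma ge0_integral_prod :
  (\int[m1 \x m2]_z f z.1 z.2 = \int[m1]_x \int[m2]_y f x y)%E.
Proof. exact: (fubini_tonelli1 (fun z => f z.1 z.2)). Qed.

Lemma ge0_integral_swap :
  (\int[m1]_x \int[m2]_y f x y = \int[m2]_y \int[m1]_x f x y)%E.
Proof. exact: (fubini_tonelli (fun z => f z.1 z.2)). Qed.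

End tonelli_curried.
Arguments ge0_measurable_integral {d1 d2 T1 T2 R m2} f.
Arguments ge0_integral_prod {d1 d2 T1 T2 R m1 m2} f.
Arguments ge0_integral_swap {d1 d2 T1 T2 R m1 m2} f.

Section affine1.
Context (R : realType).
Variables (c t : R).
Hypothesis c0 : 0 < c.

Let phi : measurableTypeR R -> measurableTypeR R := fun x => c * x + t.

Let mphi : measurable_fun setT phi.
Proof. by apply: measurable_funD => //; exact: measurable_funM. Qed.

Let c_nng : {nonneg R} := NngNum (ltW c0).

Let push : {measure set (measurableTypeR R) -> \bar R} :=
  measure_function_pushforward__canonical__measure_function_Measure
    lebesgue_measure mphi.

(** Both sides are measures agreeing on half-open intervals, which determine Lebesgue measure. *)
Let lebesgue_measure_affine (A : set (measurableTypeR R)) : measurable A ->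
  lebesgue_measure A = mscale c_nng push A.
Proof.
move=> mA; apply: lebesgue_measure_unique => //= _ [[a b]] /= _ <-.
rewrite /mscale /= /pushforward.
rewrite (_ : phi @^-1` _ = `](a - t) / c, (b - t) / c]%classic); last first.
  apply/seteqP; split => x /=; rewrite !in_itv/= /phi.
    by rewrite ltr_pdivrMr// ler_pdivlMr// mulrC ltrBlDr lerBrDr.
  by rewrite ltr_pdivrMr// ler_pdivlMr// mulrC ltrBlDr lerBrDr.
rewrite !lebesgue_measure_itv/= !lte_fin ltr_pM2r ?invr_gt0// ltrD2r.
case: ifPn => [ab|]; last by rewrite mule0.
by rewrite -!EFinB -EFinM; congr EFin; field; rewrite gt_eqF.
Qed.

Lemma ge0_integral_affine (f : R -> \bar R) :
  measurable_fun [set: measurableTypeR R] f -> (forall x, (0 <= f x)%E) ->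
  (\int[lebesgue_measure]_x f x =
   c%:E * \int[lebesgue_measure]_x f (c * x + t)%R)%E.
Proof.
move=> mf f0.
rewrite (eq_measure_integral (mscale c_nng push)).
  rewrite ge0_integral_mscale//=; congr (_ * _)%E.
  by rewrite ge0_integral_pushforward.
by move=> A mA _; exact: lebesgue_measure_affine.
Qed.

End affine1.

Section measurable_rV_lemmas.
Context (R : realType) (n : nat).
Context d (T : measurableType d).
Implicit Types f g : T -> 'rV[R]_n.

Lemma measurable_fun_coord f i : measurable_fun setT f ->
  measurable_fun setT (fun t => f t ord0 i : measurableTypeR R).
Proof.
by move=> mf; apply: (measurableT_comp (@measurable_coord R n i) mf).
Qed.

Lemma measurable_rVD f g : measurable_fun setT f -> measurable_fun setT g ->
  measurable_fun setT (fun t => f t + g t).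
Proof.
move=> mf mg; apply: measurable_rV => i; under eq_fun do rewrite mxE.
by apply: (@measurable_funD _ _ R); exact: measurable_fun_coord.
Qed.

Lemma measurable_rVZ (a : R) f : measurable_fun setT f ->
  measurable_fun setT (fun t => a *: f t).
Proof.
move=> mf; apply: measurable_rV => i; under eq_fun do rewrite mxE.
by apply: (@measurable_funM _ _ R) => //; exact: measurable_fun_coord.
Qed.

Lemma measurable_rVB f g : measurable_fun setT f -> measurable_fun setT g ->
  measurable_fun setT (fun t => f t - g t).
Proof.
move=> mf mg; apply: measurable_rV => i; under eq_fun do rewrite !mxE.
by apply: (@measurable_funB _ _ R); exact: measurable_fun_coord.
Qed.

Lemma measurable_enorm f : measurable_fun setT f ->
  measurable_fun setT (fun t => enorm (f t) : measurableTypeR R).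
Proof.
move=> mf; apply: (@measurableT_comp _ _ _ _ _ _ (@Num.sqrt R)) => //.
  by apply: continuous_measurable_fun; exact: sqrt_continuous.
apply: measurable_sum => i.
by apply: (@measurable_funM _ _ R); exact: measurable_fun_coord.
Qed.

End measurable_rV_lemmas.

Lemma ge0_integral_rV_cons (R : realType) n (f : 'rV[R]_n.+1 -> \bar R) :
  measurable_fun setT f -> (forall x, (0 <= f x)%E) ->
  (\int[leb R n.+1]_x f x =
   \int[lebesgue_measure]_a \int[leb R n]_v f (rV_cons (a, v)))%E.
Proof.
move=> mf f0; rewrite /= ge0_integral_pushforward//=; last first.
  exact: measurable_rV_cons.
rewrite -(fubini_tonelli1 (f \o @rV_cons R n))//=.
by apply: measurableT_comp => //; exact: measurable_rV_cons.
Qed.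

(** Induction peels off one coordinate at a time, each contributing a factor c. The case c = 1 gives
    translations, the case h = 0 the scaling of the kernel. *)
Lemma ge0_integral_leb_affine (R : realType) n (c : R) (h : 'rV[R]_n)
    (f : 'rV[R]_n -> \bar R) : 0 < c ->
  measurable_fun setT f -> (forall x, (0 <= f x)%E) ->
  (\int[leb R n]_x f x = (c ^+ n)%:E * \int[leb R n]_x f (c *: x + h)%R)%E.
Proof.
move=> c0; elim: n h f => [|n IH] h f mf f0.
  rewrite /= !integral_dirac//; last first.
    by apply: measurableT_comp => //; apply: measurable_rVD => //;
      apply: measurable_rVZ.
  by rewrite expr0 !diracE in_setT !mul1e; congr f; apply/rowP => -[].
have mcons a : measurable_fun setT (fun v : 'rV[R]_n => f (rV_cons (a, v))).
  apply: measurableT_comp => //; apply: measurableT_comp => //.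
    exact: measurable_rV_cons.
rewrite !ge0_integral_rV_cons//; last first.
  by apply: measurableT_comp => //; apply: measurable_rVD => //;
    apply: measurable_rVZ.
pose h' : 'rV[R]_n := \row_j h ord0 (lift ord0 j).
have E a v : (c *: rV_cons (a, v) + h = rV_cons (c * a + h ord0 ord0, c *: v + h')).
  apply/rowP => i; rewrite !mxE; case: unliftP => [j|] -> /=; by rewrite ?mxE.
under eq_integral => a _ do rewrite (IH h' _ (mcons a))//.
under [in RHS]eq_integral => a _.
  under eq_integral do rewrite E.
  over.
have mcomp (g : measurableTypeR R -> measurableTypeR R) (k : 'rV[R]_n -> 'rV[R]_n) :
    measurable_fun setT g -> measurable_fun setT k ->
    measurable_fun setT (fun p => f (rV_cons (g p.1, k p.2))).
  move=> mg mk; apply: measurableT_comp => //; apply: measurableT_comp => //.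
    exact: measurable_rV_cons.
  apply/measurable_fun_pairP; split => /=.
    exact: (measurableT_comp mg measurable_fst).
  exact: (measurableT_comp mk measurable_snd).
have maff : measurable_fun setT (fun x : 'rV[R]_n => c *: x + h').
  by apply: measurable_rVD => //; apply: measurable_rVZ.
rewrite (ge0_integral_affine (h ord0 ord0) c0); last 2 first.
- apply: emeasurable_funM => //.
  apply: (ge0_measurable_integral (fun (a : measurableTypeR R) (v : 'rV[R]_n) => f (rV_cons (a, c *: v + h')))) => //.
  by apply: (mcomp (fun a => a) _ _ maff); exact: measurable_id.
- move=> x; apply: mule_ge0; first by rewrite lee_fin exprn_ge0// ltW.
  exact: integral_ge0.
rewrite ge0_integralZl//.
- by rewrite muleA -EFinM -exprS.
- apply: (ge0_measurable_integral
    (fun (a : measurableTypeR R) (v : 'rV[R]_n) => f (rV_cons (c * a + h ord0 ord0, c *: v + h')))) => //.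
  apply: (mcomp (fun a => c * a + h ord0 ord0) _ _ maff).
  by apply: measurable_funD => //; apply: measurable_funM.
- by move=> a _; exact: integral_ge0.
- by rewrite lee_fin exprn_ge0// ltW.
Qed.

(** * Euclidean norm, sup-norm and cubes *)

Section euclidean_norm.
Context (R : realType) (d : nat).
Implicit Types x y : 'rV[R]_d.

Lemma dotv_ge0 x : 0 <= dotv x x.
Proof. by apply: sumr_ge0 => i _; exact: sqr_ge0. Qed.

Lemma enorm_ge0 x : 0 <= enorm x. Proof. exact: sqrtr_ge0. Qed.

Lemma sqr_enorm x : enorm x ^+ 2 = dotv x x.
Proof. by rewrite sqr_sqrtr// dotv_ge0. Qed.

Lemma enorm0 : enorm (0 : 'rV[R]_d) = 0.
Proof. by rewrite /enorm /dotv big1 ?sqrtr0// => i _; rewrite mxE mul0r. Qed.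

Lemma enormN x : enorm (- x) = enorm x.
Proof. by congr Num.sqrt; apply: eq_bigr => i _; rewrite mxE mulrNN. Qed.

Lemma enormB x y : enorm (x - y) = enorm (y - x).
Proof. by rewrite -enormN opprB. Qed.

Lemma enormZ (c : R) x : 0 <= c -> enorm (c *: x) = c * enorm x.
Proof.
move=> c0; rewrite /enorm (_ : dotv _ _ = c ^+ 2 * dotv x x).
  by rewrite sqrtrM ?sqr_ge0// sqrtr_sqr ger0_norm.
by rewrite /dotv mulr_sumr; apply: eq_bigr => i _; rewrite !mxE; ring.
Qed.

Lemma coord_le_enorm x i : `|x ord0 i| <= enorm x.
Proof.
rewrite -(ler_pXn2r (n := 2))// ?nnegrE ?enorm_ge0//.
rewrite sqr_enorm /dotv (bigD1 i)//= real_normK ?num_real// expr2 lerDl.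
by apply: sumr_ge0 => j _; exact: sqr_ge0.
Qed.

Lemma enorm_eq0 x : enorm x = 0 -> x = 0.
Proof.
move=> x0; apply/rowP => i; apply/eqP; rewrite mxE -normr_eq0 eq_le normr_ge0.
by rewrite -x0 coord_le_enorm.
Qed.

Lemma enorm_gt0 x : x != 0 -> 0 < enorm x.
Proof.
by move=> x0; rewrite lt_neqAle enorm_ge0 andbT eq_sym;
  apply: contra_neq x0 => /enorm_eq0.
Qed.

Lemma dotv_le_enorm x y : dotv x y <= enorm x * enorm y.
Proof.
have [->|/enorm_gt0 x0] := eqVneq x 0.
  by rewrite enorm0 mul0r /dotv big1// => i _; rewrite mxE mul0r.
have [->|/enorm_gt0 y0] := eqVneq y 0.
  by rewrite enorm0 mulr0 /dotv big1// => i _; rewrite mxE mulr0.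
have : 0 <= dotv (enorm y *: x - enorm x *: y) (enorm y *: x - enorm x *: y).
  exact: dotv_ge0.
rewrite (_ : dotv _ _ = 2 * (enorm x * enorm y) *
    (enorm x * enorm y - dotv x y)); last first.
  transitivity (enorm y ^+ 2 * dotv x x + enorm x ^+ 2 * dotv y y -
      2 * (enorm x * enorm y) * dotv x y); last by rewrite -!sqr_enorm; ring.
  rewrite /dotv !mulr_sumr -big_split -sumrB; apply: eq_bigr => i _ /=.
  by rewrite !mxE; ring.
by rewrite pmulr_rge0 ?subr_ge0// !mulr_gt0.
Qed.

Lemma enormD x y : enorm (x + y) <= enorm x + enorm y.
Proof.
rewrite -(ler_pXn2r (n := 2))// ?nnegrE ?enorm_ge0 ?addr_ge0 ?enorm_ge0//.
rewrite sqr_enorm sqrrD !sqr_enorm.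
rewrite (_ : dotv (x + y) _ = dotv x x + dotv x y *+ 2 + dotv y y).
  by rewrite lerD2r lerD2l lerMn2r dotv_le_enorm orbT.
rewrite /dotv -sumrMnl -!big_split; apply: eq_bigr => i _ /=.
by rewrite !mxE; ring.
Qed.

Lemma norm_le_enorm x : `|x| <= enorm x.
Proof.
rewrite -[`|x|]/(mx_norm x) mx_normrE; apply/bigmax_leP; split.
  exact: enorm_ge0.
by move=> [i j] _ /=; rewrite ord1 coord_le_enorm.
Qed.

Lemma coord_le_norm x i : `|x ord0 i| <= `|x|.
Proof.
rewrite -[`|x|]/(mx_norm x) mx_normrE.
exact: (le_bigmax _ (fun ij : 'I_1 * 'I_d => `|x ij.1 ij.2|) (ord0, i)).
Qed.

(** The sharp constant sqrt d is relaxed to d, which keeps roots out of later constants. *)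
Lemma enorm_le_norm x : enorm x <= d%:R * `|x|.
Proof.
rewrite -(ler_pXn2r (n := 2))// ?nnegrE ?enorm_ge0 ?mulr_ge0//.
rewrite sqr_enorm exprMn.
apply: (@le_trans _ _ (d%:R * `|x| ^+ 2)).
  have -> : d%:R * `|x| ^+ 2 = \sum_(i < d) `|x| ^+ 2.
    by rewrite sumr_const card_ord mulr_natl.
  apply: ler_sum => i _; rewrite -expr2 -real_normK ?num_real//.
  by rewrite lerXn2r ?nnegrE// coord_le_norm.
by rewrite ler_wpM2r ?sqr_ge0// -natrX ler_nat; case: d => // n; rewrite leq_pmulr.
Qed.

Lemma ball_rVP x r y : 0 < r ->
  ball x r y <-> forall i, `|y ord0 i - x ord0 i| < r.
Proof.
move=> r0; rewrite -ball_normE /ball_ /= distrC; split => [h i|h].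
  by have := coord_le_norm (y - x) i; rewrite !mxE => /le_lt_trans; exact.
rewrite -[`|_|]/(mx_norm _) mx_normrE; apply/bigmax_ltP; split => //.
by move=> [i j] _ /=; rewrite ord1 !mxE.
Qed.

(** A library ball is a cube, hence a product of intervals: measurability and the exact volume
    follow. *)
Lemma ball_rVE x r : 0 < r ->
  ball x r = [set y | forall i, `]x ord0 i - r, x ord0 i + r[%classic (y ord0 i)].
Proof.
move=> r0; apply/seteqP; split => y.
  by move=> /(ball_rVP _ _ r0) h i /=; rewrite in_itv/= -ltr_distl.
move=> h; apply/(ball_rVP _ _ r0) => i.
by have := h i; rewrite /= in_itv/= -ltr_distl.
Qed.

Lemma measurable_rV_ball x r : measurable (ball x r).
Proof.
have [r0|r0] := ltP 0 r.
  rewrite ball_rVE//.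
  by apply: (@measurable_box R d (fun i => `]x ord0 i - r, x ord0 i + r[%classic)).
rewrite (_ : ball x r = set0)// -subset0 => y; rewrite -ball_normE /ball_ /=.
by move=> /(le_lt_trans (normr_ge0 _)); rewrite ltNge r0.
Qed.

Lemma leb_ball x r : 0 < r -> leb R d (ball x r) = ((2 * r) ^+ d)%:E.
Proof.
move=> r0; rewrite ball_rVE//.
rewrite (@leb_box R d (fun i => `]x ord0 i - r, x ord0 i + r[%classic)); last first.
  by move=> i; exact: measurable_itv.
under eq_bigr => i _.
  rewrite lebesgue_measure_itv/= lte_fin ltrD2l gtrN// -EFinB.
  rewrite (_ : _ - _ = 2 * r); last by ring.
  over.
by rewrite prodEFin prodr_const card_ord.
Qed.

End euclidean_norm.

Section translation.
Context (R : realType) (d : nat).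

Lemma ge0_integral_lebD (h : 'rV[R]_d) (f : 'rV[R]_d -> \bar R) :
  measurable_fun setT f -> (forall x, (0 <= f x)%E) ->
  (\int[leb R d]_x f (x + h)%R = \int[leb R d]_x f x)%E.
Proof.
move=> mf f0; rewrite (ge0_integral_leb_affine h (@ltr01 R) mf f0) expr1n mul1e.
by under [in RHS]eq_integral do rewrite scale1r.
Qed.

Lemma integral_lebD (h : 'rV[R]_d) (f : 'rV[R]_d -> \bar R) :
  measurable_fun setT f ->
  (\int[leb R d]_x f (x + h)%R = \int[leb R d]_x f x)%E.
Proof.
move=> mf; rewrite [LHS]integralE [RHS]integralE.
have mfp : measurable_fun setT f^\+%E by exact: measurable_funepos.
have mfn : measurable_fun setT f^\-%E by exact: measurable_funeneg.
congr (_ - _)%E.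
  rewrite -(ge0_integral_lebD h mfp) ?funepos_ge0//.
  by apply: eq_integral => x _; rewrite !funeposE.
rewrite -(ge0_integral_lebD h mfn) ?funeneg_ge0//.
by apply: eq_integral => x _; rewrite !funenegE.
Qed.

End translation.

(** * The kernel and the quadratic form of H^s *)

(** The series of the functions [a j] on [A j] dominates f, and its integral is at most a geometric
    series. The sets may overlap, so whole cubes can replace dyadic shells. *)
Lemma ge0_integral_lty_geometric d (T : measurableType d) (R : realType)
    (mu : {measure set T -> \bar R}) (f : T -> R) (A : nat -> set T)
    (a : nat -> R) (c z : R) :
  measurable_fun setT f -> (forall x, 0 <= f x) ->
  (forall j, measurable (A j)) -> (forall j, 0 <= a j) ->
  (forall j, (a j)%:E * mu (A j) <= (c * z ^+ j)%:E)%E -> 0 <= z < 1 ->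
  (forall x, f x = 0 \/ exists2 j, A j x & f x <= a j) ->
  (\int[mu]_x (f x)%:E < +oo)%E.
Proof.
move=> mf f0 mA a0 muA /andP[z0 z1] fA.
have mg j : measurable_fun setT (fun x => (a j * \1_(A j) x)%:E).
  by apply/measurable_EFinP; apply: measurable_funM => //; exact: measurable_indic.
have g0 j x : (0 <= (a j * \1_(A j) x)%:E)%E by rewrite lee_fin mulr_ge0.
apply: (@le_lt_trans _ _ (\int[mu]_x \sum_(j <oo) (a j * \1_(A j) x)%:E)%E).
  apply: ge0_le_integral => //.
  - by move=> x _; rewrite lee_fin.
  - exact/measurable_EFinP.
  - exact: ge0_emeasurable_sum.
  - move=> x _; have [->|[j Ajx faj]] := fA x.
      by apply: nneseries_ge0.
    apply: (@le_trans _ _ (\sum_(0 <= i < j.+1) (a i * \1_(A i) x)%:E)%E).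
      rewrite big_nat_recr//= indicE mem_set// mulr1.
      by apply: (@le_trans _ _ (a j)%:E); rewrite ?lee_fin// leeDr// sume_ge0.
    by apply: (nneseries_lim_ge (m := 0)).
rewrite integral_nneseries//.
apply: (@le_lt_trans _ _ (\sum_(j <oo) (c * z ^+ j)%:E)%E).
  apply: lee_nneseries => [j _ _|j _].
    by apply: integral_ge0.
  under eq_integral do rewrite EFinM.
  by rewrite ge0_integralZl// ?integral_indic ?setIT// ?lee_fin//;
    apply/measurable_EFinP; exact: measurable_indic.
have c0 : 0 <= c.
  have := muA 0; rewrite expr0 mulr1 -lee_fin; apply: le_trans.
  by rewrite mule_ge0// lee_fin.
rewrite (_ : limn _ = (c / (1 - z))%:E) ?ltry//.
apply/cvg_lim => //; apply: cvg_EFin.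
  by apply: nearW => n /=; rewrite sumEFin.
rewrite [X in X @ _ --> _](_ : _ = series (geometric c z)); last first.
  by apply/funext => n /=; rewrite sumEFin.
by apply: cvg_geometric_series; rewrite ger0_norm.
Qed.

Lemma dyadic_ge1 (R : realType) (e : R) : 1 <= e ->
  exists j : nat, 2 ^+ j <= e < 2 ^+ j.+1.
Proof.
move=> e1; have ex : exists n, e < 2 ^+ n.
  exists (Num.bound e); rewrite (@lt_trans _ _ (Num.bound e)%:R)//.
    by rewrite archi_boundP// (le_trans ler01).
  by rewrite -natrX ltr_nat ltn_expl.
case: (ex_minnP ex) => -[|j] ej min; first by move: ej; rewrite expr0 ltNge e1.
by exists j; rewrite ej andbT leNgt; apply/negP => /min; rewrite ltnn.
Qed.

Lemma dyadic_lt1 (R : realType) (e : R) : 0 < e < 1 ->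
  exists j : nat, 2^-1 ^+ j.+1 <= e < 2^-1 ^+ j.
Proof.
move=> /andP[e0 e1]; have ex : exists n, 2^-1 ^+ n <= e.
  have /dyadic_ge1[j /andP[_ ej]] : 1 <= e^-1 by rewrite invf_ge1// ltW.
  by exists j.+1; rewrite exprVn invf_ple ?posrE// ltW.
case: (ex_minnP ex) => -[|j] ej min; first by move: ej; rewrite expr0 leNgt e1.
by exists j; rewrite ej ltNge; apply/negP => /min; rewrite ltnn.
Qed.

Lemma powR2_gt1 (R : realType) (r : R) : 0 < r -> 1 < 2 `^ r.
Proof.
move=> r0; have := @gt0_ltr_powR _ _ r0 1 2; rewrite powR1; apply.
- by rewrite nnegrE.
- by rewrite nnegrE.
- by rewrite ltr1n.
Qed.

Section kernel.
Context (R : realType) (d : nat) (s : R).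
Hypothesis s01 : 0 < s < 1.

Let D : R := d%:R + 2 * s.

Let D0 : 0 < D.
Proof. by case/andP: s01 => s0 _; rewrite ltr_wpDl// mulr_gt0. Qed.

(** [kern 0 = 0], because [0 `^ a = 0] for [a != 0] and [0^-1 = 0]. *)
Definition kern (h : 'rV[R]_d) : R := (enorm h `^ (d%:R + 2 * s))^-1.

Lemma kern_ge0 h : 0 <= kern h. Proof. by rewrite invr_ge0 powR_ge0. Qed.

Lemma kernN h : kern (- h) = kern h. Proof. by rewrite /kern enormN. Qed.

Lemma kern0 : kern 0 = 0.
Proof. by rewrite /kern enorm0 powR0 ?invr0// gt_eqF. Qed.

Lemma measurable_kern : measurable_fun setT kern.
Proof.
rewrite /kern; under eq_fun do rewrite -powRN.
apply: (@measurableT_comp _ _ _ _ _ _ (fun x : R => x `^ (- D))) => //.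
exact: (@measurable_enorm _ _ _ _ id).
Qed.

Lemma kern_ge h rho : h != 0 -> enorm h <= rho -> (rho `^ D)^-1 <= kern h.
Proof.
move=> /enorm_gt0 h0 hr; rewrite lef_pV2 ?posrE ?powR_gt0//.
  apply: ge0_ler_powR => //; rewrite ?nnegrE; [exact: ltW|exact: ltW|].
  by rewrite ltW// (lt_le_trans h0).
by rewrite (lt_le_trans h0).
Qed.

Lemma kern_le h rho : 0 < rho -> rho <= enorm h -> kern h <= (rho `^ D)^-1.
Proof.
move=> rho0 hr; rewrite lef_pV2 ?posrE ?powR_gt0//.
  apply: ge0_ler_powR => //; rewrite ?nnegrE; [exact: ltW|exact: ltW|].
  by rewrite ltW// (lt_le_trans rho0).
by rewrite (lt_le_trans rho0).
Qed.

Lemma kernZ c h : 0 < c -> kern (c *: h) = (c `^ D)^-1 * kern h.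
Proof.
by move=> c0; rewrite /kern enormZ ?ltW// powRM ?enorm_ge0 ?ltW// invfM.
Qed.

(** Passing to the next smaller dyadic shell multiplies the kernel by at most P and the volume by
    2^-d; the product is T = 2^(2 s). *)
Let P : R := 2 `^ D.

Let P0 : 0 < P. Proof. by rewrite powR_gt0. Qed.

Let T : R := 2 `^ (2 * s).

Let P_T : P = 2 ^+ d * T.
Proof. by rewrite /P /D powRD ?pnatr_eq0 ?implybT// powR_mulrn. Qed.

Let T1 : 1 < T.
Proof.
by case/andP: s01 => s0 _; apply: powR2_gt1; rewrite mulr_gt0.
Qed.

Let T4 : T < 4.
Proof.
case/andP: s01 => _ s1; rewrite (_ : 4 = T * 2 `^ (2 - 2 * s)); last first.
  rewrite -powRD ?pnatr_eq0 ?implybT// addrCA subrr addr0 powR_mulrn//.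
  by rewrite -natrX.
rewrite ltr_pMr ?powR_gt0//; apply: powR2_gt1.
by rewrite subr_gt0 -[X in _ < X]mulr1 ltr_pM2l.
Qed.

Let powRX (a : R) n : 0 <= a -> (a ^+ n) `^ D = (a `^ D) ^+ n.
Proof. by move=> a0; rewrite -!powR_mulrn ?powR_ge0// powRAC. Qed.

(** For 2^-(j+1) <= |h| < 2^-j the integrand is at most 4^-j P^(j+1), on a cube of volume (2 *
    2^-j)^d: the contributions decay like (T / 4)^j, and T < 4 because s < 1. *)
Lemma kern_inner_moment_lty :
  (\int[leb R d]_h (if enorm h < 1 then enorm h ^+ 2 * kern h else 0)%:E < +oo)%E.
Proof.
have me : measurable_fun setT (fun h : 'rV[R]_d => enorm h : measurableTypeR R).
  exact: (@measurable_enorm _ _ _ _ id).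
apply: (@ge0_integral_lty_geometric _ _ R (leb R d)
  (fun h : 'rV[R]_d => if enorm h < 1 then enorm h ^+ 2 * kern h else 0)
  (fun j => ball 0 (2^-1 ^+ j))
  (fun j => (2^-1 ^+ j) ^+ 2 * P ^+ j.+1) (2 ^+ d * P) (T / 4)).
- apply: measurable_fun_ifT => //; first exact: measurable_fun_ltr.
  by apply: measurable_funM; [exact: measurable_funX|exact: measurable_kern].
- by move=> h; case: ifP => // _; rewrite mulr_ge0 ?sqr_ge0 ?kern_ge0.
- by move=> j; exact: measurable_rV_ball.
- by move=> j; rewrite mulr_ge0 ?sqr_ge0// exprn_ge0// ltW.
- move=> j /=; rewrite leb_ball ?exprn_gt0 ?invr_gt0// -EFinM lee_fin.
  set y := 2^-1 ^+ j.
  have yd : y ^+ d * (2 ^+ d) ^+ j = 1.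
    by rewrite -!exprM (mulnC d) -exprMn mulVf// expr1n.
  have y2 : y ^+ 2 = 4^-1 ^+ j.
    by rewrite /y -exprM mulnC exprM exprVn -natrX.
  have -> : y ^+ 2 * P ^+ j.+1 * (2 * y) ^+ d =
      2 ^+ d * P * T ^+ j * y ^+ 2 * (y ^+ d * (2 ^+ d) ^+ j).
    have -> : P ^+ j.+1 = P * ((2 ^+ d) ^+ j * T ^+ j).
      by rewrite exprS -exprMn -P_T.
    by rewrite exprMn; move: (y ^+ d) (y ^+ 2) (T ^+ j) => a b e; ring.
  by rewrite yd mulr1 y2 exprMn mulrA.
- by rewrite divr_ge0 ?powR_ge0// ltr_pdivrMr// mul1r.
- move=> h; case: ifPn => [h1|]; last by left.
  have [->|/enorm_gt0 h0] := eqVneq h 0.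
    by left; rewrite kern0 mulr0.
  right; have [|j /andP[je ej]] := @dyadic_lt1 _ (enorm h); first by rewrite h0.
  exists j.
    rewrite -ball_normE /= sub0r normrN.
    by rewrite (le_lt_trans (norm_le_enorm _)).
  apply: ler_pM; rewrite ?sqr_ge0 ?kern_ge0//.
    by rewrite lerXn2r ?nnegrE ?enorm_ge0 ?exprn_ge0 ?ltW.
  rewrite (le_trans (kern_le _ je)) ?exprn_gt0//.
  rewrite powRX// (_ : 2^-1 `^ D = P^-1) ?exprVn ?invrK//.
  by rewrite -powR_inv1// -powRrM mulN1r powRN.
Qed.

(** For 2^j <= |h| < 2^(j+1) the kernel is at most P^-j, on a cube of volume 4^d 2^(j d). This
    leaves T^-j, summable because s > 0. *)
Lemma kern_tail_lty :
  (\int[leb R d]_h (if 1 <= enorm h then kern h else 0)%:E < +oo)%E.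
Proof.
have me : measurable_fun setT (fun h : 'rV[R]_d => enorm h : measurableTypeR R).
  exact: (@measurable_enorm _ _ _ _ id).
apply: (@ge0_integral_lty_geometric _ _ R (leb R d)
  (fun h : 'rV[R]_d => if 1 <= enorm h then kern h else 0)
  (fun j => ball 0 (2 ^+ j.+1)) (fun j => P^-1 ^+ j) (4 ^+ d) T^-1).
- apply: measurable_fun_ifT => //; first exact: measurable_fun_ler.
  exact: measurable_kern.
- by move=> h; case: ifP => // _; rewrite kern_ge0.
- by move=> j; exact: measurable_rV_ball.
- by move=> j; rewrite exprn_ge0// invr_ge0 ltW.
- move=> j /=; rewrite leb_ball ?exprn_gt0// -EFinM lee_fin.
  have -> : (2 * 2 ^+ j.+1) ^+ d = 4 ^+ d * (2 ^+ j) ^+ d :> R.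
    by rewrite exprS mulrA -natrM exprMn.
  have yd : (2 ^+ d)^-1 ^+ j * (2 ^+ j) ^+ d = 1 :> R.
    by rewrite -exprVn -!exprM mulnC -exprMn mulVf// expr1n.
  by rewrite P_T invfM exprMn mulrCA mulrAC yd mul1r.
- by rewrite invr_ge0 powR_ge0 invf_lt1// (lt_trans ltr01).
- move=> h; case: ifPn => [h1|]; last by left.
  right; have [j /andP[je ej]] := dyadic_ge1 h1.
  exists j.
    rewrite -ball_normE /= sub0r normrN.
    by rewrite (le_lt_trans (norm_le_enorm _)).
  rewrite (le_trans (kern_le _ je)) ?exprn_gt0//.
  by rewrite powRX// exprVn.
Qed.

End kernel.

Section kernel_moments.
Context (R : realType) (d : nat) (s : R).
Hypothesis s01 : 0 < s < 1.
Local Notation mu := (leb R d).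

Let measurable_enorm_id : measurable_fun setT (fun h : 'rV[R]_d => enorm h : measurableTypeR R).
Proof. exact: (@measurable_enorm _ _ _ _ id). Qed.

(** One quantity that controls both the kernel mass beyond distance r and the fractional Laplacian
    of a bump of width r. *)
Definition kern_moment (r : R) : \bar R :=
  (\int[mu]_h (Num.min ((enorm h / r) ^+ 2) 1 * kern s h)%:E)%E.

Lemma measurable_kern_moment (r : R) : measurable_fun setT
  (fun h : 'rV[R]_d => Num.min ((enorm h / r) ^+ 2) 1 * kern s h).
Proof.
apply: measurable_funM; last exact: measurable_kern.
apply: measurable_minr => //; apply: measurable_funX.
by apply: measurable_funM.
Qed.

Lemma kern_moment_ge0 r : (0 <= kern_moment r)%E.
Proof.
apply: integral_ge0 => h _; rewrite lee_fin mulr_ge0 ?kern_ge0//.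
by rewrite le_min sqr_ge0 ler01.
Qed.

Lemma kern_moment1_lty : (kern_moment 1 < +oo)%E.
Proof.
apply: le_lt_trans (lte_add_pinfty (kern_inner_moment_lty d s01)
  (kern_tail_lty d s01)).
have mi : measurable_fun setT (fun h : 'rV[R]_d =>
    (if enorm h < 1 then enorm h ^+ 2 * kern s h else 0)%:E).
  apply/measurable_EFinP; apply: measurable_fun_ifT => //.
    exact: measurable_fun_ltr.
  by apply: measurable_funM; [exact: measurable_funX|exact: measurable_kern].
have mt : measurable_fun setT (fun h : 'rV[R]_d =>
    (if 1 <= enorm h then kern s h else 0)%:E).
  apply/measurable_EFinP; apply: measurable_fun_ifT => //.
    exact: measurable_fun_ler.
  exact: measurable_kern.
rewrite -ge0_integralD//.
- apply: ge0_le_integral => //.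
  + move=> h _; rewrite lee_fin mulr_ge0 ?kern_ge0//.
    by rewrite le_min sqr_ge0 ler01.
  + apply/measurable_EFinP; exact: measurable_kern_moment.
  + exact: emeasurable_funD.
  + move=> h _; rewrite -EFinD lee_fin divr1.
    case: ltP => h1; rewrite ?addr0 ?add0r.
      by rewrite ler_wpM2r ?kern_ge0// ge_min lexx.
    by rewrite -[leRHS]mul1r ler_wpM2r ?kern_ge0// ge_min lexx orbT.
- by move=> h _; rewrite lee_fin; case: ifP => // _; rewrite mulr_ge0 ?sqr_ge0 ?kern_ge0.
- by move=> h _; rewrite lee_fin; case: ifP => // _; rewrite kern_ge0.
Qed.

(** Rescaling by r gives r^d from the volume and r^-(d + 2 s) from the homogeneity of the kernel. *)
Lemma kern_momentE r : 0 < r ->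
  kern_moment r = ((r `^ (2 * s))^-1%:E * kern_moment 1)%E.
Proof.
move=> r0; rewrite /kern_moment (ge0_integral_leb_affine 0 r0); last 2 first.
- apply/measurable_EFinP; exact: measurable_kern_moment.
- move=> h; rewrite lee_fin mulr_ge0 ?kern_ge0//.
  by rewrite le_min sqr_ge0 ler01.
under eq_integral => h _.
  rewrite addr0 enormZ ?ltW// kernZ// mulrAC divff ?gt_eqF// mul1r mulrCA EFinM.
  over.
rewrite ge0_integralZl//; last 3 first.
- under eq_fun do rewrite -[enorm _]divr1.
  apply/measurable_EFinP; exact: measurable_kern_moment.
- move=> h _; rewrite lee_fin mulr_ge0 ?kern_ge0//.
  by rewrite le_min sqr_ge0 ler01.
- by rewrite lee_fin invr_ge0 powR_ge0.
under [in RHS]eq_integral do rewrite divr1.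
rewrite muleA -EFinM; congr (_%:E * _)%E.
rewrite powRD ?(gt_eqF r0) ?implybT// powR_mulrn ?ltW// invfM mulrA divff ?mul1r//.
by rewrite expf_neq0// gt_eqF.
Qed.

Lemma kern_moment_lty r : 0 < r -> (kern_moment r < +oo)%E.
Proof.
by move=> r0; rewrite kern_momentE// lte_mul_pinfty ?lee_fin ?invr_ge0 ?powR_ge0//
  kern_moment1_lty.
Qed.

Lemma kern_tail_le r (x : 'rV[R]_d) : 0 < r ->
  (\int[mu]_y (if (r <= enorm (x - y)) then kern s (x - y) else 0)%:E
   <= kern_moment r)%E.
Proof.
move=> r0; pose t (h : 'rV[R]_d) := (if r <= enorm h then kern s h else 0)%:E.
have mt : measurable_fun setT t.
  apply/measurable_EFinP; apply: measurable_fun_ifT => //.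
    exact: measurable_fun_ler.
  exact: measurable_kern.
have t0 h : (0 <= t h)%E by rewrite lee_fin; case: ifP => // _; exact: kern_ge0.
have -> : (\int[mu]_y (if r <= enorm (x - y) then kern s (x - y) else 0)%:E =
    \int[mu]_y t (y + - x)%R)%E.
  by apply: eq_integral => y _; rewrite /t -[y + - x]opprB enormN kernN.
rewrite ge0_integral_lebD//; apply: ge0_le_integral => //.
  apply/measurable_EFinP; exact: measurable_kern_moment.
move=> h _; rewrite lee_fin; case: ifPn => [rh|_].
  rewrite min_r ?mul1r// -{1}(expr1n _ 2) lerXn2r ?nnegrE ?divr_ge0 ?enorm_ge0 ?(ltW r0)//.
  by rewrite ler_pdivlMr ?mul1r.
by rewrite mulr_ge0 ?kern_ge0// le_min sqr_ge0 ler01.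
Qed.

End kernel_moments.

(** * Energy and bilinear form *)

Section energy.
Context (R : realType) (d : nat) (s : R).
Hypothesis s01 : 0 < s < 1.
Local Notation mu := (leb R d).
Local Notation mu2 := (leb R d \x leb R d)%E.
Implicit Types u v : 'rV[R]_d -> R.

Definition form_density u v (z : 'rV[R]_d * 'rV[R]_d) : R :=
  (u z.1 - u z.2) * (v z.1 - v z.2) * kern s (z.1 - z.2).

(** A real-valued integral, which has its intended meaning when both arguments have finite energy:
    see [eform_EFin]. It is normalized so that its diagonal is |u|_{H^s}^2. *)
Definition eform u v : R := (\int[mu2]_z form_density u v z)%R.

Definition finite_energy u := measurable_fun setT u /\ (Hs_sq s u < +oo)%E.

Lemma measurable_kern2 : measurable_fun setT
  (fun z : 'rV[R]_d * 'rV[R]_d => kern s (z.1 - z.2)).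
Proof.
by apply: measurableT_comp; [exact: measurable_kern|exact: measurable_rVB].
Qed.

Lemma measurable_diff2 u : measurable_fun setT u ->
  measurable_fun setT (fun z : 'rV[R]_d * 'rV[R]_d => u z.1 - u z.2).
Proof.
by move=> mu_; apply: measurable_funB; apply: measurableT_comp.
Qed.

Lemma measurable_form_density u v : measurable_fun setT u ->
  measurable_fun setT v -> measurable_fun setT (form_density u v).
Proof.
move=> mu_ mv; apply: measurable_funM; last exact: measurable_kern2.
by apply: measurable_funM; exact: measurable_diff2.
Qed.

Lemma form_density_ge0 u z : 0 <= form_density u u z.
Proof. by rewrite mulr_ge0 ?kern_ge0// -expr2 sqr_ge0. Qed.

Lemma Hs_sqE u : measurable_fun setT u ->
  (Hs_sq s u = \int[mu2]_z (form_density u u z)%:E)%E.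
Proof.
move=> mu_; transitivity (\int[mu]_x \int[mu]_y (form_density u u (x, y))%:E)%E.
  apply: eq_integral => x _; apply: eq_integral => y _.
  by rewrite /form_density /kern /= -expr2 real_normK ?num_real.
rewrite -(ge0_integral_prod (fun x y => (form_density u u (x, y))%:E))//.
- apply/measurable_EFinP.
  exact: (measurable_form_density mu_ mu_).
- by move=> x y; rewrite lee_fin form_density_ge0.
Qed.

Lemma Hs_sqN u : Hs_sq s (fun x => - u x) = Hs_sq s u.
Proof.
apply: eq_integral => x _; apply: eq_integral => y _.
by rewrite -opprD normrN.
Qed.

Lemma integrable_form_diag u : finite_energy u ->
  mu2.-integrable setT (EFin \o form_density u u).
Proof.
move=> [mu_ fu]; apply/integrableP; split.
  by apply/measurable_EFinP; exact: measurable_form_density.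
under eq_integral do rewrite gee0_abs ?lee_fin ?form_density_ge0//.
by rewrite -Hs_sqE.
Qed.

Lemma integrable_form u v : finite_energy u -> finite_energy v ->
  mu2.-integrable setT (EFin \o form_density u v).
Proof.
move=> fu fv.
apply: (le_integrable _ _ _ (integrableD _ (integrable_form_diag fu)
  (integrable_form_diag fv))) => //.
  by apply/measurable_EFinP; case: fu fv => ? _ [? _]; exact: measurable_form_density.
move=> z _ /=; rewrite lee_fin [leRHS]ger0_norm ?addr_ge0 ?form_density_ge0//.
rewrite /form_density -mulrDl normrM (ger0_norm (kern_ge0 _ _)).
rewrite ler_wpM2r ?kern_ge0//; move: (u _ - u _) (v _ - v _) => a b.
by rewrite ler_norml; apply/andP; split; nra.
Qed.

Lemma eform_EFin u v : finite_energy u -> finite_energy v ->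
  (\int[mu2]_z (form_density u v z)%:E = (eform u v)%:E)%E.
Proof.
move=> fu fv; rewrite /eform /Rintegral fineK//.
by apply: integrable_fin_num => //; exact: integrable_form.
Qed.

Lemma Hs_sq_form u : finite_energy u -> Hs_sq s u = (eform u u)%:E.
Proof. by move=> fu; rewrite Hs_sqE ?eform_EFin//; case: fu. Qed.

Lemma eform_ge0 u : 0 <= eform u u.
Proof. by apply: Rintegral_ge0 => z _; exact: form_density_ge0. Qed.

Lemma eformC u v : eform u v = eform v u.
Proof.
by apply: eq_Rintegral => z _; rewrite /form_density (mulrC (u _ - _)).
Qed.

(** From (b + c)^2 <= 2 b^2 + 2 c^2. This covers sums as well as truncations, which contract
    differences. *)
Lemma finite_energy_le v u1 u2 : measurable_fun setT v ->
  finite_energy u1 -> finite_energy u2 ->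
  (forall x y, `|v x - v y| <= `|u1 x - u1 y| + `|u2 x - u2 y|) ->
  finite_energy v.
Proof.
move=> mv fu1 fu2 vu; split => //; rewrite Hs_sqE//.
have [[mu1 _] [mu2_ _]] := (fu1, fu2).
apply: (@le_lt_trans _ _ (\int[mu2]_z (2 * form_density u1 u1 z +
    2 * form_density u2 u2 z)%:E)%E).
  apply: ge0_le_integral => //.
  - by move=> z _; rewrite lee_fin form_density_ge0.
  - by apply/measurable_EFinP; exact: measurable_form_density.
  - apply/measurable_EFinP; apply: measurable_funD;
      by apply: measurable_funM => //; exact: measurable_form_density.
  - move=> z _; rewrite lee_fin /form_density !mulrA -mulrDl ler_wpM2r ?kern_ge0//.
    have := vu z.1 z.2; rewrite -!expr2 -!mulrA -!expr2 -!(real_normK (num_real (_ - _))).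
    have := normr_ge0 (v z.1 - v z.2).
    move: `|v _ - _| `|u1 _ - _| `|u2 _ - _| => a b c a0 abc.
    apply: (@le_trans _ _ ((b + c) ^+ 2)); first by rewrite lerXn2r ?nnegrE// (le_trans a0).
    rewrite -subr_ge0 (_ : _ - _ = (b - c) ^+ 2) ?sqr_ge0//; ring.
under eq_integral do rewrite EFinD !EFinM.
apply: integrable_lty => //; apply: integrableD => //;
  by apply: integrableZl => //; exact: integrable_form_diag.
Qed.

Lemma finite_energy_contraction v u : measurable_fun setT v ->
  finite_energy u -> (forall x y, `|v x - v y| <= `|u x - u y|) ->
  finite_energy v.
Proof.
move=> mv fu vu; apply: (finite_energy_le mv fu fu) => x y.
by rewrite (le_trans (vu x y))// lerDl.
Qed.

Lemma finite_energyD u v : finite_energy u -> finite_energy v ->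
  finite_energy (fun x => u x + v x).
Proof.
move=> fu fv; apply: (finite_energy_le _ fu fv).
  by case: fu fv => ? _ [? _]; exact: measurable_funD.
move=> x y; rewrite (_ : _ - _ = (u x - u y) + (v x - v y)); last by ring.
exact: ler_normD.
Qed.

Lemma form_densityZl a u v z :
  form_density (fun x => a * u x) v z = a * form_density u v z.
Proof. by rewrite /form_density; ring. Qed.

Lemma form_densityDl u1 u2 v z : form_density (fun x => u1 x + u2 x) v z =
  form_density u1 v z + form_density u2 v z.
Proof. by rewrite /form_density; ring. Qed.

Lemma finite_energyZ a u : finite_energy u -> finite_energy (fun x => a * u x).
Proof.
move=> fu; have mu_ : measurable_fun setT u by case: fu.
have mau : measurable_fun setT (fun x => a * u x) by exact: measurable_funM.
split => //; rewrite Hs_sqE//.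
under eq_integral => z _.
  rewrite (_ : form_density _ _ _ = a ^+ 2 * form_density u u z); last first.
    by rewrite /form_density; ring.
  rewrite EFinM; over.
apply: integrable_lty => //; apply: integrableZl => //.
exact: integrable_form_diag.
Qed.

Lemma eformZl a u v : finite_energy u -> finite_energy v ->
  eform (fun x => a * u x) v = a * eform u v.
Proof.
move=> fu fv; rewrite -RintegralZl//; last exact: integrable_form.
by apply: eq_Rintegral => z _; rewrite form_densityZl.
Qed.

Lemma eformDl u1 u2 v : finite_energy u1 -> finite_energy u2 ->
  finite_energy v -> eform (fun x => u1 x + u2 x) v = eform u1 v + eform u2 v.
Proof.
move=> fu1 fu2 fv; rewrite -RintegralD//; [|exact: integrable_form..].
by apply: eq_Rintegral => z _; rewrite form_densityDl.
Qed.

Lemma eformZr a u v : finite_energy u -> finite_energy v ->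
  eform u (fun x => a * v x) = a * eform u v.
Proof. by move=> fu fv; rewrite eformC eformZl// eformC. Qed.

Lemma eformDr u v1 v2 : finite_energy u -> finite_energy v1 ->
  finite_energy v2 -> eform u (fun x => v1 x + v2 x) = eform u v1 + eform u v2.
Proof. by move=> fu fv1 fv2; rewrite eformC eformDl// !(eformC u). Qed.

End energy.

(** * Comparison and regularity for weak solutions *)

Section comparison.
Context (R : realType) (d : nat) (s : R).
Hypothesis s01 : 0 < s < 1.
Local Notation mu := (leb R d).
Local Notation mu2 := (leb R d \x leb R d)%E.
Local Notation kern := (kern s).
Implicit Types f g : 'rV[R]_d -> R.

Lemma measurable_tensor_kern f g : measurable_fun setT f -> measurable_fun setT g ->
  measurable_fun setT
    (fun z : 'rV[R]_d * 'rV[R]_d => f z.1 * g z.2 * kern (z.1 - z.2)).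
Proof.
move=> mf mg; apply: measurable_funM; last exact: measurable_kern2.
by apply: measurable_funM; apply: measurableT_comp.
Qed.

Lemma measurable_kern_diff (x : 'rV[R]_d) g : measurable_fun setT g ->
  measurable_fun setT (fun y => g y * kern (x - y)).
Proof.
move=> mg; apply: measurable_funM => //.
apply: measurableT_comp; first exact: measurable_kern.
by apply: measurable_rVB => //; exact: measurable_cst.
Qed.

Lemma ge0_integral_tensor_kern f g :
  measurable_fun setT f -> measurable_fun setT g ->
  (forall x, 0 <= f x) -> (forall x, 0 <= g x) ->
  (\int[mu2]_z (f z.1 * g z.2 * kern (z.1 - z.2))%:E =
   \int[mu]_x ((f x)%:E * \int[mu]_y (g y * kern (x - y))%:E))%E.
Proof.
move=> mf mg f0 g0.
rewrite (ge0_integral_prod (fun x y => (f x * g y * kern (x - y))%:E))//.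
- apply: eq_integral => x _; rewrite -ge0_integralZl//.
  + by apply: eq_integral => y _; rewrite -EFinM mulrA.
  + by apply/measurable_EFinP; exact: measurable_kern_diff.
  + by move=> y _; rewrite lee_fin mulr_ge0 ?kern_ge0.
  + by rewrite lee_fin.
- by apply/measurable_EFinP; exact: measurable_tensor_kern.
- by move=> x y; rewrite lee_fin !mulr_ge0 ?kern_ge0.
Qed.

Lemma measurable_integral_kern g : measurable_fun setT g ->
  (forall x, 0 <= g x) ->
  measurable_fun setT (fun x : 'rV[R]_d => \int[mu]_y (g y * kern (x - y))%:E)%E.
Proof.
move=> mg g0; apply: (ge0_measurable_integral (fun x y : 'rV[R]_d => (g y * kern (x - y))%:E)).
  apply/measurable_EFinP; apply: measurable_funM; last exact: measurable_kern2.
  exact: measurableT_comp.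
by move=> x y; rewrite lee_fin mulr_ge0 ?kern_ge0.
Qed.

Lemma ge0_integral_tensor_kernC f g :
  measurable_fun setT f -> measurable_fun setT g ->
  (forall x, 0 <= f x) -> (forall x, 0 <= g x) ->
  (\int[mu2]_z (g z.1 * f z.2 * kern (z.1 - z.2))%:E =
   \int[mu2]_z (f z.1 * g z.2 * kern (z.1 - z.2))%:E)%E.
Proof.
move=> mf mg f0 g0.
have mfg : measurable_fun setT (fun z : 'rV[R]_d * 'rV[R]_d =>
    (f z.1 * g z.2 * kern (z.1 - z.2))%:E).
  by apply/measurable_EFinP; exact: measurable_tensor_kern.
have mgf : measurable_fun setT (fun z : 'rV[R]_d * 'rV[R]_d =>
    (g z.1 * f z.2 * kern (z.1 - z.2))%:E).
  by apply/measurable_EFinP; exact: measurable_tensor_kern.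
have fg0 x y : (0 <= (f x * g y * kern (x - y))%:E)%E.
  by rewrite lee_fin !mulr_ge0 ?kern_ge0.
have gf0 x y : (0 <= (g x * f y * kern (x - y))%:E)%E.
  by rewrite lee_fin !mulr_ge0 ?kern_ge0.
transitivity (\int[mu]_x \int[mu]_y (g x * f y * kern (x - y))%:E)%E.
  exact: (ge0_integral_prod (fun x y => (g x * f y * kern (x - y))%:E)).
transitivity (\int[mu]_y \int[mu]_x (g x * f y * kern (x - y))%:E)%E.
  exact: (ge0_integral_swap (fun x y => (g x * f y * kern (x - y))%:E)).
transitivity (\int[mu]_x \int[mu]_y (f x * g y * kern (x - y))%:E)%E.
  apply: eq_integral => x _; apply: eq_integral => y _.
  by rewrite (mulrC (g y)) -(kernN s (x - y)) opprB.
by apply/esym; exact: (ge0_integral_prod (fun x y => (f x * g y * kern (x - y))%:E)).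
Qed.

(** [E] collects points where [w] lies [lambda] below the truncation level, [m]
    is the part of [w] above this level (null on a neighbourhood of the support
    of [psi] in the applications) and [gamma b] bends the level. *)
Lemma comparison_principle (w psi b m : 'rV[R]_d -> R) (E : set 'rV[R]_d)
    (G gamma beta lambda kappa tau : R) :
  finite_energy s w -> finite_energy s psi -> finite_energy s b ->
  (forall x, 0 <= psi x) -> mu.-integrable setT (EFin \o psi) ->
  measurable_fun setT m -> (forall x, 0 <= m x) -> measurable E ->
  0 <= gamma -> 0 <= lambda -> 0 <= kappa -> 0 <= tau ->
  eform s w psi <= G * \int[mu]_x psi x ->
  eform s b psi <= beta * \int[mu]_x psi x ->
  (forall x, psi x != 0%R -> kappa%:E <= \int[mu]_y (\1_E y * kern (x - y))%:E)%E ->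
  (forall x, psi x != 0%R -> \int[mu]_y (m y * kern (x - y))%:E <= tau%:E)%E ->
  (forall x y, lambda * (psi x * \1_E y) <=
     (w x - w y) * (psi x - psi y) + gamma * ((b x - b y) * (psi x - psi y)) +
     (psi x * m y + m x * psi y)) ->
  G + gamma * beta + 2 * tau < lambda * kappa ->
  {ae mu, forall x, psi x = 0}.
Proof.
move=> fw fpsi fb psi0 ipsi mm m0 mE gamma0 lambda0 kappa0 tau0 wG bb kE tm pw strict.
have mpsi : measurable_fun setT psi by case: fpsi.
have mind : measurable_fun setT (\1_E : _ -> R) by exact: measurable_indic.
set I := (\int[mu]_x psi x)%R in wG bb.
have IE : (\int[mu]_x (psi x)%:E = I%:E)%E.
  by rewrite /I /Rintegral fineK// integrable_fin_num.
have I0 : 0 <= I by apply: Rintegral_ge0 => x _; exact: psi0.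
pose N (z : 'rV[R]_d * 'rV[R]_d) := psi z.1 * \1_E z.2 * kern (z.1 - z.2).
pose T1 (z : 'rV[R]_d * 'rV[R]_d) := psi z.1 * m z.2 * kern (z.1 - z.2).
pose T2 (z : 'rV[R]_d * 'rV[R]_d) := m z.1 * psi z.2 * kern (z.1 - z.2).
have mN : measurable_fun setT N by exact: measurable_tensor_kern.
have mT1 : measurable_fun setT T1 by exact: measurable_tensor_kern.
have mT2 : measurable_fun setT T2 by exact: measurable_tensor_kern.
have N0 z : 0 <= N z by rewrite !mulr_ge0 ?kern_ge0.
have T10 z : 0 <= T1 z by rewrite !mulr_ge0 ?kern_ge0.
have T20 z : 0 <= T2 z by rewrite !mulr_ge0 ?kern_ge0.
have mEFpsi : measurable_fun setT (EFin \o psi) by exact/measurable_EFinP.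
have NI : ((kappa * I)%:E <= \int[mu2]_z (N z)%:E)%E.
  rewrite ge0_integral_tensor_kern// EFinM -IE -ge0_integralZl//; last by move=> x _; rewrite lee_fin.
  apply: ge0_le_integral => //.
  - by move=> x _; rewrite mule_ge0 ?lee_fin.
  - exact: measurable_funeM.
  - apply: emeasurable_funM => //; exact: measurable_integral_kern.
  - move=> x _; have [->|psix] := eqVneq (psi x) 0; first by rewrite mul0e mule0.
    by rewrite muleC lee_wpmul2l ?lee_fin// kE.
have T1I : (\int[mu2]_z (T1 z)%:E <= (tau * I)%:E)%E.
  rewrite ge0_integral_tensor_kern// EFinM -IE -ge0_integralZl//; last by move=> x _; rewrite lee_fin.
  apply: ge0_le_integral => //.
  - move=> x _; rewrite mule_ge0 ?lee_fin// integral_ge0// => y _.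
    by rewrite lee_fin mulr_ge0 ?kern_ge0.
  - apply: emeasurable_funM => //; exact: measurable_integral_kern.
  - exact: measurable_funeM.
  - move=> x _; have [->|psix] := eqVneq (psi x) 0; first by rewrite mul0e mule0.
    by rewrite muleC lee_wpmul2r ?lee_fin// tm.
have T2I : (\int[mu2]_z (T2 z)%:E = \int[mu2]_z (T1 z)%:E)%E.
  exact: ge0_integral_tensor_kernC.
have iT (T : 'rV[R]_d * 'rV[R]_d -> R) : measurable_fun setT T -> (forall z, 0 <= T z) ->
    (\int[mu2]_z (T z)%:E <= (tau * I)%:E)%E -> mu2.-integrable setT (EFin \o T).
  move=> mT T0 TI; apply/integrableP; split; first exact/measurable_EFinP.
  under eq_integral do rewrite gee0_abs ?lee_fin//.
  by rewrite (le_lt_trans TI)// ltry.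
have iT1 := iT _ mT1 T10 T1I.
have iT2 : mu2.-integrable setT (EFin \o T2) by apply: iT => //; rewrite T2I.
have iw := integrable_form fw fpsi.
have ib := integrable_form fb fpsi.
(* The pointwise hypothesis is integrated against the kernel. Every term is then comparable with a
   multiple of I, so that I > 0 would contradict [strict]. *)
have key : ((lambda * (kappa * I))%:E <=
    (eform s w psi)%:E + gamma%:E * (eform s b psi)%:E +
    (\int[mu2]_z (T1 z)%:E + \int[mu2]_z (T2 z)%:E))%E.
  rewrite -!eform_EFin// -integralZl// -integralD//; last exact: integrableZl.
  rewrite -integralD// -integralD//; last 2 first.
  - by apply: integrableD => //; exact: integrableZl.
  - exact: integrableD.
  apply: (@le_trans _ _ (\int[mu2]_z (lambda%:E * (N z)%:E))%E).
    rewrite ge0_integralZl//; last 2 first.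
    + exact/measurable_EFinP.
    + by move=> z _; rewrite lee_fin.
    by rewrite EFinM lee_wpmul2l// lee_fin.
  apply: ge0_le_integral => //.
  - by move=> z _; rewrite mule_ge0 ?lee_fin.
  - by apply: measurable_funeM; exact/measurable_EFinP.
  - apply: (measurable_int _ (integrableD _ (integrableD _ iw
      (integrableZl _ gamma ib)) (integrableD _ iT1 iT2))) => //.
  - move=> z _; rewrite -EFinM -!EFinD lee_fin /form_density /N /T1 /T2.
    have := pw z.1 z.2; have := kern_ge0 s (z.1 - z.2); nra.
have I_eq0 : I = 0.
  move: key; rewrite T2I -EFinM -EFinD.
  have : (\int[mu2]_z (T1 z)%:E)%E \is a fin_num by exact: integrable_fin_num.
  move=> /fineK <-; rewrite -!EFinD lee_fin.
  have : fine (\int[mu2]_z (T1 z)%:E)%E <= tau * I.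
    by rewrite -lee_fin fineK ?integrable_fin_num.
  move: (fine _) => t tI key.
  apply/eqP; rewrite eq_le I0 andbT leNgt; apply/negP => Ip.
  have := ler_wpM2l gamma0 bb.
  have : 0 < (lambda * kappa - (G + gamma * beta + 2 * tau)) * I.
    by rewrite mulr_gt0// subr_gt0.
  lra.
have : (\int[mu]_x `|(psi x)%:E| = 0)%E.
  by under eq_integral do rewrite gee0_abs ?lee_fin//; rewrite IE I_eq0.
move=> /(ae_eq_integral_abs _ measurableT mEFpsi); apply: filterS => x /(_ Logic.I).
by move=> [].
Qed.

End comparison.

(** * Bending the level: shear and truncated paraboloid *)

Section shear.
Context (R : realType) (d : nat).
Local Notation mu := (leb R d).
Local Notation mu2 := (leb R d \x leb R d)%E.

Lemma integrable_lebD (h : 'rV[R]_d) (f : 'rV[R]_d -> \bar R) :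
  mu.-integrable setT f -> mu.-integrable setT (fun x => f (x + h)).
Proof.
move=> /integrableP[mf fi]; apply/integrableP; split.
  by apply: measurableT_comp => //; apply: measurable_rVD => //; exact: measurable_cst.
by rewrite (ge0_integral_lebD h (f := fun x => `|f x|%E))//; exact: measurableT_comp.
Qed.

(** Passing to the coordinates (x, h) with y = x + h, in which the kernel depends on h alone. *)
Let shear (z : 'rV[R]_d * 'rV[R]_d) : 'rV[R]_d * 'rV[R]_d := (z.1, z.2 + z.1).

Let measurable_shear : measurable_fun setT shear.
Proof.
apply/measurable_fun_pairP; split.
  exact: measurable_fst.
exact: (measurable_rVD measurable_snd measurable_fst).
Qed.

Lemma ge0_integral_shear (f : 'rV[R]_d * 'rV[R]_d -> \bar R) :
  measurable_fun setT f -> (forall z, (0 <= f z)%E) ->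
  (\int[mu2]_z f (z.1, z.2 + z.1)%R = \int[mu2]_z f z)%E.
Proof.
move=> mf f0.
have mfs : measurable_fun setT (f \o shear) by exact: measurableT_comp.
have -> : (\int[mu2]_z f z = \int[mu]_x \int[mu]_y f (x, y))%E.
  exact: fubini_tonelli1.
transitivity (\int[mu]_x \int[mu]_y f (x, y + x)%R)%E.
  exact: (fubini_tonelli1 (f \o shear) mfs (fun z => f0 _)).
apply: eq_integral => x _.
rewrite -(ge0_integral_lebD x (f := fun y => f (x, y)))//.
by apply: measurableT_comp => //; exact: pair1_measurable.
Qed.

Lemma integral_shear (f : 'rV[R]_d * 'rV[R]_d -> \bar R) :
  measurable_fun setT f ->
  (\int[mu2]_z f (z.1, z.2 + z.1)%R = \int[mu2]_z f z)%E.
Proof.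
move=> mf; rewrite [LHS]integralE [RHS]integralE.
have mfp : measurable_fun setT f^\+%E by exact: measurable_funepos.
have mfn : measurable_fun setT f^\-%E by exact: measurable_funeneg.
congr (_ - _)%E.
  rewrite -(ge0_integral_shear mfp) ?funepos_ge0//.
  by apply: eq_integral => z _; rewrite !funeposE.
rewrite -(ge0_integral_shear mfn) ?funeneg_ge0//.
by apply: eq_integral => z _; rewrite !funenegE.
Qed.

Lemma integrable_shear (f : 'rV[R]_d * 'rV[R]_d -> \bar R) :
  mu2.-integrable setT f -> mu2.-integrable setT (fun z => f (z.1, z.2 + z.1)).
Proof.
move=> /integrableP[mf fi]; apply/integrableP; split.
  exact: (measurableT_comp mf measurable_shear).
rewrite (ge0_integral_shear (f := fun z => `|f z|%E))//.
exact: measurableT_comp.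
Qed.

End shear.

Section paraboloid.
Context (R : realType) (d : nat) (s : R).
Hypothesis s01 : 0 < s < 1.
Local Notation mu := (leb R d).
Local Notation mu2 := (leb R d \x leb R d)%E.
Variables (x0 : 'rV[R]_d) (r : R).
Hypothesis r0 : 0 < r.

Definition paraboloid (x : 'rV[R]_d) : R := Num.max (1 - (enorm (x - x0) / r) ^+ 2) 0.

Let cutoff (h : 'rV[R]_d) : R := Num.min ((enorm h / r) ^+ 2) 1.

Let cutoff_ge0 h : 0 <= cutoff h.
Proof. by rewrite le_min sqr_ge0 ler01. Qed.

Lemma measurable_bump : measurable_fun setT paraboloid.
Proof.
apply: measurable_maxr => //; apply: measurable_funB => //; apply: measurable_funX.
apply: measurable_funM => //; apply: measurable_enorm.
by apply: measurable_rVB => //; exact: measurable_cst.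
Qed.

Lemma bump_ge0 x : 0 <= paraboloid x. Proof. by rewrite le_max lexx orbT. Qed.

Lemma bump_le1 x : paraboloid x <= 1.
Proof. by rewrite ge_max ler01 andbT gerBl sqr_ge0. Qed.

Lemma bump_neq0 x : paraboloid x != 0 -> enorm (x - x0) < r.
Proof.
apply: contra_neqT; rewrite -leNgt => rx; apply/max_idPr.
by rewrite subr_le0 -{1}(expr1n _ 2) lerXn2r ?nnegrE ?divr_ge0 ?enorm_ge0 ?(ltW r0)//
  ler_pdivlMr ?mul1r.
Qed.

Lemma bump_ge_half x : enorm (x - x0) <= r / 2 -> 2^-1 <= paraboloid x.
Proof.
move=> xr; rewrite le_max; apply/orP; left.
have : (enorm (x - x0) / r) ^+ 2 <= 2^-1 ^+ 2.
  rewrite lerXn2r ?nnegrE ?divr_ge0 ?enorm_ge0 ?(ltW r0)//.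
  by rewrite ler_pdivrMr// mulrC.
move: (_ ^+ 2) => t; lra.
Qed.

(** The bump is a function of t = |x - x0| / r, with slope -2 t on [0, 1] and 0 beyond; t itself is
    Lipschitz with constant 1 / r. *)
Let bump_lipschitz x y : `|paraboloid x - paraboloid y| <= 2 * (enorm (x - y) / r).
Proof.
have : `|enorm (x - x0) / r - enorm (y - x0) / r| <= enorm (x - y) / r.
  rewrite -mulrBl normrM (gtr0_norm (_ : 0 < r^-1)) ?invr_gt0//.
  rewrite ler_pM2r ?invr_gt0// ler_norml.
  have /= := enormD (x - y) (y - x0); have /= := enormD (y - x) (x - x0).
  rewrite addrA subrK addrA subrK (enormB y x) => h1 h2.
  by apply/andP; split; lra.
have : 0 <= enorm (x - x0) / r by rewrite divr_ge0 ?enorm_ge0 ?ltW.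
have : 0 <= enorm (y - x0) / r by rewrite divr_ge0 ?enorm_ge0 ?ltW.
rewrite /paraboloid; move: (enorm (x - x0) / r) (enorm (y - x0) / r) (enorm (x - y) / r).
move=> a b c b0 a0 abc.
have half (t u : R) : 0 <= t -> 0 <= u -> u - t <= c -> 0 <= c ->
    Num.max (1 - t ^+ 2) 0 - Num.max (1 - u ^+ 2) 0 <= 2 * c.
  move=> t0 u0 utc c0; have [t1|t1] := leP 1 t.
    have -> : Num.max (1 - t ^+ 2) 0 = 0.
      by apply/max_idPr; rewrite subr_le0 expr_ge1.
    rewrite sub0r (@le_trans _ _ 0)// ?oppr_le0 ?le_max ?lexx ?orbT//.
    by rewrite mulr_ge0.
  have -> : Num.max (1 - t ^+ 2) 0 = 1 - t ^+ 2.
    by apply/max_idPl; rewrite subr_ge0 expr_le1// ltW.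
  have [u1|u1] := leP u 1.
    have -> : Num.max (1 - u ^+ 2) 0 = 1 - u ^+ 2.
      by apply/max_idPl; rewrite subr_ge0 expr_le1.
    have : 0 <= (t + u) * (c - (u - t)) by apply: mulr_ge0; lra.
    have : 0 <= c * (2 - (t + u)) by apply: mulr_ge0; lra.
    lra.
  have : 0 <= Num.max (1 - u ^+ 2) 0 by rewrite le_max lexx orbT.
  have : 0 <= (1 - t) * (1 - t) by exact: sqr_ge0.
  by move: (Num.max _ _) => v; lra.
have c0 : 0 <= c by exact: le_trans (normr_ge0 _) abc.
move: abc; rewrite !ler_norml => /andP[h1 h2].
apply/andP; split; last by apply: half => //; lra.
by rewrite -opprB lerN2; apply: half => //; lra.
Qed.

Let sqr_bump x y : (paraboloid x - paraboloid y) ^+ 2 <= 4 * cutoff (x - y).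
Proof.
rewrite /cutoff; case: (leP _ 1) => _.
  rewrite -real_normK ?num_real// [4](_ : _ = 2 ^+ 2 :> R); last by rewrite -natrX.
  rewrite -exprMn.
  rewrite lerXn2r ?nnegrE ?normr_ge0 ?bump_lipschitz//.
  by rewrite mulr_ge0// divr_ge0 ?enorm_ge0 ?ltW.
have := bump_ge0 x; have := bump_le1 x; have := bump_ge0 y; have := bump_le1 y.
move: (paraboloid x) (paraboloid y) => a b; nra.
Qed.

(** The bump lies above a paraboloid and touches it at [x], so that no smoothness
    is needed. *)
Lemma bump_second_difference x h : paraboloid x != 0 ->
  paraboloid x *+ 2 - paraboloid (x + h) - paraboloid (x - h) <= 2 * cutoff h.
Proof.
move=> bx; rewrite /cutoff minr_pMr// le_min; apply/andP; split; last first.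
  have := bump_le1 x; have := bump_ge0 (x + h); have := bump_ge0 (x - h); lra.
have bxE : paraboloid x = 1 - (enorm (x - x0) / r) ^+ 2.
  move: bx; rewrite /paraboloid; case: leP => //; by rewrite eqxx.
have b1 : 1 - (enorm (x + h - x0) / r) ^+ 2 <= paraboloid (x + h) by rewrite le_max lexx.
have b2 : 1 - (enorm (x - h - x0) / r) ^+ 2 <= paraboloid (x - h) by rewrite le_max lexx.
(* Parallelogram law for x - x0 and h. *)
suff : (enorm (x + h - x0) / r) ^+ 2 + (enorm (x - h - x0) / r) ^+ 2 =
  2 * (enorm (x - x0) / r) ^+ 2 + 2 * (enorm h / r) ^+ 2 by lra.
rewrite !expr_div_n !mulrA -!mulrDl; congr (_ / _).
rewrite -!mulrA -!expr2 !sqr_enorm /dotv !mulr_sumr -!big_split; apply: eq_bigr => i _ /=.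
by rewrite !mxE; ring.
Qed.

Let M (h : 'rV[R]_d) : R := cutoff h * kern s h.

Let M_ge0 h : 0 <= M h.
Proof. by rewrite mulr_ge0 ?cutoff_ge0 ?kern_ge0. Qed.

Let MB x y : M (x - y) = M (y - x).
Proof. by rewrite /M /cutoff -(kernN s (x - y)) opprB enormB. Qed.

Let measurable_M : measurable_fun setT M.
Proof. exact: measurable_kern_moment. Qed.

Let integral_M x : (\int[mu]_y (M (x - y))%:E = kern_moment d s r)%E.
Proof.
under eq_integral do rewrite MB.
apply: (ge0_integral_lebD (- x) (f := fun h => (M h)%:E)) => //.
by apply/measurable_EFinP; exact: measurable_M.
Qed.

Let B := ball x0 r.

(** The energy density of the bump vanishes unless x or y lies in its support, so up to a factor 4
    it is dominated by this function plus its reflection. *)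
Let f1 x y : \bar R := (\1_B x * M (x - y))%:E.

Let f1_ge0 x y : (0 <= f1 x y)%E.
Proof. by rewrite lee_fin mulr_ge0. Qed.

Let measurable_f1 : measurable_fun setT (fun z => f1 z.1 z.2).
Proof.
apply/measurable_EFinP; apply: measurable_funM.
  apply: measurableT_comp => //; apply: measurable_indic.
  exact: measurable_rV_ball.
by apply: measurableT_comp; [exact: measurable_M|exact: measurable_rVB].
Qed.

Let measurable_f1C : measurable_fun setT (fun z => f1 z.2 z.1).
Proof. exact: (measurableT_comp measurable_f1 (@measurable_swap _ _ _ _)). Qed.

Let integral_f1_lty : (\int[mu2]_z f1 z.1 z.2 < +oo)%E.
Proof.
have -> : (\int[mu2]_z f1 z.1 z.2 = \int[mu]_x \int[mu]_y f1 x y)%E.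
  exact: (ge0_integral_prod f1 measurable_f1 f1_ge0).
have inner x : (\int[mu]_y f1 x y = (\1_B x)%:E * kern_moment d s r)%E.
  rewrite /f1; under eq_integral do rewrite EFinM.
  rewrite ge0_integralZl; first by rewrite integral_M.
  - by [].
  - apply/measurable_EFinP; apply: measurableT_comp; first exact: measurable_M.
    by apply: measurable_rVB => //; exact: measurable_cst.
  - by move=> y _; rewrite lee_fin.
  - by rewrite lee_fin.
under eq_integral do rewrite inner.
have mB : measurable B by exact: measurable_rV_ball.
rewrite ge0_integralZr; last 4 first.
- by [].
- by apply/measurable_EFinP; exact: measurable_indic.
- by move=> x _; rewrite lee_fin.
- exact: kern_moment_ge0.
rewrite integral_indic// setIT lte_mul_pinfty//.
  by rewrite [X in X \is a fin_num]leb_ball.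
exact: kern_moment_lty.
Qed.

Let integral_f1C_lty : (\int[mu2]_z f1 z.2 z.1 < +oo)%E.
Proof.
have -> : (\int[mu2]_z f1 z.2 z.1 = \int[mu]_x \int[mu]_y f1 y x)%E.
  exact: (ge0_integral_prod (fun x y => f1 y x) measurable_f1C (fun x y => f1_ge0 y x)).
have -> : (\int[mu]_x \int[mu]_y f1 y x = \int[mu]_y \int[mu]_x f1 y x)%E.
  exact: (ge0_integral_swap (fun x y => f1 y x) measurable_f1C (fun x y => f1_ge0 y x)).
have <- : (\int[mu2]_z f1 z.1 z.2 = \int[mu]_x \int[mu]_y f1 x y)%E.
  exact: (ge0_integral_prod f1 measurable_f1 f1_ge0).
exact: integral_f1_lty.
Qed.

Lemma finite_energy_bump : finite_energy s paraboloid.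
Proof.
have mb := measurable_bump.
split => //; rewrite Hs_sqE//.
apply: (@le_lt_trans _ _ (\int[mu2]_z (4%:E * (f1 z.1 z.2 + f1 z.2 z.1)))%E).
  apply: ge0_le_integral => //.
  - by move=> z _; rewrite lee_fin form_density_ge0.
  - by apply/measurable_EFinP; exact: measurable_form_density.
  - by apply: measurable_funeM; exact: (emeasurable_funD measurable_f1 measurable_f1C).
  - move=> [x y] _ /=; rewrite /form_density /= /f1 -EFinD -EFinM lee_fin.
    have [/andP[/eqP -> /eqP ->]|nb] := boolP ((paraboloid x == 0) && (paraboloid y == 0)).
      by rewrite subrr mulr0 mul0r mulr_ge0// addr_ge0// mulr_ge0.
    have B1 v : paraboloid v != 0 -> \1_B v = 1 :> R.
      move=> bv; rewrite indicE mem_set//.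
      by rewrite /B -ball_normE /= distrC (le_lt_trans (norm_le_enorm _))// bump_neq0.
    have ge1 : 1 <= \1_B x + \1_B y :> R.
      by move: nb; rewrite negb_and => /orP[] /B1 ->; rewrite ?lerDl ?lerDr.
    rewrite (MB y) -mulrDl /M !mulrA ler_wpM2r ?kern_ge0//.
    rewrite (le_trans (sqr_bump x y))// -mulrA mulrCA -[leLHS]mul1r ler_wpM2r ?mulr_ge0//.
rewrite ge0_integralZl; last 4 first.
- by [].
- exact: (emeasurable_funD measurable_f1 measurable_f1C).
- by move=> z _; rewrite adde_ge0.
- by rewrite lee_fin.
rewrite ge0_integralD; last 5 first.
- by [].
- by move=> z _; exact: f1_ge0.
- exact: measurable_f1.
- by move=> z _; exact: f1_ge0.
- exact: measurable_f1C.
apply: lte_mul_pinfty; rewrite ?lee_fin//.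
exact: lte_add_pinfty integral_f1_lty integral_f1C_lty.
Qed.

Let integral_second_difference (psi : 'rV[R]_d -> R) h : (forall x, 0 <= psi x) ->
  mu.-integrable setT (EFin \o psi) -> (forall x, psi x != 0 -> paraboloid x != 0) ->
  mu.-integrable setT
    (fun x => ((paraboloid x - paraboloid (h + x)) * (psi x - psi (h + x)))%:E) /\
  (\int[mu]_x ((paraboloid x - paraboloid (h + x)) * (psi x - psi (h + x)))%:E <=
   (2 * cutoff h)%:E * \int[mu]_x (psi x)%:E)%E.
Proof.
move=> psi0 ipsi supp.
have mpsi : measurable_fun setT psi.
  by apply/measurable_EFinP; exact: measurable_int ipsi.
have mD (k : 'rV[R]_d) (f : 'rV[R]_d -> R) : measurable_fun setT f ->
    measurable_fun setT (fun x : 'rV[R]_d => f (x + k)).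
  by move=> mf; apply: measurableT_comp => //; apply: measurable_rVD => //;
    exact: measurable_cst.
have mb := measurable_bump.
have bnd x y : `|paraboloid x - paraboloid y| <= 1.
  have := bump_ge0 x; have := bump_le1 x; have := bump_ge0 y; have := bump_le1 y.
  by rewrite ler_norml; move: (paraboloid x) (paraboloid y) => a b; lra.
pose p x := psi x * (paraboloid x - paraboloid (x + h)).
pose q x := psi x * (paraboloid x - paraboloid (x - h)).
have ip : mu.-integrable setT (EFin \o p).
  apply: (le_integrable measurableT _ _ ipsi).
    apply/measurable_EFinP; apply: measurable_funM => //.
    by apply: measurable_funB => //; exact: mD.
  move=> x _ /=; rewrite lee_fin normrM ger0_norm//.
  by rewrite -[leRHS]mulr1 ler_wpM2l.
have iq : mu.-integrable setT (EFin \o q).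
  apply: (le_integrable measurableT _ _ ipsi).
    apply/measurable_EFinP; apply: measurable_funM => //.
    by apply: measurable_funB => //; exact: mD.
  move=> x _ /=; rewrite lee_fin normrM ger0_norm//.
  by rewrite -[leRHS]mulr1 ler_wpM2l.
(* Discrete integration by parts: once the translation in [q] is undone, [p + q] is psi times a
   second difference of the bump. *)
have -> : (fun x => ((paraboloid x - paraboloid (h + x)) * (psi x - psi (h + x)))%:E) =
    (fun x => (p x)%:E + (q (x + h))%:E)%E.
  apply/funext => x; rewrite -EFinD; congr EFin.
  by rewrite /p /q addrK (addrC h); ring.
split; first exact: (integrableD measurableT ip (integrable_lebD h iq)).
rewrite integralD; last 3 first.
- by [].
- exact: ip.
- exact: (integrable_lebD h iq).
rewrite (integral_lebD h (f := EFin \o q)); last exact: measurable_int iq.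
rewrite -integralD; last 3 first.
- by [].
- exact: ip.
- exact: iq.
rewrite -integralZl; last 2 first.
- by [].
- exact: ipsi.
apply: le_integral.
- by [].
- exact: (integrableD measurableT ip iq).
- exact: (integrableZl measurableT (2 * cutoff h) ipsi).
- move=> x _; rewrite -EFinD -EFinM lee_fin.
  have [psix0|psix] := eqVneq (psi x) 0.
    by rewrite /p /q psix0 !mul0r addr0 mulr0.
  have := bump_second_difference h (supp _ psix) => sd.
  by rewrite /p /q -mulrDr [leRHS]mulrC ler_wpM2l//; lra.
Qed.

(** With [y = x + h] and for fixed [h], a translation in [x] moves the difference
    from [psi] to the bump; this avoids principal values. *)
Lemma eform_bump_le (psi : 'rV[R]_d -> R) : finite_energy s psi -> (forall x, 0 <= psi x) ->
  mu.-integrable setT (EFin \o psi) -> (forall x, psi x != 0 -> paraboloid x != 0) ->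
  eform s paraboloid psi <= 2 * fine (kern_moment d s r) * (\int[mu]_x psi x)%R.
Proof.
move=> fpsi psi0 ipsi supp.
have iF := integrable_form finite_energy_bump fpsi.
rewrite -lee_fin -eform_EFin//; last exact: finite_energy_bump.
have I_E : (\int[mu]_x (psi x)%:E = (\int[mu]_x psi x)%R%:E)%E.
  by rewrite /Rintegral fineK// integrable_fin_num.
have iFs := integrable_shear iF.
rewrite -(integral_shear (measurable_int _ iF)).
rewrite -(integral21_prod_meas1 iFs).
have J_E : kern_moment d s r = (fine (kern_moment d s r))%:E.
  by rewrite fineK// ge0_fin_numE ?kern_moment_ge0// kern_moment_lty.
have iM : mu.-integrable setT (EFin \o M).
  apply/integrableP; split; first by apply/measurable_EFinP; exact: measurable_M.
  under eq_integral do rewrite gee0_abs ?lee_fin//.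
  exact: kern_moment_lty.
have -> : (2 * fine (kern_moment d s r) * \int[mu]_x psi x)%:E =
    (\int[mu]_h ((2 * \int[mu]_x psi x)%R%:E * (M h)%:E))%E.
  rewrite (integralZl measurableT iM).
  rewrite -[X in (_ * X)%E]/(kern_moment d s r) J_E -EFinM; congr EFin; ring.
apply: le_integral.
- by [].
- have mFs := measurable_int _ iFs.
  apply/integrableP; split; first exact: (measurable_fubini_G iFs).
  apply: le_lt_trans ((integrable21ltyP _ _ mFs).1 iFs).
  apply: ge0_le_integral => //.
  + apply: measurableT_comp => //; exact: (measurable_fubini_G iFs).
  + pose Fs (z : 'rV[R]_d * 'rV[R]_d) :=
      (EFin \o form_density s paraboloid psi) (z.1, z.2 + z.1).
    have mFa : measurable_fun setT (abse \o Fs) by exact: measurableT_comp.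
    exact: (measurable_fun_fubini_tonelli_G (abse \o Fs) mFa (fun z => abse_ge0 _)).
  + move=> h _; apply: le_abse_integral => //.
    exact: (measurableT_comp mFs (pair2_measurable h)).
- exact: (integrableZl measurableT _ iM).
- move=> h _; rewrite /fubini_G /=.
  have [ig gle] := integral_second_difference h psi0 ipsi supp.
  under eq_integral => x _.
    rewrite /form_density /= opprD addrCA subrr addr0 kernN mulrC EFinM.
    over.
  rewrite (integralZl measurableT ig).
  apply: (le_trans (lee_wpmul2l _ gle)); first by rewrite lee_fin kern_ge0.
  by rewrite I_E -!EFinM lee_fin /M le_eqVlt; apply/orP; left; apply/eqP; ring.
Qed.

End paraboloid.

Lemma powR_inv_large (R : realType) (t A : R) : 0 < t -> 0 < A ->
  exists2 r0 : R, 0 < r0 & forall r, 0 < r <= r0 -> A < (r `^ t)^-1.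
Proof.
(* At this radius r^-t equals A + 1, the 1 making the inequality strict. *)
move=> t0 A0; exists ((A + 1) `^ (- t^-1)); first by rewrite powR_gt0// addr_gt0.
move=> r /andP[r0 rr].
have A1 : 0 < A + 1 by rewrite addr_gt0.
apply: (@lt_le_trans _ _ (A + 1)); first by rewrite ltrDl.
rewrite -[leLHS]invrK lef_pV2 ?posrE ?powR_gt0 ?invr_gt0//.
have -> : (A + 1)^-1 = ((A + 1) `^ (- t^-1)) `^ t.
  by rewrite -powRrM mulNr mulVf ?gt_eqF// powR_inv1// ltW.
by apply: ge0_ler_powR => //; rewrite ?nnegrE ltW// powR_gt0.
Qed.

Lemma clamp_lipschitz (R : realType) (a b : R) : a <= b ->
  0 <= Num.min (Num.max b 0) 1 - Num.min (Num.max a 0) 1 <= b - a.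
Proof.
have h1 : Num.min 0 1 = 0 :> R by apply/min_idPl.
move=> ab; case: (leP b 0) => b0; case: (leP a 0) => a0; rewrite ?h1.
- by apply/andP; split; lra.
- lra.
- by case: (leP b 1) => b1; apply/andP; split; lra.
- by case: (leP b 1) => b1; case: (leP a 1) => a1; apply/andP; split; lra.
Qed.

(** * Weak solutions: bounds and uniform smallness *)

Section weak_solutions.
Context (R : realType) (d : nat) (s : R).
Hypothesis d0 : (0 < d)%N.
Hypothesis s01 : 0 < s < 1.
Local Notation mu := (leb R d).
Local Notation mu2 := (leb R d \x leb R d)%E.
Local Notation kern := (kern s).
Let D : R := d%:R + 2 * s.
Implicit Types (w psi : 'rV[R]_d -> R) (E : set 'rV[R]_d).

Let D0 : 0 < D.
Proof. by case/andP: s01 => s0 _; rewrite ltr_wpDl// mulr_gt0. Qed.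

Let dR0 : 0 < d%:R :> R. Proof. by rewrite ltr0n. Qed.

(** [x] is outside [E] because the kernel vanishes on the diagonal. *)
Lemma integral_indic_kern_ge E x rho : measurable E -> ~ E x ->
  (forall y, E y -> enorm (x - y) <= rho) ->
  (((rho `^ D)^-1)%:E * mu E <= \int[mu]_y (\1_E y * kern (x - y))%:E)%E.
Proof.
move=> mE xE Erho.
have mind : measurable_fun setT (\1_E : _ -> R) by exact: measurable_indic.
have -> : (mu E = \int[mu]_y (\1_E y)%:E)%E by rewrite integral_indic ?setIT.
rewrite -ge0_integralZl; last 4 first.
- by [].
- exact/measurable_EFinP.
- by move=> y _; rewrite lee_fin.
- by rewrite lee_fin invr_ge0 powR_ge0.
apply: ge0_le_integral => //.
- by move=> y _; rewrite mule_ge0// lee_fin// invr_ge0 powR_ge0.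
- by apply: measurable_funeM; exact/measurable_EFinP.
- by apply/measurable_EFinP; exact: measurable_kern_diff.
- move=> y _; rewrite -EFinM lee_fin mulrC indicE.
  case: (boolP (y \in E)) => [/set_mem yE|]; last by rewrite !mul0r.
  rewrite !mul1r; apply: kern_ge => //; last exact: Erho.
  by apply: contra_notN xE => /eqP/subr0_eq ->.
Qed.

Variable Om : set 'rV[R]_d.

(** Only truncations are tested. Boundedness, together with support in the bounded set Om, makes
    them integrable. *)
Definition test_function psi :=
  [/\ finite_energy s psi, forall x, ~ Om x -> psi x = 0,
      forall x, 0 <= psi x & exists c, forall x, psi x <= c].

(** [|(-Delta)^s w| <= G] in Omega, up to a constant factor, in the weak sense. *)
Definition weak_bounded (G : R) w :=
  [/\ finite_energy s w, forall x, ~ Om x -> w x = 0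
    & forall psi, test_function psi ->
        `|eform s w psi| <= G * (\int[mu]_x psi x)%R].

Lemma weak_boundedN G w : weak_bounded G w -> weak_bounded G (fun x => - w x).
Proof.
have Nw : (fun x => - w x) = (fun x => -1 * w x).
  by apply/funext => x; rewrite mulN1r.
move=> [fw w0 wG]; split.
- by rewrite Nw; exact: finite_energyZ.
- by move=> x Omx; rewrite w0// oppr0.
- move=> psi tpsi; have [fpsi _ _ _] := tpsi; rewrite Nw (eformZl _ fw fpsi).
  by rewrite mulN1r normrN wG.
Qed.

Lemma weak_boundedW G G' w : G <= G' -> weak_bounded G w -> weak_bounded G' w.
Proof.
move=> GG' [fw w0 wG]; split => // psi tpsi.
apply: (le_trans (wG _ tpsi)); apply: ler_wpM2r => //.
by apply: Rintegral_ge0 => x _; case: tpsi.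
Qed.

Hypothesis Om_bounded : bounded_set Om.

Lemma bounded_sub_ball : exists2 M : R, 0 < M & Om `<=` ball 0 M.
Proof.
have [M [_ HM]] := Om_bounded.
exists (Num.max 1 (M + 2)); first by rewrite lt_max ltr01.
move=> x Omx; rewrite -ball_normE /ball_ /= sub0r normrN.
apply: (@le_lt_trans _ _ (M + 1)); first by apply: HM => //; rewrite ltrDl.
by rewrite lt_max; apply/orP; right; rewrite ltrD2l ltrDr.
Qed.

Lemma integrable_bounded_support psi c : measurable_fun setT psi ->
  (forall x, ~ Om x -> psi x = 0) -> (forall x, `|psi x| <= c) ->
  mu.-integrable setT (EFin \o psi).
Proof.
move=> mpsi psi0 psic; have [M M0 OmM] := bounded_sub_ball.
have mB : measurable (ball (0 : 'rV[R]_d) M) by exact: measurable_rV_ball.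
have ib : mu.-integrable setT (EFin \o (fun x => c * \1_(ball 0 M) x)).
  apply: (@integrableZl _ _ _ mu _ measurableT c (EFin \o \1_(ball 0 M))).
  apply/integrableP; split.
    by apply/measurable_EFinP; exact: measurable_indic.
  under eq_integral do rewrite gee0_abs ?lee_fin//.
  by rewrite integral_indic// setIT [X in (X < _)%E]leb_ball ?ltry.
apply: (le_integrable measurableT _ _ ib); first exact/measurable_EFinP.
move=> x _ /=; rewrite lee_fin indicE.
have c0 : 0 <= c by apply: (le_trans (normr_ge0 (psi x))).
have [Omx|Omx] := pselect (Om x); last by rewrite psi0 ?normr0.
by rewrite mem_set ?mulr1 ?[leRHS]ger0_norm//; exact: OmM.
Qed.

Lemma integrable_test_function psi : test_function psi ->
  mu.-integrable setT (EFin \o psi).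
Proof.
move=> [[mpsi _] psi0 psi_ge0 [c psic]].
by apply: (integrable_bounded_support mpsi psi0 (c := c)) => x; rewrite ger0_norm.
Qed.

(** Comparison with the flat level c. As c >= 0, the truncation above c vanishes outside Om and is
    admissible. *)
Lemma weak_sup_estimate G w E (c lambda kappa : R) : weak_bounded G w ->
  0 <= c -> 0 < lambda -> 0 <= kappa -> measurable E ->
  (forall y, E y -> w y <= c - lambda) ->
  (forall x, Om x -> c < w x ->
    (kappa%:E <= \int[mu]_y (\1_E y * kern (x - y))%:E)%E) ->
  G < lambda * kappa -> {ae mu, forall x, w x <= c}.
Proof.
move=> [fw w0 wG] c0 lambda0 kappa0 mE Ew kE strict.
have mw : measurable_fun setT w by case: fw.
(* The cap at 1 makes psi bounded, as required of a test function, before any bound on [w] is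
   known. *)
pose psi x := Num.min (Num.max (w x - c) 0) 1.
have psi_ge0 x : 0 <= psi x by rewrite le_min ler01 andbT le_max lexx orbT.
have psi_gt0 x : psi x != 0 -> c < w x.
  apply: contra_neqT; rewrite -leNgt => wc; rewrite /psi.
  by rewrite (max_idPr _) ?subr_le0// (min_idPl _).
have lip x y : w x <= w y -> 0 <= psi y - psi x <= w y - w x.
  by move=> xy; have := @clamp_lipschitz _ (w x - c) (w y - c); rewrite lerD2r => /(_ xy);
    rewrite opprB addrA subrK.
have tpsi : test_function psi.
  split => //.
  - apply: (finite_energy_contraction _ fw).
      apply: measurable_minr => //; apply: measurable_maxr => //.
      exact: measurable_funB.
    move=> x y; have [xy|/ltW yx] := leP (w x) (w y).
      have /andP[h1 h2] := lip _ _ xy.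
      by rewrite distrC (distrC (w x)) !ger0_norm ?subr_ge0// -subr_ge0.
    by have /andP[h1 h2] := lip _ _ yx; rewrite !ger0_norm ?subr_ge0// -subr_ge0.
  - move=> x Omx; apply/eqP; apply: contraT => /psi_gt0; rewrite w0//.
    by rewrite ltNge c0.
  - by exists 1 => x; rewrite ge_min lexx orbT.
have ipsi := integrable_test_function tpsi.
have fpsi : finite_energy s psi by case: tpsi.
have form_le : eform s w psi <= G * \int[mu]_x psi x.
  exact: le_trans (ler_norm _) (wG _ tpsi).
have : {ae mu, forall x, psi x = 0}.
  (* With gamma = 0 the bending function is a placeholder; [w] with the bound G serves as such, and
     [m] is zero. *)
  apply: (@comparison_principle R d s w psi w (cst 0) E G 0 G lambda kappa 0) => //.
  - exact: ltW.
  - move=> x psix; apply: kE; last exact: psi_gt0.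
    by apply: contrapT => /w0 wx; have := psi_gt0 _ psix; rewrite wx ltNge c0.
  - move=> x _; rewrite (eq_integral (cst 0%E)) ?integral0//.
    by move=> y _ /=; rewrite mul0r.
  - move=> x y; rewrite /cst !mulr0 !mul0r !addr0 indicE.
    case: (boolP (y \in E)) => [/set_mem /Ew wy|_]; last first.
      rewrite !mulr0; have [xy|/ltW yx] := leP (w x) (w y).
        have /andP[h1 _] := lip _ _ xy.
        by rewrite -mulrNN !opprB mulr_ge0 ?subr_ge0// -subr_ge0.
      by have /andP[h1 _] := lip _ _ yx; rewrite mulr_ge0 ?subr_ge0// -subr_ge0.
    have -> : psi y = 0.
      by apply/eqP; apply: contraT => /psi_gt0; rewrite ltNge (le_trans wy)// gerBl ltW.
    rewrite mulr1 subr0; have [->|/psi_gt0 wx] := eqVneq (psi x) 0.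
      by rewrite !mulr0.
    by rewrite ler_wpM2r//; lra.
  - by rewrite mul0r mulr0 !addr0.
apply: filterS => x; apply: contra_eqT; rewrite -ltNge => cw.
by rewrite gt_eqF// lt_min ltr01 andbT lt_max subr_gt0 cw.
Qed.

End weak_solutions.

Section weak_bounds.
Context (R : realType) (d : nat) (s : R).
Hypothesis d0 : (0 < d)%N.
Hypothesis s01 : 0 < s < 1.
Local Notation mu := (leb R d).
Local Notation mu2 := (leb R d \x leb R d)%E.
Local Notation kern := (kern s).
Let D : R := d%:R + 2 * s.
Variable Om : set 'rV[R]_d.
Hypothesis Om_bounded : bounded_set Om.

Let dR0 : 0 < d%:R :> R. Proof. by rewrite ltr0n. Qed.

(** A unit cube beside a cube containing Om lies at bounded distance from all of Om, so the kernel
    is bounded below on it. *)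
Lemma exterior_kernel_mass : exists (E : set 'rV[R]_d) (kappa : R),
  [/\ measurable E, 0 < kappa, forall y, E y -> ~ Om y
    & forall x, Om x -> (kappa%:E <= \int[mu]_y (\1_E y * kern (x - y))%:E)%E].
Proof.
have [M M0 OmM] := bounded_sub_ball Om_bounded.
(* On the unit cube around [e] each coordinate exceeds M, while on Om it is below M; a single
   coordinate, available as d > 0, separates them. In sup-norm the distance is at most M + (M +
   2). *)
pose e : 'rV[R]_d := \row_i (M + 1).
pose rho := d%:R * (M + (M + 2)).
have rho0 : 0 < rho by rewrite mulr_gt0// !addr_gt0.
have EOm y : ball e 1 y -> ~ Om y.
  move=> /(ball_rVP _ _ ltr01)/(_ (Ordinal d0)); rewrite mxE => h /OmM.
  move=> /(ball_rVP _ _ M0)/(_ (Ordinal d0)); rewrite mxE subr0.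
  by move: h; rewrite !ltr_norml => /andP[h1 h2] /andP[h3 h4]; lra.
exists (ball e 1), ((rho `^ D)^-1 * (2 * 1) ^+ d); split => //.
- exact: measurable_rV_ball.
- by rewrite mulr_gt0 ?exprn_gt0 ?invr_gt0 ?powR_gt0 ?mulr1.
- move=> x Omx; rewrite EFinM -(leb_ball e ltr01).
  apply: integral_indic_kern_ge => //.
  + exact: measurable_rV_ball.
  + by move=> /EOm.
  + move=> y Ey; apply: (le_trans (enorm_le_norm _)).
    rewrite ler_wpM2l ?ler0n//.
    have /ltW xM : `|x| < M by have := OmM _ Omx; rewrite -ball_normE /= sub0r normrN.
    rewrite (le_trans (ler_normB _ _))// lerD//.
    have /ltW ey : `|e - y| < 1 by move: Ey; rewrite -ball_normE.
    have eM : `|e| <= M + 1.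
      rewrite -[`|e|]/(mx_norm e) mx_normrE; apply/bigmax_leP; split.
        by rewrite addr_ge0// ltW.
      by move=> [i j] _ /=; rewrite mxE ger0_norm// addr_ge0// ltW.
    rewrite -(subrK e y) (le_trans (ler_normD _ _))// distrC; lra.
Qed.

(** Level and gap are both taken equal to M: [w] vanishes on the exterior set, hence lies M below
    the level M there. M is chosen so that M kappa > G. *)
Lemma weak_bounded_essentially_bounded G w : weak_bounded s Om G w ->
  exists2 M : R, 0 < M & {ae mu, forall x, `|w x| <= M}.
Proof.
move=> wG; have [E [kappa [mE kappa0 EOm kE]]] := exterior_kernel_mass.
pose M := (`|G| + 1) / kappa.
have M0 : 0 < M by rewrite divr_gt0// ltr_wpDl.
have GM : G < M * kappa.
  by rewrite divfK ?gt_eqF// (le_lt_trans (ler_norm _))// ltrDl.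
have ub v : weak_bounded s Om G v -> {ae mu, forall x, v x <= M}.
  move=> vG; apply: (weak_sup_estimate Om_bounded vG (ltW M0) M0 (ltW kappa0) mE) => //.
    by case: vG => _ v0 _ y /EOm /v0 ->; rewrite subrr.
  by move=> x Omx _; exact: kE.
exists M => //.
have := ub _ (weak_boundedN wG); have := ub _ wG; apply: filterS2 => x h1 h2.
by rewrite ler_norml lerNl h1 h2.
Qed.

(** Keep in the energy only the pairs with y in the exterior set, where w y = 0. *)
Lemma poincare_inequality : exists2 kappa : R, 0 < kappa &
  forall w : 'rV[R]_d -> R, measurable_fun setT w ->
    (forall x, ~ Om x -> w x = 0) ->
  (kappa%:E * \int[mu]_x (w x ^+ 2)%:E <= Hs_sq s w)%E.
Proof.
have [E [kappa [mE kappa0 EOm kE]]] := exterior_kernel_mass.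
exists kappa => // w mw w0; rewrite Hs_sqE//.
have mind : measurable_fun setT (\1_E : _ -> R) by exact: measurable_indic.
have mw2 : measurable_fun setT (fun x => w x ^+ 2) by exact: measurable_funX.
apply: (@le_trans _ _
  (\int[mu2]_z (w z.1 ^+ 2 * \1_E z.2 * kern (z.1 - z.2))%:E)%E).
  rewrite (ge0_integral_tensor_kern _ mw2 mind)//; last by move=> x; exact: sqr_ge0.
  rewrite -ge0_integralZl; last 4 first.
  - by [].
  - exact/measurable_EFinP.
  - by move=> x _; rewrite lee_fin sqr_ge0.
  - by rewrite lee_fin ltW.
  apply: ge0_le_integral => //.
  - by move=> x _; rewrite mule_ge0// lee_fin ?sqr_ge0// ltW.
  - by apply: measurable_funeM; exact/measurable_EFinP.
  - apply: emeasurable_funM; first exact/measurable_EFinP.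
    exact: measurable_integral_kern.
  - move=> x _; have [Omx|/w0 ->] := pselect (Om x).
      by rewrite muleC lee_wpmul2l ?lee_fin ?sqr_ge0// kE.
    by rewrite expr0n/= mule0 mul0e.
apply: ge0_le_integral => //.
- by move=> z _; rewrite lee_fin mulr_ge0 ?kern_ge0// mulr_ge0 ?sqr_ge0.
- by apply/measurable_EFinP; exact: (measurable_tensor_kern s mw2 mind).
- by apply/measurable_EFinP; exact: measurable_form_density.
- move=> z _; rewrite lee_fin /form_density ler_wpM2r ?kern_ge0// -expr2 indicE.
  case: (boolP (z.2 \in E)) => [/set_mem/EOm/w0 ->|_]; last by rewrite mulr0 sqr_ge0.
  by rewrite mulr1 subr0.
Qed.

(** Lower bound of the kernel on a cube of radius rho times the volume of this cube: only rho^(-2 s)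
    survives. *)
Lemma kernel_mass_scaling (rho : R) : 0 < rho ->
  ((d%:R * rho) `^ D)^-1 * (2 * rho) ^+ d =
  (d%:R `^ D)^-1 * 2 ^+ d * (rho `^ (2 * s))^-1.
Proof.
move=> r0; rewrite powRM ?ler0n ?ltW// /D (powRD (x := rho)) ?(gt_eqF r0) ?implybT//.
rewrite powR_mulrn ?ltW// exprMn; field.
by rewrite !gt_eqF ?powR_gt0 ?exprn_gt0.
Qed.

(** By the Poincare and Chebyshev inequalities, small energy forces {w > c / 2} to have small
    measure. Then at least half of every cube of a fixed small radius r lies c / 2 below the level
    c, and the singular kernel turns this into a mass large enough for the comparison. *)
Lemma weak_bounded_uniformly_small G c : 0 < c -> exists2 delta : R, 0 < delta &
  forall w, weak_bounded s Om G w -> (Hs_sq s w <= delta%:E)%E ->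
    {ae mu, forall x, w x <= c}.
Proof.
move=> c0; have [kappa0 kappa0_gt0 poincare] := poincare_inequality.
(* Half a cube of radius r, seen from its centre, has kernel mass at least [C1] r^(-2 s). *)
pose C1 := (d%:R `^ D)^-1 * 2 ^+ d * 2^-1.
have C10 : 0 < C1.
  by rewrite !mulr_gt0 ?exprn_gt0 ?invr_gt0 ?powR_gt0.
have s2 : 0 < 2 * s by case/andP: s01 => ? _; rewrite mulr_gt0.
have A0 : 0 < (`|G| + 1) / (c / 2 * C1).
  by apply: divr_gt0; [rewrite ltr_wpDl|apply: mulr_gt0 => //; rewrite divr_gt0].
have [r r0 rbig] := powR_inv_large s2 A0.
have {rbig}rbig := rbig r _; rewrite r0 lexx /= in rbig.
pose eta := (2 * r) ^+ d / 2.
have eta0 : 0 < eta by rewrite divr_gt0 ?exprn_gt0 ?mulr_gt0.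
(* Chebyshev: kappa0 (c / 2)^2 times the measure of {w > c / 2} is at most the energy, so that
   measure is at most eta, half the volume of a cube of radius r. *)
exists (kappa0 * (c / 2) ^+ 2 * eta).
  by apply: mulr_gt0 => //; apply: mulr_gt0 => //; rewrite exprn_gt0// divr_gt0.
move=> w wG wd; have [fw w0 _] := wG; have mw : measurable_fun setT w by case: fw.
pose F := [set x | c / 2 < w x].
have mF : measurable F.
  rewrite (_ : F = w @^-1` `]c / 2, +oo[%classic); last first.
    by apply/seteqP; split => x /=; rewrite in_itv/= andbT.
  by rewrite -[X in measurable X]setTI; exact: mw.
have Feta : (mu F <= eta%:E)%E.
  have k0 : 0 < kappa0 * (c / 2) ^+ 2 by rewrite mulr_gt0// exprn_gt0// divr_gt0.
  rewrite -(@lee_pmul2l _ (kappa0 * (c / 2) ^+ 2)%:E)// -EFinM.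
  apply: le_trans wd; apply: le_trans (poincare _ mw w0).
  rewrite EFinM -muleA lee_wpmul2l ?lee_fin ?(ltW kappa0_gt0)//.
  have -> : (mu F = \int[mu]_x (\1_F x)%:E)%E by rewrite integral_indic ?setIT.
  have mindF : measurable_fun setT (\1_F : _ -> R) by exact: measurable_indic.
  rewrite -ge0_integralZl; last 4 first.
  - by [].
  - exact/measurable_EFinP.
  - by move=> x _; rewrite lee_fin.
  - by rewrite lee_fin sqr_ge0.
  apply: ge0_le_integral => //.
  - by move=> x _; rewrite mule_ge0// lee_fin ?sqr_ge0.
  - by apply: measurable_funeM; exact/measurable_EFinP.
  - by apply/measurable_EFinP; exact: measurable_funX.
  - move=> x _; rewrite -EFinM lee_fin indicE.
    case: (boolP (x \in F)) => [/set_mem Fx|_]; last by rewrite mulr0 sqr_ge0.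
    by rewrite mulr1 lerXn2r ?nnegrE ?divr_ge0 ?ltW// (le_lt_trans _ Fx)// divr_ge0// ltW.
pose kappa := C1 * (r `^ (2 * s))^-1.
apply: (weak_sup_estimate Om_bounded (E := ~` F) (lambda := c / 2) (kappa := kappa) wG) => //.
- exact: ltW.
- by rewrite divr_gt0.
- by rewrite mulr_ge0 ?invr_ge0 ?powR_ge0// ltW.
- exact: measurableC.
- by move=> y /negP; rewrite -leNgt; lra.
- move=> x Omx cx.
  have mB : measurable (ball x r) by exact: measurable_rV_ball.
  pose E' := ~` F `&` ball x r.
  have mE' : measurable E' by apply: measurableI => //; exact: measurableC.
  have E'eta : (eta%:E <= mu E')%E.
    have : (mu (ball x r) <= mu E' + mu F)%E.
      apply: (le_trans (le_measure _ _ _ (_ : _ `<=` E' `|` F))); rewrite ?inE//.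
      - exact: measurableU.
      - by move=> y By; have [Fy|Fy] := pselect (F y); [right|left].
      - exact: measureU2.
    rewrite [X in (X <= _)%E]leb_ball// => h.
    have : (((2 * r) ^+ d)%:E <= mu E' + eta%:E)%E by rewrite (le_trans h)// leeD2l.
    by rewrite -leeBlDr// -EFinB; congr (_%:E <= _)%E; rewrite /eta; field.
  apply: (@le_trans _ _ (\int[mu]_y (\1_E' y * kern (x - y))%:E)%E); last first.
    apply: ge0_le_integral => //.
    + by move=> y _; rewrite lee_fin mulr_ge0 ?kern_ge0.
    + by apply/measurable_EFinP; apply: measurable_kern_diff; exact: measurable_indic.
    + by apply/measurable_EFinP; apply: measurable_kern_diff; apply: measurable_indic;
        exact: measurableC.
    + move=> y _; rewrite lee_fin ler_wpM2r ?kern_ge0// !indicE ler_nat.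
      by case: (boolP (y \in E')) => // /set_mem[Fy _]; rewrite mem_set.
  apply: le_trans (@integral_indic_kern_ge _ _ _ s01 E' x (d%:R * r) mE' _ _).
  + rewrite (_ : kappa = ((d%:R * r) `^ D)^-1 * eta); last first.
      by rewrite /kappa /eta mulrA kernel_mass_scaling// /C1; ring.
    by rewrite EFinM lee_wpmul2l// lee_fin invr_ge0 powR_ge0.
  + by move=> [+ _]; apply; rewrite /F /=; lra.
  + move=> y [_]; rewrite -ball_normE /= => /ltW xy.
    by rewrite (le_trans (enorm_le_norm _))// ler_wpM2l ?ler0n.
- move: (rbig isT); rewrite ltr_pdivrMr; last by apply: mulr_gt0 => //; rewrite divr_gt0.
  move=> h; rewrite (le_lt_trans (ler_norm _))// /kappa.
  rewrite [ltRHS](_ : _ = (r `^ (2 * s))^-1 * (c / 2 * C1)); last by ring.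
  by rewrite (le_lt_trans _ h)// lerDl.
Qed.

End weak_bounds.

Lemma ler_dist_maxr (R : realDomainType) (a b c : R) :
  `|Num.max a c - Num.max b c| <= `|a - b|.
Proof.
have := ler_norm (a - b); have := ler_norm (b - a); rewrite (distrC b).
have := normr_ge0 (a - b); move: `|a - b| => t t0 h1 h2.
rewrite ler_norml; case: (leP a c) => ac; case: (leP b c) => bc;
  apply/andP; split; lra.
Qed.

Lemma ler_dist_minr (R : realDomainType) (a b c : R) :
  `|Num.min a c - Num.min b c| <= `|a - b|.
Proof.
have := ler_norm (a - b); have := ler_norm (b - a); rewrite (distrC b).
have := normr_ge0 (a - b); move: `|a - b| => t t0 h1 h2.
rewrite ler_norml; case: (leP a c) => ac; case: (leP b c) => bc;
  apply/andP; split; lra.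
Qed.

(** * Local decay around a point *)

Section weak_decay.
Context (R : realType) (d : nat) (s : R).
Hypothesis d0 : (0 < d)%N.
Hypothesis s01 : 0 < s < 1.
Local Notation mu := (leb R d).
Local Notation kern := (kern s).
Let D : R := d%:R + 2 * s.
Variable Om : set 'rV[R]_d.
Hypothesis Om_bounded : bounded_set Om.

Let dR0 : 0 < d%:R :> R. Proof. by rewrite ltr0n. Qed.

Let s2 : 0 < 2 * s. Proof. by case/andP: s01 => ? _; rewrite mulr_gt0. Qed.

(** A set filling the proportion c0 of a cube of radius r is within Euclidean distance 2 d r of each
    point of the cube, hence has kernel mass at least [C1 c0] r^(-2 s) there. *)
Let C1 c0 : R := c0 * ((d%:R `^ D)^-1 * (2 `^ (2 * s))^-1).

Let C1_gt0 c0 : 0 < c0 -> 0 < C1 c0.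
Proof. by move=> c00; rewrite !mulr_gt0 ?invr_gt0 ?powR_gt0. Qed.

Let near_mass (x0 x : 'rV[R]_d) r c0 E : 0 < r -> 0 < c0 -> measurable E ->
  E `<=` ball x0 r -> ((c0 * (2 * r) ^+ d)%:E <= mu E)%E -> ball x0 r x -> ~ E x ->
  ((C1 c0 * (r `^ (2 * s))^-1)%:E <= \int[mu]_y (\1_E y * kern (x - y))%:E)%E.
Proof.
move=> r0 c00 mE Er Emass xr xE.
apply: le_trans (@integral_indic_kern_ge _ _ _ s01 E x (d%:R * (2 * r)) mE xE _).
  apply: le_trans (lee_wpmul2l _ Emass); last by rewrite lee_fin invr_ge0 powR_ge0.
  rewrite -EFinM lee_fin le_eqVlt; apply/orP; left; apply/eqP.
  have r20 : 0 < 2 * r by rewrite mulr_gt0.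
  have h : ((d%:R * (2 * r)) `^ D)^-1 * (2 * r) ^+ d =
      (d%:R `^ D)^-1 * ((2 `^ (2 * s))^-1 * (r `^ (2 * s))^-1).
    apply: (@mulfI _ (2 ^+ d)); first by rewrite expf_neq0.
    rewrite -invfM -powRM ?ltW// mulrCA -exprMn kernel_mass_scaling//.
    by rewrite mulrCA mulrA.
  by rewrite mulrCA h /C1; ring.
move=> y /Er yr; rewrite (le_trans (enorm_le_norm _))// ler_wpM2l ?ler0n//.
move: xr yr; rewrite -!ball_normE /= => xr yr.
have -> : x - y = (x0 - y) - (x0 - x) by rewrite opprB [RHS]addrC addrA subrK.
by rewrite (le_trans (ler_normB _ _))//; lra.
Qed.

(** As [m] vanishes on the cube of radius r1, a point of the half-size cube sees it only from
    distance r1 / 2 on. The bound does not involve the scale r at which the level is bent. *)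
Let far_mass (x0 x : 'rV[R]_d) r1 M (m : 'rV[R]_d -> R) : 0 < r1 ->
  measurable_fun setT m -> (forall y, 0 <= m y) -> 0 <= M ->
  {ae mu, forall y, m y <= M} -> {ae mu, forall y, ball x0 r1 y -> m y = 0} ->
  ball x0 (r1 / 2) x ->
  (\int[mu]_y (m y * kern (x - y))%:E <= M%:E * kern_moment d s (r1 / 2))%E.
Proof.
move=> r10 mm m0 M0 mM mB xr.
have r20 : 0 < r1 / 2 by rewrite divr_gt0.
have M0e : (0 <= M%:E)%E by rewrite lee_fin.
apply: (le_trans _ (lee_wpmul2l M0e (kern_tail_le s x r20))).
have mt : measurable_fun setT (fun y : 'rV[R]_d =>
    if r1 / 2 <= enorm (x - y) then kern (x - y) else 0).
  apply: measurable_fun_ifT => //.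
    apply: measurable_fun_ler => //; apply: measurable_enorm.
    by apply: measurable_rVB => //; exact: measurable_cst.
  apply: measurableT_comp; first exact: measurable_kern.
  by apply: measurable_rVB => //; exact: measurable_cst.
rewrite -ge0_integralZl; last 4 first.
- by [].
- exact/measurable_EFinP.
- by move=> y _; rewrite lee_fin; case: ifP => // _; exact: kern_ge0.
- by rewrite lee_fin.
apply: ae_ge0_le_integral => //.
- by move=> y _; rewrite lee_fin mulr_ge0// kern_ge0.
- by apply/measurable_EFinP; exact: measurable_kern_diff.
- by move=> y _; rewrite -EFinM lee_fin mulr_ge0//; case: ifP => // _; exact: kern_ge0.
- by apply: measurable_funeM; exact/measurable_EFinP.
- move: mB mM; apply: filterS2 => y my0 myM _; rewrite -EFinM lee_fin.
  case: (leP (r1 / 2) (enorm (x - y))) => h; first by rewrite ler_wpM2r ?kern_ge0.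
  rewrite my0 ?mul0r ?mulr0//.
  move: xr; rewrite -!ball_normE /= => xr.
  have -> : x0 - y = (x0 - x) + (x - y) by rewrite addrA subrK.
  have xy := norm_le_enorm (x - y).
  by rewrite (le_lt_trans (ler_normD _ _))//; lra.
Qed.

(** If [top] is an essential upper bound of [w] near [x0] up to any [delta > 0]
    and [w <= ell] on a fixed proportion of arbitrarily small balls, then [top]
    is not sharp: at scale [r -> 0], the gain [r^(-2 s)] of the comparison
    principle beats [G] and the contribution of points far from [x0]. *)
Lemma weak_decay G w Mw (x0 : 'rV[R]_d) (top ell c0 : R) :
  weak_bounded s Om G w -> {ae mu, forall x, `|w x| <= Mw} -> ell < top -> 0 < c0 ->
  (forall delta, 0 < delta -> exists2 r, 0 < r &
     {ae mu, forall x, ball x0 r x -> w x <= top + delta}) ->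
  ((exists2 rho, 0 < rho & ball x0 rho `<=` Om) \/ 0 <= ell) ->
  (forall rho, 0 < rho -> exists2 r, 0 < r <= rho &
     ((c0 * (2 * r) ^+ d)%:E <= mu (ball x0 r `&` [set x | (w x <= ell)%R]))%E) ->
  exists delta r, [/\ 0 < delta, 0 < r &
     {ae mu, forall x, ball x0 r x -> w x <= top - delta}].
Proof.
move=> wG wM elltop c00 wtop inOm mass.
have [fw w0 _] := wG; have mw : measurable_fun setT w by case: fw.
pose g := top - ell; have g0 : 0 < g by rewrite subr_gt0.
pose C := C1 c0; have C0 : 0 < C by exact: C1_gt0.
pose J := fine (kern_moment d s 1).
have J0 : 0 <= J by rewrite fine_ge0// kern_moment_ge0.
(* Chosen so that (g - gamma) C - 2 gamma J = g C / 2: the gain minus the cost of bending keeps half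
   of g C, up to the factor r^(-2 s). *)
pose gamma := g * C / (2 * (C + 2 * J)).
have CJ0 : 0 < C + 2 * J by rewrite ltr_pwDl// mulr_ge0.
have gamma0 : 0 < gamma by apply: divr_gt0; exact: mulr_gt0.
have gammaE : gamma * (C + 2 * J) = g * C / 2.
  by rewrite /gamma; field; rewrite gt_eqF.
have gammag : gamma < g.
  rewrite -(ltr_pM2r CJ0) gammaE; have : 0 < g * C by rewrite mulr_gt0.
  have : 0 <= g * J by rewrite mulr_ge0// ltW.
  by rewrite mulrDr; lra.
(* The level exceeds [top] by gamma / 4, so that w <= k near x0, but bending lowers it by at least
   gamma / 2 near the centre: a net descent of gamma / 4 below [top]. *)
pose k := top + gamma / 4.
have [|r1 r10 wk] := wtop (gamma / 4); first by rewrite divr_gt0.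
pose M := `|Mw| + `|k|.
have M0 : 0 <= M by rewrite addr_ge0.
pose tau := M * fine (kern_moment d s (r1 / 2)).
have r120 : 0 < r1 / 2 by rewrite divr_gt0.
have tau0 : 0 <= tau by rewrite mulr_ge0// fine_ge0// kern_moment_ge0.
have A0 : 0 < (`|G| + 2 * tau + 1) / (g * C / 2).
  apply: divr_gt0; first by rewrite ltr_wpDl// addr_ge0// mulr_ge0.
  by apply: divr_gt0 => //; exact: mulr_gt0.
have [r2 r20 rbig] := powR_inv_large s2 A0.
(* Either case makes psi vanish outside Om: its support lies in Om, or the bent level stays above
   ell >= 0 while w = 0 there. *)
have [rho rho0 Hrho] : exists2 rho, 0 < rho & ball x0 rho `<=` Om \/ 0 <= ell.
  case: inOm => [[rho rho0 H]|H]; first by exists rho => //; left.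
  by exists 1 => //; right.
have [|r /andP[r0 rr] rmass] := mass (Num.min (r1 / 2) (Num.min r2 rho)).
  by rewrite !lt_min r120 r20 rho0.
move: rr; rewrite !le_min => /and3P[rr1 rr2 rrho].
have {rbig} rbig : (`|G| + 2 * tau + 1) / (g * C / 2) < (r `^ (2 * s))^-1.
  by apply: rbig; rewrite r0.
pose b := paraboloid x0 r.
have b_ge0 x : 0 <= b x by exact: bump_ge0.
have b_le1 x : b x <= 1 by exact: bump_le1.
have fb : finite_energy s b by exact: finite_energy_bump.
have mb : measurable_fun setT b by case: fb.
(* Where w <= k this is [w] minus the bent level k - gamma b. The cap at 0 confines psi to the
   support of the bump, and [m] records what is cut off. *)
pose W x := Num.min (w x - k) 0 + gamma * b x.
pose psi x := Num.max (W x) 0.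
pose m x := Num.max (w x - k) 0.
pose E := ball x0 r `&` [set x | w x <= ell].
have psi_ge0 x : 0 <= psi x by rewrite le_max lexx orbT.
have psiW x : psi x != 0 -> 0 < W x.
  by apply: contra_neqT; rewrite -leNgt => Wx; exact/max_idPr.
have psiWE x : psi x != 0 -> psi x = W x.
  by move=> /psiW/ltW Wx; exact/max_idPl.
have minw0 x : Num.min (w x - k) 0 <= 0 by rewrite ge_min lexx orbT.
have psib x : psi x != 0 -> b x != 0.
  move=> /psiW; apply: contraTneq => bx; rewrite -leNgt /W bx mulr0 addr0.
  exact: minw0.
have psiball x : psi x != 0 -> ball x0 r x.
  move=> /psib /(bump_neq0 r0) h; rewrite -ball_normE /= distrC.
  exact: le_lt_trans (norm_le_enorm _) h.
have psiw x : psi x != 0 -> k - gamma < w x.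
  move=> /psiW; rewrite /W => Wx.
  have : gamma * b x <= gamma by rewrite ger_pMr.
  have : Num.min (w x - k) 0 <= w x - k by rewrite ge_min lexx.
  lra.
have gk : g + ell <= k by rewrite /k /g subrK lerDl divr_ge0// ltW.
have tpsi : test_function s Om psi.
  split.
  - have fmin : finite_energy s (fun x => Num.min (w x - k) 0).
      apply: (finite_energy_contraction _ fw).
        by apply: measurable_minr => //; exact: measurable_funB.
      move=> x y; apply: (le_trans (ler_dist_minr _ _ _)).
      by rewrite opprB addrA subrK.
    have fW : finite_energy s W.
      exact: (finite_energyD fmin (finite_energyZ gamma fb)).
    apply: (finite_energy_contraction _ fW); last by move=> x y; exact: ler_dist_maxr.
    by apply: measurable_maxr => //; case: fW.
  - move=> x Omx; apply/eqP; apply: contraT => psix; case: Hrho => [Hb|ell0].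
      case: Omx; apply: Hb; apply: le_ball rrho _ _; exact: psiball.
    by have := psiw _ psix; rewrite w0//; lra.
  - exact: psi_ge0.
  - exists gamma => x; rewrite ge_max (ltW gamma0) andbT /W.
    have : gamma * b x <= gamma by rewrite ger_pMr.
    by have := minw0 x; lra.
have [fpsi _ _ _] := tpsi.
have ipsi := integrable_test_function Om_bounded tpsi.
have form_le : eform s w psi <= G * \int[mu]_x psi x.
  by case: wG => _ _ wG; exact: le_trans (ler_norm _) (wG _ tpsi).
pose q := (r `^ (2 * s))^-1.
have q0 : 0 < q by rewrite invr_gt0 powR_gt0.
have JrE : fine (kern_moment d s r) = q * J.
  rewrite kern_momentE// /J; have : kern_moment d s 1 \is a fin_num.
    by rewrite ge0_fin_numE ?kern_moment_ge0// kern_moment1_lty.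
  by move=> /fineK <-; rewrite -EFinM.
have mE : measurable E.
  apply: measurableI; first exact: measurable_rV_ball.
  rewrite (_ : [set x | _] = w @^-1` `]-oo, ell]%classic); last first.
    by apply/seteqP; split => x /=; rewrite in_itv.
  by rewrite -[X in measurable X]setTI; exact: mw.
have : {ae mu, forall x, psi x = 0}.
  apply: (@comparison_principle R d s w psi b m E G gamma (2 * (q * J)) (g - gamma)
    (C * q) tau) => //.
  - by apply: measurable_maxr => //; exact: measurable_funB.
  - by move=> x; rewrite le_max lexx orbT.
  - exact: ltW.
  - by rewrite subr_ge0 ltW.
  - by rewrite mulr_ge0// ltW.
  - by rewrite -JrE; exact: eform_bump_le.
  - move=> x psix; apply: near_mass rmass _ _ => //; first exact: psiball.
    by move=> [_] /=; have := psiw _ psix; lra.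
  - move=> x psix; rewrite /tau EFinM fineK; last first.
      by rewrite ge0_fin_numE ?kern_moment_ge0// kern_moment_lty.
    apply: far_mass (le_ball rr1 (psiball _ psix)) => //.
    + by apply: measurable_maxr => //; exact: measurable_funB.
    + by move=> y; rewrite le_max lexx orbT.
    + apply: filterS wM => y wy; rewrite ge_max M0 andbT /M.
      have := ler_norm (w y); have := ler_norm Mw; have := ler_norm (- k).
      by rewrite normrN; lra.
    + by apply: filterS wk => y wy yr1; apply/max_idPr; rewrite subr_le0 wy.
  - move=> x y; have wE v : w v = k + (W v - gamma * b v) + m v.
      rewrite /W /m addrK; case: (leP (w v - k) 0) => h; lra.
    (* Expand w = k + W - gamma b + m. In (m x - m y) (psi x - psi y) the diagonal products are
       nonnegative and the mixed ones are the allowed error. *)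
    have cross : (W x - W y) * (psi x - psi y) <= (w x - w y) * (psi x - psi y) +
        gamma * ((b x - b y) * (psi x - psi y)) + (psi x * m y + m x * psi y).
      rewrite (wE x) (wE y).
      have : 0 <= m x * psi x by rewrite mulr_ge0// le_max lexx orbT.
      have : 0 <= m y * psi y by rewrite mulr_ge0// le_max lexx orbT.
      lra.
    apply: le_trans cross; rewrite indicE.
    have mono : 0 <= (W x - W y) * (psi x - psi y).
      rewrite /psi; move: (W x) (W y) => u v.
      case: (leP u 0) => h1; case: (leP v 0) => h2.
      - by rewrite subrr mulr0.
      - by rewrite sub0r mulrN -mulNr mulr_ge0 ?(ltW h2)//; lra.
      - by rewrite subr0 mulr_ge0 ?(ltW h1)//; lra.
      - exact: sqr_ge0.
    case: (boolP (y \in E)) => [/set_mem[_ /= wy]|_]; last by rewrite !mulr0.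
    have Wy : W y <= - (g - gamma).
      have : gamma * b y <= gamma by rewrite ger_pMr.
      have : Num.min (w y - k) 0 <= w y - k by rewrite ge_min lexx.
      by rewrite /W; lra.
    have -> : psi y = 0 by apply/max_idPr; lra.
    rewrite mulr1 subr0; have [->|psix] := eqVneq (psi x) 0; first by rewrite !mulr0.
    rewrite ler_wpM2r//; have := psiW _ psix; lra.
  - move: rbig; rewrite ltr_pdivrMr; last by apply: divr_gt0 => //; exact: mulr_gt0.
    rewrite -/q => h; have := ler_norm G.
    have : q * (gamma * (C + 2 * J)) = q * (g * C / 2) by rewrite gammaE.
    lra.
(* A cube of radius r / (2 d) lies in the Euclidean ball of radius r / 2, where the bump is at least
   1/2. *)
move=> psi_ae0; exists (gamma / 4), (r / (2 * d%:R)); split.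
- by rewrite divr_gt0.
- by rewrite divr_gt0 ?mulr_gt0.
apply: filterS psi_ae0 => x psix xr.
have bx : 2^-1 <= b x.
  apply: bump_ge_half => //; move: xr; rewrite -ball_normE /= distrC => /ltW xr.
  apply: (le_trans (enorm_le_norm _)).
  apply: (le_trans (ler_wpM2l (ler0n _ _) xr)).
  by rewrite le_eqVlt; apply/orP; left; apply/eqP; field; rewrite gt_eqF.
have : W x <= 0 by rewrite -psix le_max lexx.
rewrite /W => Wx.
have : gamma * 2^-1 <= gamma * b x by rewrite ler_wpM2l// ltW.
case: (leP (w x - k) 0) Wx => h; rewrite /k in h *; lra.
Qed.

End weak_decay.

(** * Essential limits and continuous representatives *)

Lemma negligible_countable_bigcup d (X : measurableType d) (R : realType)
    (mu : {measure set X -> \bar R}) (T : countType) (F : T -> set X) :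
  (forall t, mu.-negligible (F t)) -> mu.-negligible (\bigcup_t F t).
Proof.
move=> NF; pose G n := if unpickle n is Some t then F t else set0.
apply: (@negligibleS _ _ _ _ (\bigcup_n G n)).
  by move=> x [t _ Ftx]; exists (pickle t) => //; rewrite /G pickleK.
apply: negligible_bigcup => n; rewrite /G; case: unpickle => // .
exact: negligible_set0.
Qed.

Section rational_balls.
Context (R : realType) (d : nat).

(** Cubes with rational centre and radius 1 / (n + 1): a countable base, used to globalize
    negligibility and to count extremal values. *)
Definition rball (t : 'rV[rat]_d * nat) : set 'rV[R]_d :=
  ball (map_mx ratr t.1 : 'rV[R]_d) t.2.+1%:R^-1.

Lemma rball_sub (x : 'rV[R]_d) r : 0 < r ->
  exists2 t, rball t x & rball t `<=` ball x r.
Proof.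
move=> r0; pose k := Num.bound (2 / r).
have k0 : 0 < k.+1%:R^-1 :> R by rewrite invr_gt0.
have kr : 2 * k.+1%:R^-1 <= r.
  rewrite ler_pdivrMr// mulrC -ler_pdivrMr// ltW// (lt_le_trans (archi_boundP _))//.
    by rewrite divr_ge0// ltW.
  by rewrite ler_nat.
have /choice[q Hq] : forall i, exists q : rat,
    x ord0 i - k.+1%:R^-1 < ratr q < x ord0 i + k.+1%:R^-1.
  move=> i; have [|q] := @rat_in_itvoo R (x ord0 i - k.+1%:R^-1) (x ord0 i + k.+1%:R^-1).
    by rewrite ltrD2l gtrN.
  by rewrite in_itv/= => h; exists q.
have xq : rball (\row_i q i, k) x.
  apply/(ball_rVP _ _ k0) => i; rewrite !mxE distrC ltr_distl.
  exact: Hq.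
exists (\row_i q i, k) => // y yq.
apply: (le_ball kr); rewrite mulr_natl mulr2n; apply: ball_triangle yq.
exact: ball_sym.
Qed.

Lemma locally_negligible (N : set 'rV[R]_d) :
  (forall x, exists2 r, 0 < r & (leb R d).-negligible (N `&` ball x r)) ->
  (leb R d).-negligible N.
Proof.
move=> H; pose F t := [set x | (leb R d).-negligible (N `&` rball t) /\ (N `&` rball t) x].
apply: (@negligibleS _ _ _ _ (\bigcup_t F t)).
  move=> x Nx; have [r r0 Nr] := H x; have [t tx tr] := rball_sub x r0.
  exists t => //; split; last by [].
  by apply: negligibleS Nr; exact: setIS.
apply: negligible_countable_bigcup => t; have [Nt|Nt] := pselect ((leb R d).-negligible (N `&` rball t)).
  by apply: negligibleS Nt => x [].
by rewrite (_ : F t = set0) -?subset0; [exact: negligible_set0|move=> x []].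
Qed.

(** Balls have positive measure. This extracts actual points from properties that hold almost
    everywhere. *)
Lemma ae_ball_witness (P : 'rV[R]_d -> Prop) x r : 0 < r ->
  {ae leb R d, forall y, ball x r y -> P y} -> exists2 y, ball x r y & P y.
Proof.
move=> r0 aeP; apply: contrapT => noy.
have : (leb R d).-negligible (ball x r).
  apply: negligibleS aeP => y By /(_ By) Py; apply: noy; exists y => //.
rewrite negligibleP; last exact: measurable_rV_ball.
move=> h; have := leb_ball x r0; rewrite [LHS]h => -[] /esym/eqP.
by rewrite expf_eq0 mulf_eq0 pnatr_eq0/= (gt_eqF r0) andbF.
Qed.

End rational_balls.

Section essential_limits.
Context (R : realType) (d : nat).
Local Notation mu := (leb R d).
Implicit Types (w : 'rV[R]_d -> R) (x : 'rV[R]_d).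

Definition near_bound w x0 c :=
  exists2 r : R, 0 < r & {ae mu, forall x, ball x0 r x -> w x <= c}.

(** The infimum of the essential upper bounds near x0; it is finite because each such bound is
    tested at a point where |w| <= M. *)
Lemma essential_limsup w x0 M : {ae mu, forall x, `|w x| <= M} ->
  exists top : R, (forall delta, 0 < delta -> near_bound w x0 (top + delta)) /\
    (forall delta, 0 < delta -> ~ near_bound w x0 (top - delta)).
Proof.
move=> wM; pose S := [set c | near_bound w x0 c].
have S0 : S !=set0.
  exists M; exists 1 => //; apply: filterS wM => x wx _.
  exact: le_trans (ler_norm _) wx.
have Slb : lbound S (- M).
  move=> c [r r0 wc].
  have [x xr [h1 h2]] : exists2 x, ball x0 r x & w x <= c /\ `|w x| <= M.
    by apply: ae_ball_witness => //; move: wc wM; apply: filterS2 => x h1 h2 /h1.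
  by rewrite (le_trans _ h1)// lerNl (le_trans _ h2)// -normrN ler_norm.
have hS : has_inf S by split => //; exists (- M).
exists (inf S); split => delta delta0.
  have [c [r r0 wc] cS] := inf_adherent delta0 hS.
  exists r => //; apply: filterS wc => x wx /wx h; exact: le_trans h (ltW cS).
move=> nb; have := @ge_inf _ S (proj2 hS) _ nb.
by rewrite lerBrDr gerDl leNgt delta0.
Qed.

Definition essential_limit w x0 a :=
  forall e : R, 0 < e -> exists2 r : R, 0 < r &
    {ae mu, forall x, ball x0 r x -> `|w x - a| <= e}.

(** Values of f at nearby points are both compared with w at a common point, whence continuity. For
    each n, the set where w and f differ by more than 1 / (n + 1) is locally negligible, hence
    negligible. *)
Lemma essential_limit_continuous w f : (forall x, essential_limit w x (f x)) ->
  continuous_rep w f.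
Proof.
move=> wf.
have cf x0 e : 0 < e -> exists2 r, 0 < r & forall x, ball x0 r x -> `|f x - f x0| <= e.
  move=> e0; have e20 : 0 < e / 2 by rewrite divr_gt0.
  have [r r0 wr] := wf x0 _ e20.
  have r20 : 0 < r / 2 by rewrite divr_gt0.
  exists (r / 2) => // x xr; have [r' r'0 wr'] := wf x _ e20.
  pose t := Num.min r' (r / 2).
  have t0 : 0 < t by rewrite lt_min r'0.
  have [y yt [h1 h2]] : exists2 y, ball x t y & `|w y - f x0| <= e / 2 /\ `|w y - f x| <= e / 2.
    apply: ae_ball_witness => //; move: wr wr'; apply: filterS2 => y h1 h2 yt.
    split; last by apply: h2; apply: le_ball yt; rewrite ge_min lexx.
    apply: h1; rewrite [r]splitr; apply: ball_triangle xr _.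
    by apply: le_ball yt; rewrite ge_min lexx orbT.
  rewrite (_ : f x - f x0 = (w y - f x0) - (w y - f x)); last by ring.
  by rewrite (le_trans (ler_normB _ _))// [e]splitr lerD.
split.
  move=> x0; apply/(@cvgrPdist_le _ _ _ (nbhs x0) (nbhs_filter x0)) => e e0.
  have [r r0 fr] := cf x0 e e0.
  apply: filterS (nbhsx_ballx x0 r r0) => x xr; rewrite distrC.
  exact: fr.
have Nn n : mu.-negligible [set x | n.+1%:R^-1 < `|w x - f x|].
  apply: locally_negligible => x0.
  have n0 : 0 < n.+1%:R^-1 / 2 :> R by rewrite divr_gt0 ?invr_gt0.
  have [r r0 fr] := cf x0 _ n0; have [r' r'0 wr'] := wf x0 _ n0.
  exists (Num.min r r'); first by rewrite lt_min r0.
  apply: negligibleS wr' => x [/= wx xr] /(_ _) h.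
  have h1 : `|w x - f x0| <= n.+1%:R^-1 / 2.
    by apply: h; apply: le_ball xr; rewrite ge_min lexx orbT.
  have h2 : `|f x - f x0| <= n.+1%:R^-1 / 2.
    by apply: fr; apply: le_ball xr; rewrite ge_min lexx.
  move: wx; rewrite ltNge => /negP; apply.
  rewrite (_ : w x - f x = (w x - f x0) - (f x - f x0)); last by ring.
  by rewrite (le_trans (ler_normB _ _))// [leRHS]splitr lerD.
apply: negligibleS (negligible_bigcup Nn) => x /= fwx.
have wf0 : 0 < `|w x - f x| by rewrite normr_gt0 subr_eq0 eq_sym; exact/eqP.
exists (Num.bound (`|w x - f x|^-1)) => //=.
rewrite invf_plt ?posrE// (lt_le_trans (archi_boundP _)) ?invr_ge0//.
by rewrite ler_nat.
Qed.

End essential_limits.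

(** * Continuity up to the boundary *)

Section continuity.
Context (R : realType) (d : nat) (s : R).
Hypothesis d0 : (0 < d)%N.
Hypothesis s01 : 0 < s < 1.
Local Notation mu := (leb R d).
Variable Om : set 'rV[R]_d.
Hypothesis Om_open : open Om.
Hypothesis Om_bounded : bounded_set Om.
Hypothesis Om_ext : exterior_ball Om.

Let dR0 : 0 < d%:R :> R. Proof. by rewrite ltr0n. Qed.

Let open_ball (E : set 'rV[R]_d) x : nbhs x E -> exists2 r : R, 0 < r & ball x r `<=` E.
Proof. by move=> /nbhs_ballP[r /= r0 rE]; exists r. Qed.

(** At a boundary point, every small cube contains a smaller one, of comparable size, inside the
    exterior ball; off the closure of Om this is immediate. *)
Lemma exterior_density x0 : ~ Om x0 -> exists2 c : R, 0 < c &
  forall rho : R, 0 < rho -> exists2 r, 0 < r <= rho &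
    exists y, ball y (c * r) `<=` ball x0 r `\` Om.
Proof.
move=> x0Om; have [clOm|nclOm] := pselect (closure Om x0); last first.
  have [r0 r00 r0Om] : exists2 r : R, 0 < r & ball x0 r `<=` ~` Om.
    have [r r0 Hr] : exists2 r : R, 0 < r & ball x0 r `<=` ~` closure Om.
      apply: open_ball; apply: open_nbhs_nbhs; split => //.
      exact/closed_openC/closed_closure.
    by exists r => // y /Hr yOm /subset_closure.
  exists 1 => // rho rho0; exists (Num.min r0 rho).
    by rewrite lt_min r00 rho0 ge_min lexx orbT.
  exists x0; rewrite mul1r => y yr; split => //; apply: r0Om.
  by apply: le_ball yr; rewrite ge_min lexx.
have bx0 : boundary Om x0 by split => // /interior_subset.
have [r0 r00 H] := Om_ext; have [c cr cOm] := H _ bx0.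
exists (2 * d%:R)^-1; first by rewrite invr_gt0 mulr_gt0.
move=> rho rho0; pose t := Num.min r0 rho.
have t0 : 0 < t by rewrite lt_min r00.
have tr0 : t <= r0 by rewrite ge_min lexx.
exists t; first by rewrite t0 ge_min lexx orbT.
(* The point at distance t / 2 from x0 towards the centre of the exterior ball: the Euclidean ball
   of radius t / 2 around it fits both in that ball and in the ball of radius t around x0. The
   factor 1 / (2 d) inscribes a cube. *)
pose y := x0 + (t / (2 * r0)) *: (c - x0).
have yx0 : enorm (y - x0) = t / 2.
  rewrite /y addrC addKr enormZ ?divr_ge0 ?mulr_ge0 ?ltW// enormB cr.
  by field; rewrite gt_eqF.
have yc : enorm (y - c) = r0 - t / 2.
  have -> : y - c = (1 - t / (2 * r0)) *: (x0 - c).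
    by rewrite /y; apply/rowP => i; rewrite !mxE; ring.
  have h : t / (2 * r0) <= 1 by rewrite ler_pdivrMr ?mulr_gt0// mul1r; lra.
  rewrite enormZ ?subr_ge0// cr; field; rewrite gt_eqF//.
exists y => z; rewrite -!ball_normE /= => zy.
have ezy : enorm (y - z) < t / 2.
  apply: (le_lt_trans (enorm_le_norm _)).
  move: zy; rewrite -(ltr_pM2l dR0) => /lt_le_trans; apply.
  by rewrite le_eqVlt; apply/orP; left; apply/eqP; field; rewrite gt_eqF.
split.
  apply: (le_lt_trans (norm_le_enorm _)).
  rewrite (_ : x0 - z = - (y - x0) + (y - z)); last by rewrite opprB addrA subrK.
  by rewrite (le_lt_trans (enormD _ _))// enormN yx0; lra.
apply: cOm; rewrite /eball /= (_ : z - c = (y - c) - (y - z)); last first.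
  by rewrite opprB [RHS]addrC addrA subrK.
by rewrite (le_lt_trans (enormD _ _))// enormN yc; lra.
Qed.

(** With u and v the essential upper limits of w and -w, the essential lower limit of w is -v, so
    the claim is u + v <= 0. Otherwise w or -w satisfies the density condition of [weak_decay],
    against the minimality of u or v. *)
Lemma weak_essential_limit G w x0 : weak_bounded s Om G w ->
  exists a, essential_limit w x0 a.
Proof.
move=> wG; have wNG := weak_boundedN wG.
have [Mw _ wM] := weak_bounded_essentially_bounded d0 s01 Om_bounded wG.
have wNM : {ae mu, forall x, `|- w x| <= Mw}.
  by apply: filterS wM => x; rewrite normrN.
have [u [u1 u2]] := essential_limsup x0 wM.
have [v [v1 v2]] := essential_limsup x0 wNM.
suff uv : u + v <= 0.
  exists u => e e0; have [r r0 wr] := u1 _ e0; have [r' r'0 wr'] := v1 _ e0.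
  exists (Num.min r r'); first by rewrite lt_min r0.
  move: wr wr'; apply: filterS2 => x h1 h2 xr.
  have {}h1 := h1 (le_ball _ xr); have {}h2 := h2 (le_ball _ xr).
  have := h1; rewrite ge_min lexx => /(_ isT) {}h1.
  have := h2; rewrite ge_min lexx orbT => /(_ isT) {}h2.
  by rewrite ler_norml; apply/andP; split; lra.
have mw : measurable_fun setT w by case: wG => -[].
have mle (g : 'rV[R]_d -> R) l r : measurable_fun setT g ->
    measurable (ball x0 r `&` [set x | g x <= l]).
  move=> mg; apply: measurableI; first exact: measurable_rV_ball.
  rewrite (_ : [set x | _] = g @^-1` `]-oo, l]%classic); last first.
    by apply/seteqP; split => x /=; rewrite in_itv.
  by rewrite -[X in measurable X]setTI; exact: mg.
have mNw : measurable_fun setT (fun x => - w x) by exact: measurable_funN.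
rewrite leNgt; apply/negP => uv.
have [Omx0|Omx0] := pselect (Om x0).
  have inOm l : (exists2 rho, 0 < rho & ball x0 rho `<=` Om) \/ (0 : R) <= l.
    by left; apply: open_ball; exact: open_nbhs_nbhs.
  (* The midpoint of -v and u, strictly below u, with -l strictly below v. One of {w <= l} and {w >=
     l} fills half of arbitrarily small cubes. *)
  pose l := (u - v) / 2.
  pose A r := ball x0 r `&` [set x | w x <= l].
  pose B r := ball x0 r `&` [set x | - w x <= - l].
  have [H|H] := pselect (forall rho, 0 < rho -> exists2 r, 0 < r <= rho &
      ((2^-1 * (2 * r) ^+ d)%:E <= mu (A r))%E).
    have [||delta [r [delta0 r0 wr]]] := weak_decay d0 s01 Om_bounded wG wM _ _ u1 (inOm l) H.
    - by rewrite /l; lra.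
    - by rewrite invr_gt0.
    by apply: (u2 _ delta0); exists r.
  have {}H : forall rho, 0 < rho -> exists2 r, 0 < r <= rho &
      ((2^-1 * (2 * r) ^+ d)%:E <= mu (B r))%E.
    move=> rho rho0; have [rho1 rho10 H1] : exists2 rho1, 0 < rho1 &
        forall r, 0 < r <= rho1 -> (mu (A r) < (2^-1 * (2 * r) ^+ d)%:E)%E.
      apply: contrapT => nH; apply: H => t t0; apply: contrapT => nr; apply: nH.
      exists t => // r rt; rewrite ltNge; apply/negP => Ar; apply: nr.
      by exists r.
    pose r := Num.min rho rho1; have r0 : 0 < r by rewrite lt_min rho0.
    have r1 : 0 < r <= rho1 by rewrite r0 ge_min lexx orbT.
    exists r; first by rewrite r0 ge_min lexx.
    rewrite leNgt; apply/negP => Br.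
    have : (mu (ball x0 r) <= mu (A r) + mu (B r))%E.
      apply: (le_trans (le_measure _ _ _ (_ : _ `<=` A r `|` B r))); rewrite ?inE.
      - exact: measurable_rV_ball.
      - by apply: measurableU; exact: mle.
      - move=> y yr; have [wy|wy] := leP (w y) l; first by left.
        by right; split => //=; rewrite lerN2 ltW.
      - by apply: measureU2; exact: mle.
    rewrite [X in (X <= _)%E]leb_ball// => h1.
    have := lt_le_trans (lteD (H1 _ r1) Br) (lexx _).
    rewrite ltNge => /negP; apply; apply: le_trans h1.
    by rewrite -EFinD lee_fin; lra.
  have [||delta [r [delta0 r0 wr]]] := weak_decay d0 s01 Om_bounded wNG wNM _ _ v1 (inOm (- l)) H.
  - by rewrite /l; lra.
  - by rewrite invr_gt0.
  by apply: (v2 _ delta0); exists r.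
have [c c0 Hc] := exterior_density Omx0.
have dens (g : 'rV[R]_d -> R) : measurable_fun setT g ->
    (forall x, ~ Om x -> g x = 0) -> forall rho, 0 < rho ->
    exists2 r, 0 < r <= rho &
    ((c ^+ d * (2 * r) ^+ d)%:E <= mu (ball x0 r `&` [set x | (g x <= 0)%R]))%E.
  move=> mg g0 rho rho0; have [r rr [y yr]] := Hc _ rho0.
  exists r => //; have /andP[r0 _] := rr.
  rewrite -exprMn mulrCA -(leb_ball y) ?mulr_gt0//.
  apply: le_measure; rewrite ?inE.
  - exact: measurable_rV_ball.
  - exact: mle.
  - by move=> z /yr[zr /g0 gz]; split => //=; rewrite gz.
have cd0 : 0 < c ^+ d by rewrite exprn_gt0.
(* Outside Om the reference value is 0, attained with positive density in the exterior. As u + v >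
   0, either u or v is positive and can be decreased. *)
have [u0|u0] := ltP 0 u.
  have [delta [r [delta0 r0 wr]]] := weak_decay d0 s01 Om_bounded wG wM u0 cd0 u1
    (or_intror (lexx 0)) (dens w mw (let: And3 _ h _ := wG in h)).
  by apply: (u2 _ delta0); exists r.
have v0 : 0 < v by lra.
have [delta [r [delta0 r0 wr]]] := weak_decay d0 s01 Om_bounded wNG wNM v0 cd0 v1
  (or_intror (lexx 0)) (dens _ mNw (let: And3 _ h _ := wNG in h)).
by apply: (v2 _ delta0); exists r.
Qed.

Lemma weak_continuous_rep G w : weak_bounded s Om G w ->
  exists f, continuous_rep w f.
Proof.
move=> wG; have /choice[f Hf] x := weak_essential_limit x wG.
by exists f; exact: essential_limit_continuous.
Qed.

End continuity.

(** * Level sets under uniform convergence *)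

Section level_sets.
Context (R : realType) (d : nat).
Implicit Types (f g h : 'rV[R]_d -> R) (x y : 'rV[R]_d).

Lemma open_superlevel h theta : continuous h -> open [set x | theta < h x].
Proof.
move=> ch; rewrite (_ : [set x | _] = h @^-1` [set t | theta < t]) //.
by apply: open_comp => // x _; exact: ch.
Qed.

Lemma boundary_superlevel h theta x : continuous h ->
  boundary [set x | theta < h x] x -> h x = theta.
Proof.
move=> ch [clx nintx]; apply/eqP; rewrite eq_le; apply/andP; split.
  rewrite leNgt; apply/negP => hx; apply: nintx.
  by apply: open_nbhs_nbhs; split => //; exact: open_superlevel.
have : closed [set x | theta <= h x].
  rewrite (_ : [set x | _] = h @^-1` [set t | theta <= t]) //.
  by apply: closed_comp => // y _; exact: ch.
apply; apply: closure_subset clx => y /=; exact: ltW.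
Qed.

(** Along the segment from [ym] to [yp], which stays in the convex ball, the superlevel set would be
    both open and closed if no boundary point were met. *)
Lemma boundary_superlevel_between h theta x r yp ym : continuous h ->
  ball x r yp -> ball x r ym -> theta < h yp -> h ym <= theta ->
  exists2 z, ball x r z & boundary [set x | theta < h x] z.
Proof.
move=> ch xyp xym hp hm; apply: contrapT => nz.
pose gam (t : R) : 'rV[R]_d := ym + t *: (yp - ym).
have cgam : continuous gam.
  move=> t; apply: cvgD; first exact: cvg_cst.
  by apply: cvgZr_tmp; exact: cvg_id.
have gamball t : `[0, 1]%classic t -> ball x r (gam t).
  rewrite /= in_itv/= => /andP[t0 t1]; move: xyp xym.
  rewrite -!ball_normE /= => xp xm.
  have -> : x - gam t = (1 - t) *: (x - ym) + t *: (x - yp).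
    by rewrite /gam; apply/rowP => i; rewrite !mxE; ring.
  rewrite (le_lt_trans (ler_normD _ _))// !normrZ !ger0_norm ?subr_ge0//.
  have [->|tn1] := eqVneq t 1; first by rewrite subrr mul0r add0r mul1r.
  have : (1 - t) * `|x - ym| < (1 - t) * r.
    by rewrite ltr_pM2l// subr_gt0 lt_neqAle tn1.
  have : t * `|x - yp| <= t * r by rewrite ler_wpM2l// ltW.
  lra.
pose E := [set x | theta < h x].
pose B : set R := `[0, 1]%classic `&` gam @^-1` E.
have gam0 : gam 0 = ym by rewrite /gam scale0r addr0.
have gam1 : gam 1 = yp by rewrite /gam scale1r addrC subrK.
have B01 : B = `[0, 1]%classic.
  apply: (@segment_connected R 0 1).
  - by exists 1; split; [rewrite /= in_itv/= ler01 lexx|rewrite /= gam1].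
  - exists (gam @^-1` E) => //; apply: open_comp; first by move=> t _; exact: cgam.
    exact: open_superlevel.
  - exists (gam @^-1` closure E).
      by apply: closed_comp; [move=> t _; exact: cgam|exact: closed_closure].
    apply/seteqP; split => t [t01 Et]; split => //=; first exact: subset_closure.
    apply: contrapT => nEt; apply: nz; exists (gam t); first exact: gamball.
    by split => // /interior_subset.
have : B 0 by rewrite B01 /= in_itv/= lexx ler01.
by move=> [_ /=]; rewrite /E /= gam0 ltNge hm.
Qed.

Definition local_min_value f (theta : R) :=
  exists x r, [/\ 0 < r, f x = theta & forall y, ball x r y -> theta <= f y].

(** Each rational cube determines at most one such value, the minimum of f over it, so there are
    countably many. [phi] is the identity for minima and the opposite for maxima, seen as minima of
    -f. *)
Lemma local_min_value_negligible f (phi : R -> R) : injective phi ->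
  {ae lebesgue_measure, forall theta : R, ~ local_min_value f (phi theta)}.
Proof.
move=> phi_inj; pose V (t : 'rV[rat]_d * nat) := [set theta : R |
  (exists2 x, rball t x & f x = phi theta) /\ forall y, rball t y -> phi theta <= f y].
have V1 t a b : V t a -> V t b -> a = b.
  move=> [[x tx fx] Hx] [[y ty fy] Hy]; apply/phi_inj/eqP; rewrite eq_le.
  by apply/andP; split; [rewrite -fy Hx|rewrite -fx Hy].
have NV t : (@lebesgue_measure R).-negligible (V t).
  have [V0|/set0P[a Va]] := eqVneq (V t) set0; first by rewrite V0; exact: negligible_set0.
  exists [set a]; split => //; first exact: lebesgue_measure_set1.
  by move=> b Vb /=; exact: V1 Vb Va.
apply: (negligibleS _ (negligible_countable_bigcup NV)).
move=> theta /= /contrapT[x [r [r0 fx Hx]]].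
have [t tx tr] := rball_sub x r0; exists t => //; split; first by exists x.
by move=> y /tr /Hx.
Qed.

(** At a point of {f = theta} that is no local extremum, f passes strictly above and below theta
    nearby; compactness makes the margin uniform. *)
Lemma level_set_oscillation f theta M rho : continuous f ->
  (forall x, M < `|x| -> f x = 0) -> theta != 0 -> 0 < rho ->
  ~ local_min_value f theta -> ~ local_min_value (fun x => - f x) (- theta) ->
  exists2 eta, 0 < eta & forall x, `|f x - theta| <= eta ->
    exists yp ym, [/\ ball x rho yp, ball x rho ym,
      theta + eta < f yp & f ym < theta - eta].
Proof.
move=> cf f0 theta0 rho0 nmin nmax.
have th0 : 0 < `|theta| by rewrite normr_gt0.
(* Bounded because theta != 0: far away f = 0, at distance |theta| from theta. *)
pose K := [set x | `|f x - theta| <= `|theta| / 2].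
have cK : compact K.
  apply: bounded_closed_compact.
    exists M; split; first exact: num_real.
    move=> N MN x Kx /=; rewrite leNgt; apply/negP => Nx.
    by move: Kx; rewrite /K /= f0 ?(lt_trans MN)// sub0r normrN; lra.
  rewrite (_ : K = f @^-1` `[theta - `|theta| / 2, theta + `|theta| / 2]%classic).
    by apply: closed_comp => [x _|]; [exact: cf|exact: itv_closed].
  by apply/seteqP; split => x /=; rewrite in_itv/= -ler_distl.
pose Q eta x := exists yp ym, [/\ ball x rho yp, ball x rho ym,
      theta + eta < f yp & f ym < theta - eta].
(* The first alternative makes the property hold locally also around points of K where f != theta,
   as the covering argument requires. *)
pose P eta x := eta < `|f x - theta| \/ Q eta x.
have /compact_near_coveringP/(_ _ (0 : R)^'+ P _) near_K := cK.
have KP : \forall eta \near (0 : R)^'+, K `<=` P eta.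
  apply: near_K => x Kx; have [fx|fx] := eqVneq (f x) theta; last first.
    pose a := `|f x - theta| / 2.
    have a0 : 0 < a by rewrite divr_gt0// normr_gt0 subr_eq0.
    have fxa : \forall x' \near x, `|f x - f x'| < a.
      by have /cvgrPdist_lt := cf x; apply.
    exists ([set x' | `|f x - f x'| < a], [set e : R | e < a]).
      by split => //=; exact: nbhs_right_lt.
    move=> [x' e] /= [x'a ea]; left.
    have := ler_normD (f x - f x') (f x' - theta).
    by rewrite addrA subrK; move: x'a ea; rewrite /a; lra.
  have rho20 : 0 < rho / 2 by rewrite divr_gt0.
  have [yp xyp fyp] : exists2 y, ball x (rho / 2) y & theta < f y.
    apply: contrapT => H; apply: nmax; exists x, (rho / 2); split => //; first by rewrite fx.
    move=> y xy; rewrite lerN2 leNgt; apply/negP => yt; apply: H; by exists y.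
  have [ym xym fym] : exists2 y, ball x (rho / 2) y & f y < theta.
    apply: contrapT => H; apply: nmin; exists x, (rho / 2); split => //.
    move=> y xy; rewrite leNgt; apply/negP => yt; apply: H; by exists y.
  pose a := Num.min (f yp - theta) (theta - f ym).
  have a0 : 0 < a by rewrite lt_min !subr_gt0 fyp.
  exists (ball x (rho / 2), [set e : R | e < a]).
    by split => //=; [exact: nbhsx_ballx|exact: nbhs_right_lt].
  move=> [x' e] /= [xx']; rewrite /a lt_min => /andP[ep em].
  right; exists yp, ym; split.
  - by rewrite [rho]splitr; apply: ball_triangle xyp; exact: ball_sym.
  - by rewrite [rho]splitr; apply: ball_triangle xym; exact: ball_sym.
  - lra.
  - lra.
have th20 : 0 < `|theta| / 2 by rewrite divr_gt0.
have [eta [[eta0 etath] KPeta]] : exists eta, (0 < eta /\ eta < `|theta| / 2) /\ K `<=` P eta.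
  apply: (@filter_ex _ ((0 : R)^'+)).
  by apply: filterI KP; apply: filterI; [exact: nbhs_right_gt|exact: nbhs_right_lt].
exists eta => // x fx; have Kx : K x by rewrite /K /= (le_trans fx)// ltW.
by case: (KPeta _ Kx) => //; rewrite ltNge fx.
Qed.

Lemma edist_to_le x z (E : set 'rV[R]_d) : E z ->
  (edist_to x E <= (enorm (x - z))%:E)%E.
Proof. by move=> Ez; apply: ereal_inf_lbound; exists z. Qed.

Lemma excess_ge0 (E F : set 'rV[R]_d) : (0 <= excess E F)%E.
Proof. by apply: ereal_sup_ubound; right. Qed.

Lemma excess_le (E F : set 'rV[R]_d) rho : 0 <= rho ->
  (forall x, E x -> exists2 z, F z & enorm (x - z) <= rho) ->
  (excess E F <= rho%:E)%E.
Proof.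
move=> rho0 H; apply: ge_ereal_sup => _ [[x Ex <-]|->]; last by rewrite lee_fin.
by have [z Fz xz] := H x Ex; rewrite (le_trans (edist_to_le x Fz))// lee_fin.
Qed.

Lemma excess_subset (E F : set 'rV[R]_d) : E `<=` F -> excess E F = 0%E.
Proof.
move=> EF; apply/eqP; rewrite eq_le excess_ge0 andbT.
by apply: excess_le => // x /EF Fx; exists x => //; rewrite subrr enorm0.
Qed.

(** A boundary point of either set has |f - theta| <= eta, so f oscillates beyond theta by more than
    eta close to it. Both f and g then cross theta there, and the crossing yields a point of the
    other boundary. *)
Lemma dH_boundary_superlevel_le f theta M rho : (0 < d)%N -> continuous f ->
  (forall x, M < `|x| -> f x = 0) -> theta != 0 -> 0 < rho ->
  ~ local_min_value f theta -> ~ local_min_value (fun x => - f x) (- theta) ->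
  exists2 eta, 0 < eta & forall g, continuous g ->
    (forall x, `|g x - f x| <= eta) ->
    (dH (boundary [set x | (theta < g x)%R]) (boundary [set x | (theta < f x)%R])
       <= rho%:E)%E.
Proof.
move=> d0 cf f0 theta0 rho0 nmin nmax.
have dR0 : 0 < d%:R :> R by rewrite ltr0n.
have rd0 : 0 < rho / d%:R by rewrite divr_gt0.
have [eta eta0 Heta] := level_set_oscillation cf f0 theta0 rd0 nmin nmax.
have ball_enorm x z : ball x (rho / d%:R) z -> enorm (x - z) <= rho.
  rewrite -ball_normE /= => /ltW xz; apply: (le_trans (enorm_le_norm _)).
  by apply: (le_trans (ler_wpM2l (ltW dR0) xz)); rewrite mulrC divfK// gt_eqF.
exists eta => // g cg gf.
have gf1 x : g x <= f x + eta by have := gf x; rewrite ler_norml => /andP[]; lra.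
have gf2 x : f x - eta <= g x by have := gf x; rewrite ler_norml => /andP[]; lra.
rewrite /dH ge_max; apply/andP; split; apply: excess_le; rewrite ?(ltW rho0)//.
- move=> x /(boundary_superlevel cg) gx.
  have [|yp [ym [xyp xym hp hm]]] := Heta x; first by rewrite -gx distrC.
  have [||z xz bz] := boundary_superlevel_between (theta := theta) cf xyp xym.
  + by rewrite (lt_trans _ hp)// ltrDl.
  + by rewrite (le_trans (ltW hm))// gerBl ltW.
  by exists z => //; exact: ball_enorm.
- move=> x /(boundary_superlevel cf) fx.
  have [|yp [ym [xyp xym hp hm]]] := Heta x; first by rewrite fx subrr normr0 ltW.
  have [||z xz bz] := boundary_superlevel_between (theta := theta) cg xyp xym.
  + by have := gf2 yp; lra.
  + by have := gf1 ym; lra.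
  by exists z => //; exact: ball_enorm.
Qed.

End level_sets.

Lemma cvge0_ge0 (R : realType) (T : Type) (F : set_system T) (f : T -> \bar R) :
  Filter F -> (forall x, (0 <= f x)%E) ->
  (forall e : R, 0 < e -> \forall x \near F, (f x <= e%:E)%E) ->
  f x @[x --> F] --> 0%E.
Proof.
move=> FF f0 fe; apply/fine_cvgP; split.
  apply: filterS (fe 1 ltr01) => x fx.
  by rewrite ge0_fin_numE// (le_lt_trans fx)// ltry.
apply/cvgrPdist_le => e e0; apply: filterS (fe e e0) => x fx.
rewrite /= sub0r normrN ger0_norm ?fine_ge0//.
by rewrite -lee_fin fineK// ge0_fin_numE// (le_lt_trans fx)// ltry.
Qed.

(** * The regularized problem *)

(** Derivative-free first-order condition: take t = a / (b + 1), the 1 keeping the denominator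
    positive. *)
Lemma linear_le_quadratic_eq0 (R : realFieldType) (a b : R) :
  (forall t, t * a <= t ^+ 2 * b) -> a = 0.
Proof.
move=> H; have b0 : 0 <= b by have := H 1; have := H (-1); lra.
have b1 : 0 < b + 1 by rewrite ltr_wpDl.
have := H (a / (b + 1)); rewrite expr_div_n -mulrA => h.
have : a ^+ 2 * (b + 1) <= a ^+ 2 * b.
  have := ler_wpM2r (sqr_ge0 (b + 1)) h.
  rewrite (_ : a * ((b + 1)^-1 * a) * (b + 1) ^+ 2 = a ^+ 2 * (b + 1)); last first.
    by field; rewrite gt_eqF.
  rewrite (_ : a ^+ 2 * ((b + 1) ^+ 2)^-1 * b * (b + 1) ^+ 2 = a ^+ 2 * b)//.
  by field; rewrite gt_eqF.
rewrite mulrDr mulr1 gerDl => a2; apply/eqP; rewrite -sqrf_eq0 eq_le a2.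
exact: sqr_ge0.
Qed.

(** * Optimality conditions in weak form *)

Section hilbert.
Context (R : realType) (H : normedModType R) (dot : H -> H -> R).
Hypothesis hdot : inner_product dot.

Lemma dotC x y : dot x y = dot y x. Proof. by case: hdot. Qed.

Lemma dotDZl a x y z : dot (a *: x + y) z = a * dot x z + dot y z.
Proof. by case: hdot. Qed.

Lemma dotxx x : dot x x = `|x| ^+ 2. Proof. by case: hdot. Qed.

Lemma dot0l z : dot 0 z = 0.
Proof.
have := dotDZl 1 0 0 z; rewrite scaler0 addr0 mul1r => /eqP.
by rewrite -subr_eq subrr eq_sym => /eqP.
Qed.

Lemma dotZl a x z : dot (a *: x) z = a * dot x z.
Proof. by rewrite -[a *: x]addr0 dotDZl dot0l addr0. Qed.

Lemma dotDl x y z : dot (x + y) z = dot x z + dot y z.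
Proof. by rewrite -[x]scale1r dotDZl mul1r scale1r. Qed.

Lemma dotNl x z : dot (- x) z = - dot x z.
Proof. by rewrite -scaleN1r dotZl mulN1r. Qed.

Lemma dotBl x y z : dot (x - y) z = dot x z - dot y z.
Proof. by rewrite dotDl dotNl. Qed.

(** The norm is given beforehand with its triangle inequality, and Cauchy-Schwarz follows by
    squaring it: the reverse of the usual order. *)
Lemma dot_le_norm x y : dot x y <= `|x| * `|y|.
Proof.
have : `|x + y| ^+ 2 <= (`|x| + `|y|) ^+ 2.
  by rewrite lerXn2r ?nnegrE ?addr_ge0// ler_normD.
rewrite -dotxx dotDl 2!(dotC _ (x + y)) !dotDl !dotxx (dotC y x) sqrrD.
lra.
Qed.

End hilbert.

Section Lp_functions.
Context (R : realType) (d : nat) (s : R).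
Hypothesis d0 : (0 < d)%N.
Hypothesis s01 : 0 < s < 1.
Local Notation mu := (leb R d).
Variable Om : set 'rV[R]_d.
Hypothesis Om_bounded : bounded_set Om.

(** The L^oo norm unfolds to an essential supremum under this condition. *)
Lemma leb_setT_gt0 : (0 < mu [set: 'rV[R]_d])%E.
Proof.
have : (mu (ball (0%R : 'rV[R]_d) 1%R) <= mu setT)%E.
  by apply: le_measure; rewrite ?inE//; exact: measurable_rV_ball.
by apply: lt_le_trans; rewrite [X in (_ < X)%E]leb_ball// lte_fin exprn_gt0// mulr1.
Qed.

(** For 1 <= p <= 2, |u|^p is at most 1 + u^2 on the bounded set Om, and u is square integrable by
    the Poincare inequality. So A acts linearly on all competitors and test functions. *)
Lemma Hs0_LpO (p : R) u : 1 <= p <= 2 -> Hs0 s Om u -> LpO Om p%:E u.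
Proof.
move=> /andP[p1 p2] [mu_ u0 fu]; split => //; apply/andP; split.
  by rewrite inE.
have p0 : 0 < p by apply: lt_le_trans p1.
rewrite inE /= /finite_norm unlock /Lnorm.
apply: poweR_lty.
have [M M0 OmM] := bounded_sub_ball Om_bounded.
have [kappa kappa0 poincare] := poincare_inequality d0 s01 Om_bounded.
have mB : measurable (ball (0 : 'rV[R]_d) M) by exact: measurable_rV_ball.
have mind : measurable_fun setT (fun x => (\1_(ball (0%R : 'rV[R]_d) M) x : R)%:E).
  by apply/measurable_EFinP; exact: measurable_indic.
have mu2_ : measurable_fun setT (fun x => (u x ^+ 2)%:E).
  by apply/measurable_EFinP; exact: measurable_funX.
apply: (@le_lt_trans _ _ (\int[mu]_x ((\1_(ball (0%R : 'rV[R]_d) M) x)%:E + (u x ^+ 2)%:E))%E).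
  apply: ge0_le_integral => //.
  - by move=> x _; exact: poweR_ge0.
  - apply: (measurableT_comp (measurable_poweR p)).
    by apply: measurableT_comp => //; exact/measurable_EFinP.
  - exact: emeasurable_funD.
  - move=> x _ /=; rewrite -EFinD -[X in (X <= _)%E]/((`|u x| `^ p)%:E) lee_fin.
    have [Omx|Omx] := pselect (Om x); last first.
      by rewrite u0// normr0 powR0 ?gt_eqF// addr_ge0// sqr_ge0.
    rewrite indicE mem_set; last exact: OmM.
    have [u1|u1] := leP `|u x| 1.
      rewrite (@le_trans _ _ 1)//; last by rewrite lerDl sqr_ge0.
      have := @ge0_ler_powR R p (ltW p0) `|u x| 1; rewrite powR1.
      by apply; rewrite // nnegrE.
    rewrite (@le_trans _ _ (`|u x| `^ 2%:R))//; first by rewrite ler_powR// ltW.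
    by rewrite powR_mulrn// real_normK ?num_real// lerDr.
rewrite ge0_integralD//; last by move=> x _; rewrite lee_fin sqr_ge0.
apply: lte_add_pinfty.
  by rewrite integral_indic// setIT [X in (X < _)%E]leb_ball// ltry.
have := le_lt_trans (poincare u mu_ u0) fu.
by case: (\int[mu]_x _)%E => [r|//|//]; rewrite ?ltry// gt0_muley// lte_fin.
Qed.

Lemma Linfty_ae_le (g : 'rV[R]_d -> R) M :
  ('N[mu]_+oo[EFin \o g] <= M%:E)%E -> {ae mu, forall x, `|g x| <= M}.
Proof.
rewrite unlock /Lnorm leb_setT_gt0 => /ess_supP; apply: filterS => x /=.
by rewrite lee_fin.
Qed.

End Lp_functions.

Lemma open_negligible_empty (R : realType) (d : nat) (V : set 'rV[R]_d) :
  open V -> (leb R d).-negligible V -> forall x, ~ V x.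
Proof.
move=> oV nV x Vx; have /nbhs_ballP[r /= r0 rV] := open_nbhs_nbhs (conj oV Vx).
have := @ae_ball_witness R d (fun=> False) x r r0.
case=> //; apply: negligibleS nV => y /= /not_implyP[yr _]; exact: rV.
Qed.

Section regularized_problem.
Context (R : realType) (d : nat) (s p : R) (q : \bar R).
Hypotheses (d0 : (0 < d)%N) (s01 : 0 < s < 1) (hp : 1 <= p <= 2).
Local Notation mu := (leb R d).
Variable Om : set 'rV[R]_d.
Hypothesis Om_bounded : bounded_set Om.
Variables (H : normedModType R) (dot : H -> H -> R).
Hypothesis hdot : inner_product dot.
Variable A : ('rV[R]_d -> R) -> H.
Hypothesis hA : bounded_linear_LpO Om p%:E A.
Variable As : H -> 'rV[R]_d -> R.
Hypothesis hAs : is_adjoint Om p%:E q dot A As.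
Variable MA : R.
Hypothesis MA0 : 0 <= MA.
Hypothesis As_le : forall h, {ae mu, forall x, `|As h x| <= MA * `|h|}.
Implicit Types (u v phi psi : 'rV[R]_d -> R) (h : H).

Let LpO_Hs0 u : Hs0 s Om u -> LpO Om p%:E u.
Proof. exact: Hs0_LpO. Qed.

Lemma Hs0_finite_energy u : Hs0 s Om u -> finite_energy s u.
Proof. by case. Qed.

Let Hs0_0 : Hs0 s Om (fun=> 0).
Proof.
split => //.
rewrite /Hs_sq (eq_integral (cst 0%E)) ?integral0 ?ltry// => x _.
by rewrite (eq_integral (cst 0%E)) ?integral0// => y _; rewrite subrr normr0 expr0n/= mul0r.
Qed.

Let A0 : A (fun=> 0) = 0.
Proof.
have z0 := LpO_Hs0 Hs0_0.
have [lin _] := hA; have := lin 1 _ _ z0 z0.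
rewrite (_ : (fun x => _) = (fun=> 0)); last by apply/funext => x; rewrite mulr0 addr0.
by rewrite scale1r => /eqP; rewrite -subr_eq subrr eq_sym => /eqP.
Qed.

Lemma A_linear a u v : LpO Om p%:E u -> LpO Om p%:E v ->
  A (fun x => a * u x + v x) = a *: A u + A v.
Proof. by case: hA => lin _; exact: lin. Qed.

Lemma Hs0_linear a u v : Hs0 s Om u -> Hs0 s Om v -> Hs0 s Om (fun x => a * u x + v x).
Proof.
move=> [mu_ u0 fu] [mv v0 fv].
have [m f] := finite_energyD (finite_energyZ a (conj mu_ fu)) (conj mv fv).
by split => // x Omx; rewrite u0// v0// mulr0 addr0.
Qed.

Lemma Hs_sq_linear a u v : Hs0 s Om u -> Hs0 s Om v ->
  Hs_sq s (fun x => a * u x + v x) =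
  (a ^+ 2 * eform s u u + 2 * a * eform s v u + eform s v v)%:E.
Proof.
move=> hu hv; have [fu fv] := (Hs0_finite_energy hu, Hs0_finite_energy hv).
have fau := finite_energyZ a fu.
have fw := finite_energyD fau fv.
rewrite (Hs_sq_form fw); congr EFin.
rewrite (eformDl fau fv fw) (eformDr fau fau fv) (eformDr fv fau fv).
rewrite (eformZl _ fu fau) (eformZr _ fu fu) (eformZl _ fu fv) (eformZr _ fv fu).
by rewrite (eformC s u v); ring.
Qed.

(** Varying u by t phi with t of either sign, the energy is quadratic in t, so its linear part must
    match the pairing with A^* h. *)
Lemma subgradient_weak_equation u h phi : subgradient s Om p%:E q u (As h) ->
  Hs0 s Om phi -> eform s u phi = dot h (A phi).
Proof.
move=> [Lu fu _ sub] hphi.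
have hu : Hs0 s Om u.
  case: Lu => /andP[+ _] u0; rewrite inE => mu_; by split.
have fphi := Hs0_finite_energy hphi.
apply/eqP; rewrite eq_sym -subr_eq0; apply/eqP.
apply: (@linear_le_quadratic_eq0 _ _ (2^-1 * eform s phi phi)) => t.
(* The [+ 0] gives the variation the shape a u + v in which linearity is stated. *)
have Ltphi : LpO Om p%:E (fun x => t * phi x + 0) by apply: LpO_Hs0; exact: (Hs0_linear t hphi Hs0_0).
have := sub _ Ltphi; have [_ adj] := hAs h; rewrite adj//.
rewrite (A_linear t (LpO_Hs0 hphi) (LpO_Hs0 Hs0_0)) A0 addr0.
have -> : (fun x => u x + (t * phi x + 0)) = (fun x => t * phi x + u x).
  by apply/funext => x; rewrite addr0 addrC.
rewrite Hs_sq_linear// (Hs_sq_form (Hs0_finite_energy hu)) -!EFinM -EFinD lee_fin.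
rewrite (dotC hdot) (dotZl hdot) (dotC hdot (A phi)).
lra.
Qed.

Lemma minimizer_weak_equation f alpha n u phi : 0 < alpha ->
  is_minimizer s Om A f alpha n u -> Hs0 s Om phi ->
  alpha * eform s u phi = dot (f + n - A u) (A phi).
Proof.
move=> alpha0 [hu umin] hphi.
apply/eqP; rewrite eq_sym -subr_eq0; apply/eqP.
apply: (@linear_le_quadratic_eq0 _ _
  (2^-1 * (`|A phi| ^+ 2 + alpha * eform s phi phi))) => t.
have := umin _ (Hs0_linear t hphi hu); rewrite /tikhonov Hs_sq_linear//.
rewrite (Hs_sq_form (Hs0_finite_energy hu)) -!EFinM -!EFinD lee_fin.
rewrite (A_linear t (LpO_Hs0 hphi) (LpO_Hs0 hu)).
have -> : t *: A phi + A u - f - n = t *: A phi - (f + n - A u).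
  by rewrite !opprD opprK !addrA [RHS]addrAC; congr (_ - n); rewrite addrAC.
have -> : A u - f - n = - (f + n - A u) by rewrite !opprD opprK [RHS]addrC addrA.
move: (f + n - A u) => r; rewrite normrN -!(dotxx hdot).
rewrite !(dotBl hdot) !(dotZl hdot) !(dotC hdot _ (t *: _ - r)) !(dotBl hdot) !(dotZl hdot).
rewrite (dotC hdot r).
lra.
Qed.

(** Through the adjoint this is the integral of psi >= 0 against a function of L^oo; it is what
    bounds the right-hand side of the weak equations. *)
Lemma dot_A_test_le h psi : test_function s Om psi ->
  `|dot h (A psi)| <= MA * `|h| * (\int[mu]_x psi x)%R.
Proof.
move=> tpsi; have [[mpsi fpsi] psi_out psi_ge0 _] := tpsi.
have hpsi : Hs0 s Om psi by split.
have ipsi := integrable_test_function Om_bounded tpsi.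
have [[/andP[+ _] _] adj] := hAs h; rewrite inE => mAs.
have -> : dot h (A psi) = fine (\int[mu]_x (As h x * psi x)%:E)%E.
  rewrite -[LHS]/(fine (dot h (A psi))%:E) -(adj _ (LpO_Hs0 hpsi)) integral_mkcond.
  congr fine; apply: eq_integral => x _; rewrite /patch.
  by case: ifPn => // /negP xOm; rewrite psi_out ?mulr0// => Omx; apply: xOm; rewrite inE.
have mf : measurable_fun setT (fun x => (As h x * psi x)%:E).
  by apply/measurable_EFinP; exact: measurable_funM.
have bnd : (\int[mu]_x `|(As h x * psi x)%:E| <=
    (MA * `|h| * (\int[mu]_x psi x)%R)%:E)%E.
  rewrite EFinM (_ : (\int[mu]_x psi x)%R%:E = \int[mu]_x (psi x)%:E)%E; last first.
    by rewrite /Rintegral fineK// integrable_fin_num.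
  rewrite -ge0_integralZl; last 4 first.
  - by [].
  - exact/measurable_EFinP.
  - by move=> x _; rewrite lee_fin.
  - by rewrite lee_fin mulr_ge0.
  apply: ae_ge0_le_integral => //.
  - exact: measurableT_comp.
  - by move=> x _; rewrite -EFinM lee_fin !mulr_ge0.
  - by apply: measurable_funeM; exact/measurable_EFinP.
  - apply: filterS (As_le h) => x hx _; rewrite -EFinM abse_EFin lee_fin normrM.
    by rewrite (ger0_norm (psi_ge0 x)) ler_wpM2r.
have fin : (\int[mu]_x (As h x * psi x)%:E)%E \is a fin_num.
  rewrite -integral_fin_num_abs//; last exact: measurable_funM.
  by rewrite (le_lt_trans bnd)// ltry.
rewrite -lee_fin; apply: le_trans bnd.
rewrite -abse_EFin fineK//; exact: le_abse_integral.
Qed.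

Lemma weak_bounded_of_equation w h : Hs0 s Om w ->
  (forall phi, Hs0 s Om phi -> eform s w phi = dot h (A phi)) ->
  weak_bounded s Om (MA * `|h|) w.
Proof.
move=> hw weq; split; [exact: Hs0_finite_energy|by case: hw|].
move=> psi tpsi; rewrite weq; first exact: dot_A_test_le.
by case: tpsi => -[mpsi fpsi] psi0 _ _; split.
Qed.

Lemma source_error_estimate f alpha n ud z u : 0 < alpha ->
  A ud = f -> Hs0 s Om ud ->
  (forall phi, Hs0 s Om phi -> eform s ud phi = dot z (A phi)) ->
  is_minimizer s Om A f alpha n u ->
  exists2 v : H, `|v| <= `|n| / alpha + `|z| &
    (forall phi, Hs0 s Om phi ->
       eform s (fun x => -1 * ud x + u x) phi = dot v (A phi)) /\
    eform s (fun x => -1 * ud x + u x) (fun x => -1 * ud x + u x) <=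
      `|v| * (`|n| + alpha * (`|v| + `|z|)).
Proof.
move=> alpha0 Aud hud udeq umin; have [hu _] := umin.
pose P := alpha^-1 *: (f + n - A u).
have ueq phi : Hs0 s Om phi -> eform s u phi = dot P (A phi).
  move=> hphi; rewrite /P (dotZl hdot) -(minimizer_weak_equation alpha0 umin hphi).
  by rewrite mulrA mulVf ?gt_eqF// mul1r.
have weq phi : Hs0 s Om phi ->
    eform s (fun x => -1 * ud x + u x) phi = dot (P - z) (A phi).
  move=> hphi; have [fud fu fphi] := And3 (Hs0_finite_energy hud)
    (Hs0_finite_energy hu) (Hs0_finite_energy hphi).
  rewrite (eformDl (finite_energyZ (-1) fud) fu fphi) (eformZl _ fud fphi).
  by rewrite (ueq _ hphi) (udeq _ hphi) (dotBl hdot) mulN1r addrC.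
have hw := Hs0_linear (-1) hud hu.
have Aw : A (fun x => -1 * ud x + u x) = n - alpha *: P.
  rewrite (A_linear _ (LpO_Hs0 hud) (LpO_Hs0 hu)) Aud scaleN1r /P scalerA.
  rewrite divff ?gt_eqF// scale1r -[f + n - _]addrA opprD opprB addrCA (addrC n).
  by rewrite subrK.
have E1 : eform s (fun x => -1 * ud x + u x) (fun x => -1 * ud x + u x) =
    dot (P - z) (n - alpha *: P).
  by rewrite weq// Aw.
set v := P - z in weq E1.
have Pv : P = v + z by rewrite /v subrK.
have nv := normr_ge0 v.
exists v; last split => //.
  (* Energy is nonnegative: with P = v + z this reads alpha |v|^2 <= <v, n - alpha z>, and dividing
     by alpha |v| bounds v. *)
  have := eform_ge0 s (fun x => -1 * ud x + u x); rewrite E1 Pv.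
  rewrite scalerDr opprD addrA addrAC (dotC hdot) (dotBl hdot) (dotZl hdot) (dotxx hdot).
  have := dot_le_norm hdot (n - alpha *: z) v.
  have : `|n - alpha *: z| <= `|n| + alpha * `|z|.
    by rewrite (le_trans (ler_normB _ _))// normrZ gtr0_norm.
  move: (dot _ v) `|n - alpha *: z| => D N hN hD h0.
  have [v0|v0] := eqVneq `|v| 0; first by rewrite v0 addr_ge0// divr_ge0// ltW.
  have vp : 0 < `|v| by rewrite lt_neqAle eq_sym v0 nv.
  rewrite -(ler_pM2l alpha0) -(ler_pM2r vp) mulrDr mulrCA divff ?gt_eqF// mulr1.
  have := ler_wpM2r nv hN; lra.
rewrite E1; apply: (le_trans (dot_le_norm hdot _ _)).
rewrite ler_wpM2l// (le_trans (ler_normB _ _))// lerD2l normrZ gtr0_norm//.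
by rewrite ler_pM2l// Pv ler_normD.
Qed.

End regularized_problem.

Lemma continuous_normr (R : realType) (T : topologicalType) (g : T -> R) :
  continuous g -> continuous (fun x => `|g x|).
Proof. by move=> cg x; apply: (continuous_comp (cg x)); exact: norm_continuous. Qed.

Theorem theorem3 (R : realType) (d : nat) (s p : R) (q : \bar R)
  (hs : 0 < s < 1) (hd : 2 * s < d%:R) (hp : 1 <= p <= 2)
  (hpq : (p%:E^-1 + q^-1 = 1)%E) (hq : ((d%:R / (2 * s))%:E < q)%E)
  (Om : set 'rV[R]_d)
  (Om_open : open Om) (Om_bounded : bounded_set Om)
  (Om_Lip : Lipschitz_boundary Om) (Om_ext : exterior_ball Om)
  (H : completeNormedModType R) (dot : H -> H -> R) (hdot : inner_product dot)
  (A : ('rV[R]_d -> R) -> H) (hA : bounded_linear_LpO Om p%:E A)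
  (As : H -> 'rV[R]_d -> R) (hAs : is_adjoint Om p%:E q dot A As)
  (As_compact : compact_to_LpO Om q As)
  (As_Linfty : bounded_to_LpO Om +oo%E As)
  (f : H) (ud : 'rV[R]_d -> R) (hud : LpO Om p%:E ud)
  (ud_ge0 : {ae leb R d, forall x, 0 <= ud x}) (Aud : A ud = f)
  (z : H) (source : subgradient s Om p%:E q ud (As z))
  (U : R -> H -> 'rV[R]_d -> R)
  (hU : forall alpha n, 0 < alpha -> is_minimizer s Om A f alpha n (U alpha n))
  (C : R) :
  exists (udc : 'rV[R]_d -> R) (Uc : R -> H -> 'rV[R]_d -> R),
  [/\ continuous_rep ud udc,
      forall alpha n, 0 < alpha -> continuous_rep (U alpha n) (Uc alpha n),
      {ae lebesgue_measure, forall theta : R, 0 < theta ->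
        forall eps : R, 0 < eps ->
          excess [set x | theta < Uc an.1 an.2 x]
                 [set x | theta - eps <= udc x]
            @[an --> small_noise C] --> 0%E /\
          excess [set x | Uc an.1 an.2 x <= theta]
                 [set x | udc x <= theta + eps]
            @[an --> small_noise C] --> 0%E}
    & {ae lebesgue_measure, forall theta : R, theta != 0 ->
        density_estimates [set x | theta < udc x]} ->
      {ae lebesgue_measure, forall theta : R, theta != 0 ->
        dH [set x | theta - eps <= udc x] [set x | theta < udc x]
          @[eps --> 0^'+] --> 0%E ->
        dH (boundary [set x | theta < Uc an.1 an.2 x])
           (boundary [set x | theta < udc x])
          @[an --> small_noise C] --> 0%E}].
Proof.
have /andP[s0 s1] := hs.
have d0 : (0 < d)%N by rewrite -(ltr0n R) (lt_trans _ hd)// mulr_gt0.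
have [M HM] := As_Linfty.
have As_le h : {ae leb R d, forall x, `|As h x| <= `|M| * `|h|}.
  have [_ /Linfty_ae_le] := HM h; apply: filterS => x /le_trans; apply.
  by rewrite ler_wpM2r// ler_norm.
have hud0 : Hs0 s Om ud.
  by case: source => _ fud _ _; case: hud => /andP[+ _] ud0; rewrite inE => mud; split.
have udeq phi : Hs0 s Om phi -> eform s ud phi = dot z (A phi).
  exact: (subgradient_weak_equation d0 hs hp Om_bounded hdot hA hAs source).
have M0 : 0 <= `|M| by [].
have weak_of w h := weak_bounded_of_equation d0 hs hp Om_bounded hAs M0 As_le (w := w) (h := h).
have [udc rep_ud] := weak_continuous_rep d0 hs Om_open Om_bounded Om_ext (weak_of _ _ hud0 udeq).
(* Representatives are selected for all pairs at once; for alpha <= 0 the value 0 is a filler. *)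
have /choice[V HV] : forall an : R * H, exists g, 0 < an.1 ->
    continuous_rep (U an.1 an.2) g.
  move=> [alpha n] /=; have [alpha0|] := ltP 0 alpha; last by exists (fun=> 0).
  have [hu _] := hU alpha n alpha0.
  have ueq phi : Hs0 s Om phi -> eform s (U alpha n) phi =
      dot (alpha^-1 *: (f + n - A (U alpha n))) (A phi).
    move=> hphi; rewrite (dotZl hdot).
    rewrite -(minimizer_weak_equation d0 hs hp Om_bounded hdot hA alpha0 (hU alpha n alpha0) hphi).
    by rewrite mulrA mulVf ?gt_eqF// mul1r.
  have [g Hg] := weak_continuous_rep d0 hs Om_open Om_bounded Om_ext (weak_of _ _ hu ueq).
  by exists g.
pose Uc alpha n := V (alpha, n).
have rep_U alpha n : 0 < alpha -> continuous_rep (U alpha n) (Uc alpha n).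
  by move=> alpha0; exact: (HV (alpha, n)).
have unif eta : 0 < eta -> \forall an \near small_noise C,
    0 < an.1 /\ forall x, `|Uc an.1 an.2 x - udc x| <= eta.
  (* [K] bounds the residual v for all admissible pairs, so a single constant |M| K controls all the
     equations and [delta] is uniform in alpha and n. *)
  move=> eta0; pose K := `|C| + `|z|.
  have K0 : 0 <= K by rewrite addr_ge0.
  have [delta delta0 small] :=
    weak_bounded_uniformly_small d0 hs Om_bounded (`|M| * K) eta0.
  (* The energy is at most K (t + t (K + |z|)) when |n| and alpha are below t; the added 1 avoids a
     zero denominator when K = 0. *)
  pose t := delta / (K * (1 + (K + `|z|)) + 1).
  have den0 : 0 < K * (1 + (K + `|z|)) + 1.
    by rewrite ltr_wpDl// mulr_ge0// addr_ge0// addr_ge0.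
  have t0 : 0 < t by rewrite divr_gt0.
  apply: filterS (nbhsx_ballx ((0, 0) : R * H) t t0) => an [/= an1 an2] [an0 anC].
  split => // x.
  have {}an1 : an.1 < t.
    by move: an1; rewrite -ball_normE /= sub0r normrN gtr0_norm.
  have {}an2 : `|an.2| < t by move: an2; rewrite -ball_normE /= sub0r normrN.
  have [v vle [veq vE]] := source_error_estimate d0 hs hp Om_bounded hdot hA an0
    Aud hud0 udeq (hU an.1 an.2 an0).
  pose w x := -1 * ud x + U an.1 an.2 x.
  have [hu _] := hU an.1 an.2 an0.
  have hw : Hs0 s Om w by exact: Hs0_linear.
  have vK : `|v| <= K.
    by rewrite (le_trans vle)// lerD2r (le_trans anC)// ler_norm.
  have wG : weak_bounded s Om (`|M| * K) w.
    apply: weak_boundedW (weak_of _ _ hw veq).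
    by rewrite ler_wpM2l.
  have wdelta : (Hs_sq s w <= delta%:E)%E.
    rewrite (Hs_sq_form (Hs0_finite_energy hw)) lee_fin (le_trans vE)//.
    have h1 : `|an.2| + an.1 * (`|v| + `|z|) <= t + t * (K + `|z|).
      by rewrite lerD ?(ltW an2)// ler_pM ?(ltW an0) ?(ltW an1) ?addr_ge0// lerD2r.
    have h2 : 0 <= `|an.2| + an.1 * (`|v| + `|z|).
      by rewrite addr_ge0// mulr_ge0 ?addr_ge0// ltW.
    apply: (le_trans (ler_pM (normr_ge0 v) h2 vK h1)).
    have <- : t * (K * (1 + (K + `|z|)) + 1) = delta by rewrite divfK// gt_eqF.
    lra.
  have wNdelta : (Hs_sq s (fun x => - w x)%R <= delta%:E)%E by rewrite Hs_sqN.
  have ae1 := small _ wG wdelta.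
  have ae2 := small _ (weak_boundedN wG) wNdelta.
  have [cUc aeUc] := rep_U an.1 an.2 an0; have [cudc aeudc] := rep_ud.
  (* The set where the continuous representatives differ by more than eta is open and negligible,
     hence empty. *)
  rewrite leNgt; apply/negP.
  apply: (open_negligible_empty (V := [set x | eta < `|Uc an.1 an.2 x - udc x|])).
    apply: open_superlevel; apply: continuous_normr => y.
    exact: (@cvgB _ _ _ _ (nbhs_filter y) _ _ _ _ (cUc y) (cudc y)).
  have aew : {ae leb R d, forall y, [/\ w y <= eta, - w y <= eta,
      Uc an.1 an.2 y = U an.1 an.2 y & udc y = ud y]}.
    by apply: filterS2 (filterI ae1 ae2) (filterI aeUc aeudc) => y [h1 h2] [h3 h4].
  apply: negligibleS aew => y /= hy [h1 h2 h3 h4].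
  move: hy; rewrite h3 h4 ltNge ler_norml; case/negP.
  by move: h1 h2; rewrite /w; lra.
exists udc, Uc; split => //.
(* Once the uniform distance is at most eps, both inclusions of level sets hold exactly and the
   excesses are 0. *)
- apply: aeW => theta theta0 eps eps0; split.
    apply: cvge0_ge0 => [|e e0]; first by move=> an; exact: excess_ge0.
    apply: filterS (unif _ eps0) => an [_ close].
    rewrite excess_subset ?lee_fin ?ltW// => x /= hx.
    by have := close x; rewrite ler_norml => /andP[_]; lra.
  apply: cvge0_ge0 => [|e e0]; first by move=> an; exact: excess_ge0.
  apply: filterS (unif _ eps0) => an [_ close].
  rewrite excess_subset ?lee_fin ?ltW// => x /= hx.
  by have := close x; rewrite ler_norml => /andP[+ _]; lra.
- move=> _.
  have [B B0 OmB] := bounded_sub_ball Om_bounded.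
  have [cud ae_ud] := rep_ud.
  (* [udc] agrees with [ud] only almost everywhere, so its vanishing at a large x again uses that an
     open negligible set is empty. *)
  have udc0 x : B < `|x| -> udc x = 0.
    move=> Bx; apply/eqP; rewrite -normr_le0 leNgt; apply/negP => ux.
    apply: (open_negligible_empty
      (V := [set x | B < `|x|] `&` [set x | 0 < `|udc x|]) _ _ (conj Bx ux)).
      apply: openI; first by apply: open_superlevel => y; exact: norm_continuous.
      by apply: open_superlevel; exact: continuous_normr.
    apply: negligibleS ae_ud => y /= [By uy] /= uyE; move: uy; rewrite uyE.
    case: hud => _ ->; first by rewrite normr0 ltxx.
    by move=> /OmB; rewrite -ball_normE /= sub0r normrN ltNge (ltW By).
  have ae_min := local_min_value_negligible udc (@inj_id R).
  have ae_max := local_min_value_negligible (fun x => - udc x) (@oppr_inj R).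
  have FF := @ae_filter_ringOfSetsType _ _ _ (@lebesgue_measure R).
  (* The exceptional levels are the local minimum values of [udc] and the opposites of those of
     [- udc]. *)
  apply: filterS2 ae_min ae_max => theta nmin nmax theta0 _.
  apply: cvge0_ge0 => [|e e0]; first by move=> an; rewrite le_max excess_ge0.
  have [eta eta0 Heta] := dH_boundary_superlevel_le d0 cud udc0 theta0 e0 nmin nmax.
  apply: filterS (unif _ eta0) => an [an0 close].
  by apply: Heta => //; case: (rep_U an.1 an.2 an0).
Qed.
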